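(* Let $a,b\in(0,1)$ satisfy $2a^2+2b^2<1$. Let $c_1=c_1(a,b)\in(0,2)$ be the unique solution to $2a^{c_1}+2b^{c_1}=1$ and let $c_2=c_2(a,b)=\log 2/|\log a-\log b|\in(0,\infty]$. For $\alpha\in(c_1,2)$, let $S_1,\ldots,S_7$ be i.i.d. with $S_1\sim S_\alpha(1,0,0)$ and define $$\begin{aligned} X_1&=aS_1+bS_2+bS_4+aS_5+(1-2a^\alpha-2b^\alpha)^{1/\alpha}S_7,\\ X_2&=aS_2+bS_3+bS_5+aS_6+(1-2a^\alpha-2b^\alpha)^{1/\alpha}S_7,\\ X_3&=bS_1+aS_3+aS_4+bS_6+(1-2a^\alpha-2b^\alpha)^{1/\alpha}S_7. \end{aligned}$$ Then $X_{\alpha}=(X_1,X_2,X_3)$ is a symmetric $\alpha$-stable vector whose law is invariant under all permutations of the coordinates, and the following holds. (i) If $c_2\le c_1$, then for all $\alpha\in(c_1,2)$, $X_\alpha^h$ is a color process for all sufficiently large $h$. (ii) If $c_2\ge 2$, then for all $\alpha\in(c_1,2)$, $X_\alpha^h$ is not a color process for any sufficiently large $h$. (iii) If $c_2\in(c_1,2)$, then for all $\alpha\in(c_1,c_2)$, $X_\alpha^h$ is not a color process for any sufficiently large $h$, while for all $\alpha\in(c_2,2)$, $X_\alpha^h$ is a color process for all sufficiently large $h$. In particular, for any $\alpha_c\in(0,2)$ and $\epsilon\in(0,\alpha_c)$, one can choose $a$ and $b$ so that $c_1=\epsilon$ and $c_2=\alpha_c$, in which case $X_\alpha$ is defined for all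 $\alpha\in(\epsilon,2)$ and the question of whether $X_\alpha^h$ is a color process for large $h$ has a phase transition at $\alpha_c$ (it is not for any sufficiently large $h$ if $\alpha\in(\epsilon,\alpha_c)$, and it is for all sufficiently large $h$ if $\alpha\in(\alpha_c,2)$).
   Context: $S_\alpha(1,0,0)$ denotes the symmetric $\alpha$-stable distribution on $\mathbb{R}$ with characteristic function $\theta\mapsto e^{-|\theta|^\alpha}$. A random vector in $\mathbb{R}^d$ is symmetric $\alpha$-stable if its characteristic function is $\theta\mapsto\exp\bigl(-\int_{\mathbb{S}^{d-1}}|\theta\cdot\mathbf{x}|^\alpha\,d\Lambda(\mathbf{x})\bigr)$ for some finite measure $\Lambda$ on $\mathbb{S}^{d-1}$ invariant under $\mathbf{x}\mapsto-\mathbf{x}$. A $\{0,1\}$-valued process $(Y_i)_{i\in S}$ is a color process (divide and color process) if there are $p\in[0,1]$ and a random partition $\pi$ of $S$ such that $(Y_i)$ has the same law as the process obtained by sampling $\pi$ and then, independently of $\pi$ and independently for different partition elements, assigning all elements of a partition element the value $1$ with probability $p$ and the value $0$ with probability $1-p$. For a random vector $X=(X_i)$ and $h\in\mathbb{R}$, $X^h=(X^h_i)$ with $X^h_i=I(X_i>h)$. ''Not a color process for any sufficiently large $h$'' means that there is $h_0$ such that it is not a color process for any $h>h_0$. When $a=b$, $c_2=\infty$. *)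

(* Defs.v *)
From HB Require Import structures.
From mathcomp Require Import all_boot all_order all_algebra all_fingroup.
From mathcomp Require Import all_classical all_reals all_analysis.
From mathcomp Require Import complex.

Set Implicit Arguments.
Unset Strict Implicit.
Unset Printing Implicit Defensive.

Import Order.TTheory GRing.Theory Num.Theory.
Import numFieldNormedType.Exports.

Local Open Scope classical_set_scope.
Local Open Scope complex_scope.
Local Open Scope ring_scope.

(** R^d is [d.-tuple R], whose sigma-algebra is the product (= Borel) one. *)

Section Vectors.
Context {R : realType} {n : nat}.
Implicit Types x y : n.-tuple R.

Definition dot x y : R := \sum_(i < n) tnth x i * tnth y i.

Definition oppt x : n.-tuple R := [tuple - tnth x i | i < n].

Definition permt (s : 'S_n) x : n.-tuple R := [tuple tnth x (s i) | i < n].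

Definition sphere : set (n.-tuple R) := [set x | dot x x = 1].

End Vectors.

Arguments sphere : clear implicits.

Section RandomVectors.
Context {R : realType} {d : measure_display} {T : measurableType d}.
Variable P : probability T R.

(** E[exp(i Z)] for a real random variable Z. *)
Definition expect_cis (Z : T -> R) : R[i] :=
  (\int[P]_w cos (Z w)) +i* (\int[P]_w sin (Z w)).

Definition charfun (Z : T -> R) (theta : R) : R[i] :=
  expect_cis (fun w => theta * Z w).

Definition charfun_vec n (X : T -> n.-tuple R) (theta : n.-tuple R) : R[i] :=
  expect_cis (fun w => dot theta (X w)).

(** Z ~ S_alpha(1,0,0). *)
Definition standard_stable (alpha : R) (Z : T -> R) : Prop :=
  forall theta : R, charfun Z theta = (expR (- (`|theta| `^ alpha)))%:C.

(** The finite measure on the sphere is a finite measure on R^n that vanishes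
    outside the sphere. *)
Definition symmetric_stable n (alpha : R) (X : T -> n.-tuple R) : Prop :=
  measurable_fun setT X /\
  exists Lambda : {finite_measure set (n.-tuple R) -> \bar R},
    [/\ Lambda (~` sphere R n) = 0%E,
        forall A : set (n.-tuple R), measurable A ->
          Lambda (oppt @^-1` A) = Lambda A
      & forall theta : n.-tuple R,
          charfun_vec X theta =
          (expR (- \int[Lambda]_(x in sphere R n) (`|dot theta x| `^ alpha)))%:C].

(** Choosing [A i = setT] for i outside a subset gives the product rule for
    every subfamily. *)
Definition independent n (Z : 'I_n -> {RV P >-> R}) : Prop :=
  forall A : 'I_n -> set R, (forall i, measurable (A i)) ->
    P [set w | forall i, A i (Z i w)] = (\prod_(i < n) P (Z i @^-1` A i))%E.

Definition identically_distributed n (Z : 'I_n -> {RV P >-> R}) : Prop :=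
  forall i j (A : set R), measurable A ->
    distribution P (Z i) A = distribution P (Z j) A.

Definition exchangeable n (X : T -> n.-tuple R) : Prop :=
  forall (s : 'S_n) (A : set (n.-tuple R)), measurable A ->
    P ((fun w => permt s (X w)) @^-1` A) = P (X @^-1` A).

(** Law of the color process whose random partition of I has probability mass
    function [q]: given the partition [pi], a coloring of its elements is a
    function [c] supported in [pi], drawn with the product Bernoulli(p)
    weights; then i gets the color of its partition element [finset.pblock pi i]. *)
Definition color_law (I : finType) (p : R) (q : {set {set I}} -> R)
    (y : {ffun I -> bool}) : R :=
  \sum_(pi : {set {set I}}) q pi *
    \sum_(c : {ffun {set I} -> bool} |
            (c \in pffun_on false (mem pi) predT) &&
            [forall i, c (finset.pblock pi i) == y i])
      \prod_(B in pi) (if c B then p else 1 - p).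

Definition partition_pmf (I : finType) (q : {set {set I}} -> R) : Prop :=
  [/\ forall pi, 0 <= q pi,
      forall pi, q pi != 0 -> finset.partition pi [set: I]%SET
    & \sum_(pi : {set {set I}}) q pi = 1].

Definition color_process (I : finType) (Y : I -> T -> bool) : Prop :=
  exists (p : R) (q : {set {set I}} -> R),
    [/\ 0 <= p <= 1, partition_pmf q
      & forall y : {ffun I -> bool},
          P [set w | forall i, Y i w = y i] = (color_law p q y)%:E].

Definition threshold n (X : T -> n.-tuple R) (h : R) (i : 'I_n) (w : T) : bool :=
  h < tnth (X w) i.

Definition eventually_color n (X : T -> n.-tuple R) : Prop :=
  exists h0 : R, forall h, h0 < h -> color_process (threshold X h).

Definition eventually_not_color n (X : T -> n.-tuple R) : Prop :=
  exists h0 : R, forall h, h0 < h -> ~ color_process (threshold X h).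

End RandomVectors.

Section Model.
Context {R : realType}.
Variables a b : R.

Definition is_c1 (c : R) : Prop :=
  0 < c < 2 /\ 2 * a `^ c + 2 * b `^ c = 1.

Definition c2 : \bar R :=
  if a == b then +oo%E else (ln 2 / `|ln a - ln b|)%:E.

(** [s k] is S_k; the indices 1, ..., 7 of the variables are shifted to
    0, ..., 6. *)
Definition Xvec {T : Type} (alpha : R) (S : 'I_7 -> T -> R) (w : T) :
    3.-tuple R :=
  let s k := S (inord k.-1) w in
  let r := (1 - 2 * a `^ alpha - 2 * b `^ alpha) `^ alpha^-1 in
  [tuple a * s 1 + b * s 2 + b * s 4 + a * s 5 + r * s 7;
         a * s 2 + b * s 3 + b * s 5 + a * s 6 + r * s 7;
         b * s 1 + a * s 3 + a * s 4 + b * s 6 + r * s 7].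

Definition iid_standard_stable (alpha : R) {d : measure_display}
    {T : measurableType d} (P : probability T R)
    (S : 'I_7 -> {RV P >-> R}) : Prop :=
  [/\ independent S, identically_distributed S
    & standard_stable P alpha (S ord0)].

(** The three properties below concern the law of X_alpha only, so they are
    required of every realization of S_1, ..., S_7. *)

Definition X_stable_exchangeable (alpha : R) : Prop :=
  forall (d : measure_display) (T : measurableType d) (P : probability T R)
    (S : 'I_7 -> {RV P >-> R}),
  iid_standard_stable alpha S ->
  symmetric_stable P alpha (Xvec alpha (fun i => S i)) /\
  exchangeable P (Xvec alpha (fun i => S i)).

Definition X_color_large_h (alpha : R) : Prop :=
  forall (d : measure_display) (T : measurableType d) (P : probability T R)
    (S : 'I_7 -> {RV P >-> R}),
  iid_standard_stable alpha S ->
  eventually_color P (Xvec alpha (fun i => S i)).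

Definition X_not_color_large_h (alpha : R) : Prop :=
  forall (d : measure_display) (T : measurableType d) (P : probability T R)
    (S : 'I_7 -> {RV P >-> R}),
  iid_standard_stable alpha S ->
  eventually_not_color P (Xvec alpha (fun i => S i)).

(** The coefficient of S_7 is the alpha-th root of a nonnegative number. *)
Definition X_defined (alpha : R) : Prop :=
  0 <= 1 - 2 * a `^ alpha - 2 * b `^ alpha.

End Model.

(* Main.v *)
Require Import Defs.
From HB Require Import structures.
From mathcomp Require Import all_boot all_order all_algebra all_fingroup.
From mathcomp Require Import all_classical all_reals all_analysis.
From mathcomp Require Import measurable_realfun complex ring lra.

(** The tail of a standard stable Z is regularly varying: averaging the
    characteristic function over a Gaussian gives the Laplace transform of Z^2,
    whose behaviour near 0 determines h^alpha P(|Z| > h) -> 2K > 0 by Karamata's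
    polynomial approximation; the one-sided tail follows since Z and -Z have the
    same expectations against Gaussian kernels.  For a nonnegative linear image X
    of i.i.d. stable variables, {X_i > h for all i in A} is essentially caused by
    a single large S_k, whence h^alpha P(X_i > h, i in A) -> K sum_k min_A c_ik^alpha.
    Here the three limits are K, K (2 m + r) and K r for #|A| = 1, 2, 3, with
    m = min(a, b)^alpha and r the coefficient of S_7 to the power alpha.
    The law of an exchangeable {0,1}-valued triple is determined by these three
    moments; it is a color process iff explicit weights on the partition
    types are nonnegative.  The critical one, the weight of the partition into
    singletons, tends to 1 - 3 (2 m + r) + 2 r = 2 max(a, b)^alpha - 4 m, whose sign
    is that of alpha - c_2. *)

Set Implicit Arguments.
Unset Strict Implicit.
Unset Printing Implicit Defensive.

Import Order.TTheory GRing.Theory Num.Theory.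
Import numFieldNormedType.Exports.

Local Open Scope classical_set_scope.
Local Open Scope ring_scope.

(** All that is known about [S_k] is [E cos (t S_k) = exp (- |t|^alpha)] and [E sin (t S_k) = 0].
    Both enter only through Fubini against a Gaussian weight in [t], which yields once the Laplace
    transform of [Z^2], once the law of [Z] plus a Gaussian. The bound [alpha < 2] acts three times:
    [|t|^(2 alpha)] is dominated by [1 + t^4] in the second-order expansion of the Laplace
    transform; values of [|Z|] below [delta h] contribute only a factor [delta^(2 - alpha)], which
    forces a positive tail constant; and the smoothing error, of order [h^-2], is negligible against
    [h^-alpha]. Only the positivity of [K] matters, since the color criterion is homogeneous at
    leading order. The criterion comes from [2 nu_3 - 3 nu_2 + nu_1]: given the partition it
    vanishes for one block or two blocks, and equals [p (1 - p) (1 - 2 p)] for singletons. It is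
    therefore the weight of the singleton partition times a factor that is positive for small [p],
    and [p] tends to 0 as [h] grows. The other two weights are governed by the third central moment
    and the covariance, of orders [K r h^-alpha] and [K (2 m + r) h^-alpha]. *)

Lemma measurable_sin (R : realType) : measurable_fun setT (@sin R).
Proof. by apply: continuous_measurable_fun => x; exact: continuous_sin. Qed.

Lemma measurable_cos (R : realType) : measurable_fun setT (@cos R).
Proof. by apply: continuous_measurable_fun => x; exact: continuous_cos. Qed.

(** * Gaussian averages of the characteristic function *)

Section GaussianTransform.
Context {R : realType}.
Notation mu := (@lebesgue_measure R).
Notation phi := (@normal_pdf R 0 1).

Let phiE t : phi t = normal_peak 1 * expR (- t ^+ 2 / 2).
Proof. by rewrite normal_pdfE// /normal_fun subr0 expr1n. Qed.

Let measurable_phi : measurable_fun setT phi.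
Proof. exact: measurable_normal_pdf. Qed.

Let is_derive_phi (t : R) : is_derive t 1 phi (- t * phi t).
Proof.
have -> : phi = (fun t => normal_peak 1 * expR (- t ^+ 2 / 2)).
  by apply/funext => u; rewrite phiE.
apply: is_derive_eq; rewrite /GRing.scale /=. by field.
Qed.

(** Half of the Gaussian exponent absorbs the polynomial; the other half is, up to a constant, the
    density of variance 2. Degree 4 suffices to dominate [|t|^(2 alpha)], the highest power met
    later. *)
Lemma integrable_gauss_poly :
  mu.-integrable setT (fun t => ((1 + t ^+ 4) * phi t)%:E).
Proof.
have s2 : Num.sqrt (2 : R) != 0 by rewrite gt_eqF// sqrtr_gt0.
(* With [v = t^2 / 4], one has [1 + t^4 = 1 + 16 v^2 <= 65 e^v], because [e^(v/2) >= 1 + v/2]; the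
   ratio of normal peaks renormalizes to variance 2. *)
pose k : R := 65 * normal_peak 1 / normal_peak (Num.sqrt 2).
have := integrableZl measurableT k (integrable_normal_pdf (0:R) (Num.sqrt 2)).
apply: le_integrable => //.
  apply/measurable_EFinP; apply: measurable_funM => //.
  by apply: measurable_funD => //; exact: measurable_funX.
move=> t _.
have p1 := normal_peak_gt0 (oner_neq0 R).
have p2 := normal_peak_gt0 s2.
have pos : 0 <= (1 + t ^+ 4) * phi t.
  by rewrite mulr_ge0 ?normal_pdf_ge0// addr_ge0// exprn_even_ge0.
rewrite -EFinM.
have -> : k * normal_pdf 0 (Num.sqrt 2) t =
    65 * normal_peak 1 * expR (- t ^+ 2 / 4) :> R.
  rewrite (normal_pdfE _ s2) /normal_fun subr0 sqr_sqrtr//.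
  have -> : (2 *+ 2 : R) = 4 by ring.
  by rewrite /k; field; rewrite gt_eqF.
rewrite lee_fin ger0_norm// ger0_norm; last first.
  by rewrite mulr_ge0 ?expR_ge0// mulr_ge0// ltW.
rewrite phiE.
have -> : - t ^+ 2 / 2 = - (t ^+ 2 / 4) - t ^+ 2 / 4 :> R by field.
rewrite expRD mulNr mulrCA mulrA.
have := p1; move: (normal_peak (1 : R) : R) => p p0.
set v := t ^+ 2 / 4.
have t4 : t ^+ 4 = 16 * v ^+ 2 by rewrite /v; field.
have v0 : 0 <= v by rewrite divr_ge0// sqr_ge0.
rewrite mulrA mulrAC ler_pM2r ?expR_gt0//.
have := expR_ge1Dx (v / 2); have := expRxMexpNx_1 v.
have -> : expR v = expR (v / 2) ^+ 2 by rewrite -expRM_natl; congr expR; field.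
have := expR_gt0 (- v); move: (expR (v / 2)) (expR (- v)) => e e' e'0 h1 h.
have h2 : 1 + 16 * v ^+ 2 <= 65 * e ^+ 2 by nra.
have key : (1 + t ^+ 4) * e' <= 65.
  apply: (@le_trans _ _ (65 * (e ^+ 2 * e'))); last by rewrite h1 mulr1.
  by rewrite t4 mulrA ler_pM2r.
by rewrite -mulrA mulrC [e' * _]mulrC ler_pM2r.
Qed.

Lemma integrable_gauss (f : R -> R) : measurable_fun setT f ->
  (forall t, `|f t| <= 1 + t ^+ 4) ->
  mu.-integrable setT (fun t => (f t * phi t)%:E).
Proof.
move=> mf fle; apply: le_integrable integrable_gauss_poly => //.
  by apply/measurable_EFinP; exact: measurable_funM.
move=> t _; rewrite lee_fin !normrM ler_wpM2r//.
by rewrite (le_trans (fle t))// ler_norm.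
Qed.

Lemma cvg_integral_segment (f : R -> R) : mu.-integrable setT (EFin \o f) ->
  (fun n => \int[mu]_(x in `[- n%:R, n%:R]) f x) @ \oo --> \int[mu]_x f x.
Proof.
move=> fi; have /integrableP[/measurable_EFinP mf _] := fi.
pose F n := (f \_ `[- n%:R, n%:R] : R -> R).
have [] := @dominated_convergence _ _ _ mu setT measurableT
  (fun n => EFin \o F n) (EFin \o f) (fun x => `|f x|%:E).
- move=> n; apply/measurable_EFinP; rewrite /F.
  by apply/(measurable_restrictT _ _).1 => //; exact: measurable_funTS.
- exact/measurable_EFinP.
- apply: aeW => x _; apply/cvg_EFin; first exact: nearW.
  apply: cvg_near_cst; near=> n.
  rewrite /F /=. rewrite patchE ifT//; apply/mem_set; rewrite /= in_itv/= -ler_norml.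
  near: n; exact: nbhs_infty_ger.
- exact: integrable_abse fi.
- apply: aeW => x n _; rewrite lee_fin /F patchE; case: ifPn => // _.
  by rewrite normr0.
move=> _ _; rewrite -[X in _ --> X -> _]fineK; last exact: integrable_fin_num.
move=> /fine_cvg; apply: cvg_trans.
apply: near_eq_cvg; near=> n.
by rewrite /= Rintegral_mkcond.
Unshelve. all: by end_near.
Qed.

Lemma integrable_gauss_cos (x : R) :
  mu.-integrable setT (fun t => (cos (x * t) * phi t)%:E).
Proof.
apply: integrable_gauss.
  apply: (@measurableT_comp _ _ _ _ _ _ (@cos R) _ (fun t => x * t)).
    exact: measurable_cos.
  exact: measurable_funM.
by move=> t; rewrite (le_trans (cos_max _))// lerDl exprn_even_ge0.
Qed.

Lemma integrable_gauss_id_sin (x : R) :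
  mu.-integrable setT (fun t => (t * sin (x * t) * phi t)%:E).
Proof.
apply: integrable_gauss.
  apply: measurable_funM => //.
  apply: (@measurableT_comp _ _ _ _ _ _ (@sin R) _ (fun t => x * t)).
    exact: measurable_sin.
  exact: measurable_funM.
move=> t; rewrite normrM.
have := sin_max (x * t); have := normr_ge0 t; have := normr_ge0 (sin (x * t)).
have -> : t ^+ 4 = `|t| ^+ 4 by rewrite -normrX ger0_norm// exprn_even_ge0.
move: `|t| `|sin _| => u v v0 u0 v1.
have := sqr_ge0 (u ^+ 2 - 1 / 2); have := sqr_ge0 (u - 1 / 2); nra.
Qed.

(** Stein's identity for [sin (x t)]: the difference [f] of the two integrands is the derivative of
    [F], and [F] decays like [1 / |t|] since [e^(t^2/2) >= |t| / 2], so the integral of [f] over a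
    growing segment tends to 0. *)
Lemma gauss_stein (x : R) :
  \int[mu]_t (t * sin (x * t) * phi t) = x * \int[mu]_t (cos (x * t) * phi t).
Proof.
pose F t := - (sin (x * t) * phi t).
pose f t := t * sin (x * t) * phi t - x * (cos (x * t) * phi t).
have mx : measurable_fun setT (fun t : R => x * t) by exact: measurable_funM.
have i1 := integrable_gauss_id_sin x.
have i2 := integrable_gauss_cos x.
have dF (t : R) : is_derive t 1 F (f t).
  have dphi := is_derive_phi t.
  rewrite /F /f; apply: is_derive_eq; rewrite /GRing.scale /=.
  ring.
have cF : continuous F by move=> t; apply/differentiable_continuous/derivable1_diffP.
have i3 : mu.-integrable setT (fun t => (x * (cos (x * t) * phi t))%:E).
  exact: (integrableZl measurableT x i2).
apply/eqP; rewrite -subr_eq0 -RintegralZl//; apply/eqP.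
rewrite -RintegralB//.
have If : mu.-integrable setT (EFin \o f).
  exact: (integrableB _ i1 i3).
have cf := cvg_integral_segment If.
apply: (cvg_unique _ cf) => //.
have p0 := normal_peak_gt0 (oner_neq0 R).
have Fle t : 0 < `|t| -> `|F t| <= 2 * normal_peak 1 / `|t|.
  move=> t0; rewrite /F normrN normrM (ger0_norm (normal_pdf_ge0 _ _ _)) phiE.
  rewrite (@le_trans _ _ (normal_peak 1 * expR (- t ^+ 2 / 2)))//.
    by rewrite ler_piMl ?sin_max// mulr_ge0 ?expR_ge0 ?ltW.
  rewrite [leRHS]mulrAC mulrC ler_pM2r//.
  rewrite mulNr expRN -[leRHS]invf_div lef_pV2 ?posrE ?expR_gt0 ?divr_gt0//.
  apply: le_trans (expR_ge1Dx _).
  by rewrite -(real_normK (num_real t)); nra.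
apply/cvgrPdist_le => e e0; near=> n.
have n0 : 0 < n%:R :> R by near: n; exact: nbhs_infty_gtr.
have -> : \int[mu]_(t in `[- n%:R, n%:R]) f t = F n%:R - F (- n%:R).
  rewrite /Rintegral (@continuous_FTC2 _ f F) ?gtrN//.
  - apply: continuous_subspaceT => t; have dphi := is_derive_phi t.
    by apply/differentiable_continuous/derivable1_diffP/ex_derive.
  - split => [t _| |].
    + exact: (ex_derive).
    + by apply/cvg_at_right_filter/cF.
    + by apply/cvg_at_left_filter/cF.
  - by move=> t _; rewrite derive1E; apply: derive_val.
rewrite sub0r normrN (le_trans (ler_normB _ _))//.
have := Fle n%:R; have := Fle (- n%:R).
rewrite normrN gtr0_norm// => /(_ n0) h1 /(_ n0) h2.
rewrite (le_trans (lerD h2 h1))//.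
rewrite -mulrDl ler_pdivrMr// (mulrC e) -ler_pdivrMr//.
near: n; exact: nbhs_infty_ger.
Unshelve. all: by end_near.
Qed.

(** Differentiation under the integral and [gauss_stein] give [I' = - x I], so [I x * e^(x^2/2)] is
    constant, equal to [I 0 = 1]. *)
Lemma gauss_cos (x : R) : \int[mu]_t (cos (x * t) * phi t) = expR (- x ^+ 2 / 2).
Proof.
pose I x := \int[mu]_t (cos (x * t) * phi t).
have i2 (y : R) : mu.-integrable setT (fun t => (cos (y * t) * phi t)%:E).
  exact: integrable_gauss_cos.
have iG : mu.-integrable setT (fun t => (`|t| * phi t)%:E).
  apply: integrable_gauss; first exact: normr_measurable.
  move=> t; rewrite normr_id.
  have -> : t ^+ 4 = `|t| ^+ 4 by rewrite -normrX ger0_norm// exprn_even_ge0.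
  move: `|t| => u.
  have := sqr_ge0 (u ^+ 2 - 1 / 2); have := sqr_ge0 (u - 1 / 2); nra.
pose f (y t : R) := cos (y * t) * phi t.
have df (y t : R) : is_derive y 1 (f ^~ t) (- (t * sin (y * t) * phi t)).
  rewrite /f; apply: is_derive_eq; rewrite /GRing.scale /=; ring.
have dI (y : R) : is_derive y 1 I (- y * I y).
  have yuv : `]y - 1, y + 1[%classic y by rewrite /= in_itv/= ltrBlDr ltrDl ltr01.
  have d1 (z t : R) : derivable (f ^~ t) z 1 by exact: ex_derive.
  have G0 t : 0 <= `|t| * phi t by rewrite mulr_ge0 ?normal_pdf_ge0.
  have ub z t : `|partial1of2 f z t| <= `|t| * phi t.
    rewrite partial1of2E derive_val normrN !normrM (ger0_norm (normal_pdf_ge0 _ _ _)).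
    by rewrite ler_wpM2r ?normal_pdf_ge0// ler_piMr// sin_max.
  apply: DeriveDef.
    exact: (@derivable_under_integral _ _ (measurableTypeR R) mu f _ measurableT _ _ _ yuv
      (fun z _ => i2 z) (fun z t _ _ => d1 z t) _ G0 iG (fun z t _ _ => ub z t)).
  rewrite -derive1E (@differentiation_under_integral _ _ (measurableTypeR R) mu f _ measurableT
    _ _ _ yuv (fun z _ => i2 z) (fun z t _ _ => d1 z t) _ G0 iG (fun z t _ _ => ub z t)).
  rewrite mulNr -gauss_stein -mulN1r.
  under eq_Rintegral => t _ do rewrite partial1of2E derive_val -mulN1r.
  rewrite RintegralZl//.
  exact: integrable_gauss_id_sin.
have dJ (y : R) : is_derive y 1 (fun y => I y * expR (y ^+ 2 / 2)) 0.
  have dIy := dI y.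
  apply: is_derive_eq; rewrite /GRing.scale /=. by field.
have := is_derive_0_is_cst x 0 dJ.
rewrite /= expr0n mul0r expR0 mulr1.
have -> : I 0 = 1.
  rewrite /I; under eq_Rintegral do rewrite mul0r cos0 mul1r.
  by rewrite /Rintegral integral_normal_pdf.
move=> h; rewrite -[LHS]/(I x) mulNr expRN.
have e0 : expR (x ^+ 2 / 2) != 0 by rewrite gt_eqF ?expR_gt0.
by apply: (mulIf e0); rewrite h mulVf.
Qed.

End GaussianTransform.

(** * Polynomial approximation of a step *)

Lemma bernoulli_ge (R : realFieldType) (x : R) n : -1 <= x -> 1 + x *+ n <= (1 + x) ^+ n.
Proof.
move=> x1; elim: n => [|n IH]; first by rewrite mulr0n addr0.
rewrite exprS; apply: (@le_trans _ _ ((1 + x) * (1 + x *+ n))).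
  have : 0 <= x *+ n * x by rewrite mulrnAl mulrn_wge0// -expr2 sqr_ge0.
  rewrite mulrS; lra.
by rewrite ler_wpM2l//; lra.
Qed.

(* For fixed [y1 < y0], the polynomial [(1 - y ^ n) ^ N] with
   [N ~ eta * y1 ^ - n] and n large is a smooth version of the indicator of
   [0, y1], and vanishes at 1. *)
Lemma step_polynomial (R : realType) (y1 y0 eta : R) :
  0 < y1 -> y1 < y0 -> y0 < 1 -> 0 < eta < 1 ->
  exists n N : nat, [/\ (0 < n)%N, (0 < N)%N,
    forall y, 0 <= y <= y1 -> 1 - eta <= (1 - y ^+ n) ^+ N &
    forall y, y0 <= y <= 1 -> (1 - y ^+ n) ^+ N <= eta * (1 - y)].
Proof.
move=> y10 y1y0 y01 /andP[e0 e1].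
have y00 : 0 < y0 by exact: lt_trans y1y0.
(* Writing [y0 / y1 = s^2] and applying Bernoulli to [s^n] makes [(y0 / y1)^n] at least [(d n)^2].
   This quadratic growth beats the factor [n] lost in [1 - y^n <= n (1 - y)]. *)
pose s := Num.sqrt (y0 / y1); pose d := s - 1.
have s1 : 1 < s.
  by rewrite -(ltr_pXn2r (n := 2)) ?nnegrE ?sqrtr_ge0// sqr_sqrtr ?divr_ge0 ?ltW// expr1n ltr_pdivlMr// mul1r.
have d0 : 0 < d by rewrite subr_gt0.
pose n := (Num.truncn (2 / (eta ^+ 2 * d ^+ 2))).+1.
have hn : 2 <= eta ^+ 2 * d ^+ 2 * n%:R.
  rewrite mulrC -ler_pdivrMr ?mulr_gt0 ?exprn_gt0// ltW//.
  by rewrite truncnS_gt.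
have n1 : 1 <= n%:R :> R by rewrite ler1n.
have rho : (d * n%:R) ^+ 2 <= y0 ^+ n / y1 ^+ n.
  have q : 0 <= y0 / y1 by rewrite divr_ge0 ?ltW.
  rewrite -expr_div_n -[y0 / y1]sqr_sqrtr// -/s.
  rewrite (exprAC s) ler_pXn2r ?nnegrE ?exprn_ge0 ?mulr_ge0 ?sqrtr_ge0 ?(ltW d0)//.
  have -> : s = 1 + d by rewrite /d addrC subrK.
  apply: le_trans (bernoulli_ge _ _); last by lra.
  by rewrite mulr_natr lerDr.
have key : n%:R + eta <= eta ^+ 2 * (y0 ^+ n / y1 ^+ n).
  apply: (@le_trans _ _ (eta ^+ 2 * (d * n%:R) ^+ 2)); last first.
    by rewrite ler_pM2l// exprn_gt0.
  by rewrite exprMn; nra.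
pose N := Num.truncn (eta / y1 ^+ n).
have y1n : 0 < y1 ^+ n by rewrite exprn_gt0.
have y0n : 0 < y0 ^+ n by rewrite exprn_gt0.
have q0 : 0 <= eta / y1 ^+ n by rewrite divr_ge0 ?ltW.
have /andP[N1 N2] : N%:R <= eta / y1 ^+ n < N.+1%:R by exact: truncn_itv.
have y0n1 : y0 ^+ n <= 1 by rewrite exprn_ile1 ?ltW.
have N0 : (0 < N)%N.
  rewrite lt0n; apply/eqP => N0; move: N2; rewrite N0.
  rewrite ltr_pdivrMr// mul1r => h.
  have : eta ^+ 2 * (y0 ^+ n / y1 ^+ n) < eta.
    by rewrite mulrA ltr_pdivrMr//; nra.
  nra.
exists n, N; split => //.
- move=> y /andP[y0' yy1].
  have yn : y ^+ n <= y1 ^+ n by apply: lerXn2r => //; rewrite nnegrE ltW.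
  have yn0 : 0 <= y ^+ n by rewrite exprn_ge0.
  apply: le_trans (bernoulli_ge _ _).
    rewrite mulNrn lerD2l lerN2 -mulr_natr mulrC.
    move: N1; rewrite ler_pdivlMr//; apply: le_trans; exact: ler_wpM2l.
  rewrite lerN2 (le_trans yn)// exprn_ile1 ?ltW//; lra.
- move=> y /andP[yy0 yle1].
  have y0' : 0 <= y by rewrite (le_trans (ltW y00)).
  have yn : y0 ^+ n <= y ^+ n by apply: lerXn2r => //; rewrite nnegrE ltW.
  have yn1 : y ^+ n <= 1 by rewrite exprn_ile1.
  have b1 : 1 - y ^+ n <= n%:R * (1 - y).
    have h : -1 <= y - 1 by lra.
    have := bernoulli_ge n h; have -> : 1 + (y - 1) = y by ring.
    rewrite -mulr_natr; lra.
  (* One factor [1 - y^n] is set aside to produce [1 - y]; the other [N - 1] factors are at most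
     [1 / (1 + (N - 1) y0^n)], which compensates [n]. *)
  have -> : N = N.-1.+1 by rewrite prednK.
  rewrite exprS.
  have c0 : 0 <= N.-1%:R * y0 ^+ n by rewrite mulr_ge0 ?ler0n ?ltW.
  have b2 : (1 - y ^+ n) ^+ N.-1 * (1 + N.-1%:R * y0 ^+ n) <= 1.
    have : (1 - y ^+ n) ^+ N.-1 <= expR (- (N.-1%:R * y0 ^+ n)).
      rewrite -mulrN expRM_natl; apply: lerXn2r; rewrite ?nnegrE ?expR_ge0 ?subr_ge0//.
      apply: (@le_trans _ _ (1 - y0 ^+ n)); first by lra.
      exact: expR_ge1Dx.
    have := expR_ge1Dx (N.-1%:R * y0 ^+ n).
    have := expRxMexpNx_1 (N.-1%:R * y0 ^+ n).
    have := expR_gt0 (- (N.-1%:R * y0 ^+ n)).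
    move=> u0 uv vle zle; apply: le_trans (ler_wpM2r _ zle) _; first by lra.
    by rewrite -[leRHS]uv mulrC ler_wpM2r// ltW.
  have b3 : n%:R <= eta * (1 + N.-1%:R * y0 ^+ n).
    move: N2; rewrite ltr_pdivrMr// => N2.
    have NN : N.+1%:R = N.-1%:R + 2 :> R by rewrite -[in LHS](prednK N0) -natrD addn2.
    have : eta * (y0 ^+ n / y1 ^+ n) <= (N.-1%:R + 2) * y0 ^+ n.
      rewrite mulrA ler_pdivrMr// -NN mulrAC ler_pM2r//; exact: ltW.
    nra.
  have z0 : 0 <= (1 - y ^+ n) ^+ N.-1 by rewrite exprn_ge0// subr_ge0.
  have n0 : 0 < n%:R :> R by lra.
  move: b1 b2 b3 z0 c0; move: (_ ^+ N.-1) (N.-1%:R * _) => z c b1 b2 b3 z0 c0.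
  apply: (@le_trans _ _ (n%:R * (1 - y) * z)); first by rewrite ler_wpM2r.
  have : n%:R * z <= eta by nra.
  have : 0 <= 1 - y by lra.
  nra.
Qed.

(** * Bounded expectations and their Gaussian representation *)

Section ProbabilityTools.
Context {R : realType} {d : measure_display} {T : measurableType d}.
Variable P : probability T R.

Lemma integrable_ubound (f : T -> R) (M : R) : measurable_fun setT f ->
  (forall w, `|f w| <= M) -> P.-integrable setT (EFin \o f).
Proof.
move=> mf fM; apply: measurable_bounded_integrable => //.
  by rewrite (le_lt_trans (probability_le1 _ _))// ltry.
exists M; split; first exact: num_real.
by move=> x Mx w _; exact: le_trans (fM w) (ltW Mx).
Qed.

Lemma Rintegral_indicator (A : set T) : measurable A ->
  \int[P]_w (\1_A w) = fine (P A).
Proof. by move=> mA; rewrite /Rintegral integral_indic// setIT. Qed.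

Lemma prob_fineK (A : set T) : measurable A -> (fine (P A))%:E = P A.
Proof. by move=> mA; rewrite fineK// fin_num_measure. Qed.

Lemma le_fine_prob (A B : set T) : measurable A -> measurable B -> A `<=` B ->
  fine (P A) <= fine (P B).
Proof.
move=> mA mB AB; rewrite fine_le ?fin_num_measure//.
by apply: le_measure => //; rewrite inE.
Qed.

Lemma le_Rintegral_ubound (f g : T -> R) (M : R) :
  measurable_fun setT f -> measurable_fun setT g ->
  (forall w, `|f w| <= M) -> (forall w, `|g w| <= M) ->
  (forall w, f w <= g w) -> \int[P]_w f w <= \int[P]_w g w.
Proof.
move=> mf mg fM gM fg; apply: le_Rintegral => //.
  exact: integrable_ubound fM.
exact: integrable_ubound gM.
Qed.

Notation mu := (@lebesgue_measure R).
Notation phi := (@normal_pdf R 0 1).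

(** [gauss_cos] at [x = U w], integrated over [w] with Fubini: the Laplace transform of [U^2]
    becomes an average of the real part of the characteristic function of [U]. *)
Lemma expect_gauss (U : T -> R) : measurable_fun setT U ->
  \int[P]_w expR (- U w ^+ 2 / 2) =
  \int[mu]_t ((\int[P]_w cos (U w * t)) * phi t).
Proof.
move=> mU.
pose f (z : T * measurableTypeR R) := (cos (U z.1 * z.2) * phi z.2)%:E.
have mUt : measurable_fun setT (fun z : T * measurableTypeR R => U z.1 * z.2).
  apply: measurable_funM; last exact: measurable_snd.
  exact: (measurableT_comp mU measurable_fst).
have mphi : measurable_fun setT (fun z : T * measurableTypeR R => phi z.2).
  exact: (measurableT_comp (measurable_normal_pdf _ _) measurable_snd).
have mf : measurable_fun setT f.
  apply/measurable_EFinP/measurable_funM => //.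
  exact: (measurableT_comp (@measurable_cos R) mUt).
have mabs : measurable_fun setT (abse \o f) by exact: measurableT_comp.
have fi : (P \x mu)%E.-integrable setT f.
  apply/integrable12ltyP => //.
  apply: (@le_lt_trans _ _ (\int[P]_x 1)%E); last first.
    by rewrite integral_cst// mul1e (le_lt_trans (probability_le1 _ _))// ltry.
  apply: ge0_le_integral => //.
  - by move=> w _; exact: integral_ge0.
  - exact: (measurable_fun_fubini_tonelli_F (m2 := mu) (abse \o f) mabs (fun _ => abse_ge0 _)).
  - move=> w wT; clear wT; rewrite -(integral_normal_pdf (0 : R) 1).
    apply: ge0_le_integral => //.
    + apply: measurableT_comp => //; apply/measurable_EFinP/measurable_funM => //.
      apply: (@measurableT_comp _ _ _ _ _ _ (@cos R) _ (fun t => U w * t)).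
        exact: measurable_cos.
      exact: measurable_funM.
      exact: measurable_normal_pdf.
    + by apply/measurable_EFinP; exact: measurable_normal_pdf.
    + move=> t _; rewrite lee_fin normrM (ger0_norm (normal_pdf_ge0 _ _ _)).
      by rewrite ler_piMl ?normal_pdf_ge0// cos_max.
have e1 w : (\int[mu]_t f (w, t) = (expR (- U w ^+ 2 / 2))%:E)%E.
  rewrite -gauss_cos /Rintegral fineK//.
  exact: (integrable_fin_num measurableT (integrable_gauss_cos _)).
have ic t : P.-integrable setT (EFin \o (fun w => cos (U w * t))).
  apply: (@integrable_ubound _ 1); last by move=> w; exact: cos_max.
  apply: (measurableT_comp (@measurable_cos R)); exact: measurable_funM.
have e2 t : (\int[P]_w f (w, t) = ((\int[P]_w cos (U w * t)) * phi t)%:E)%E.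
  rewrite EFinM /Rintegral fineK; last exact: (integrable_fin_num measurableT (ic t)).
  rewrite /f /=; under eq_integral do rewrite EFinM.
  exact: (integralZr measurableT (ic t)).
have := Fubini fi.
under eq_integral do rewrite e1.
under [X in _ = X -> _]eq_integral do rewrite e2.
by rewrite /Rintegral => ->.
Qed.

End ProbabilityTools.

Lemma one_sub_cos_le (R : realType) (t : R) : 1 - cos t <= t ^+ 2.
Proof.
wlog t0 : t / 0 < t.
  move=> H; have [t0|t0|->] := ltgtP t 0; [|exact: H|].
    by rewrite -sqrrN -cosN; apply: H; rewrite oppr_gt0.
  by rewrite cos0 subrr expr0n.
have sin_le (c : R) : 0 < c -> sin c <= c.
  move=> c0; have [x _] : exists2 x, x \in `]0, c[%R & sin c - sin 0 = cos x * (c - 0).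
    apply: MVT => // x; apply: continuous_subspaceT => ?; exact: continuous_sin.
  by rewrite sin0 !subr0 => ->; rewrite ler_piMl ?(ltW c0)// (le_trans (ler_norm _))// cos_max.
have [c] : exists2 x, x \in `]0, t[%R & cos t - cos 0 = - sin x * (t - 0).
  apply: MVT => //; apply: continuous_subspaceT => ?; exact: continuous_cos.
rewrite in_itv/= cos0 subr0 => /andP[c0 ct] h.
have -> : 1 - cos t = sin c * t by rewrite -opprB h; ring.
by rewrite expr2 ler_wpM2r ?(ltW t0)// (le_trans (sin_le _ c0))// ltW.
Qed.

(** * Laplace transform of the square of a stable variable near 0 *)

Section StableLaplace.
Context {R : realType} {d : measure_display} {T : measurableType d}.
Variables (P : probability T R) (alpha : R) (Z : T -> R).
Hypothesis alpha02 : 0 < alpha < 2.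
Hypothesis mZ : measurable_fun setT Z.
Hypothesis cosZ : forall theta : R,
  \int[P]_w cos (theta * Z w) = expR (- (`|theta| `^ alpha)).

Notation mu := (@lebesgue_measure R).
Notation phi := (@normal_pdf R 0 1).

Let L (l : R) := \int[P]_w expR (- (l * Z w) ^+ 2 / 2).
Definition gauss_moment := \int[mu]_t (`|t| `^ alpha * phi t).
Local Notation m := gauss_moment.
Let C := \int[mu]_t ((1 + t ^+ 4) * phi t).

Let a0 : 0 < alpha. Proof. by case/andP: alpha02. Qed.
Let a2 : alpha < 2. Proof. by case/andP: alpha02. Qed.

Let powa_sqr (t : R) : (`|t| `^ alpha) ^+ 2 <= 1 + t ^+ 4.
Proof.
have -> : t ^+ 4 = (`|t| ^+ 2) ^+ 2 by rewrite -exprM -normrX ger0_norm// exprn_even_ge0.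
have t0 := normr_ge0 t; move: (`|t| : R) t0 => u u0.
have p0 := powR_ge0 u alpha.
have [u1|u1] := leP u 1.
  have : u `^ alpha <= 1.
    have := @ge0_ler_powR _ _ (ltW a0) u 1; rewrite !nnegrE powR1; exact.
  have := sqr_ge0 (u ^+ 2); nra.
have : u `^ alpha <= u ^+ 2.
  by rewrite -powR_mulrn// ler_powR ?ltW.
move: (u `^ alpha) (u ^+ 2) p0 => v w; nra.
Qed.

Let powa (t : R) : `|t| `^ alpha <= 1 + t ^+ 4.
Proof.
have := powa_sqr t; have := powR_ge0 `|t| alpha.
have : 0 <= t ^+ 4 by rewrite exprn_even_ge0.
move: (_ `^ _) (t ^+ 4) => u v; nra.
Qed.

Let m_powa : measurable_fun setT (fun t : R => `|t| `^ alpha).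
Proof.
apply: (@measurableT_comp _ _ _ _ _ _ (fun x => x `^ alpha) _ (fun t : R => `|t|)).
  exact: measurable_powR.
exact: normr_measurable.
Qed.

Let int_powa : mu.-integrable setT (fun t => (`|t| `^ alpha * phi t)%:E).
Proof.
apply: integrable_gauss => // t.
by rewrite ger0_norm ?powR_ge0 ?powa.
Qed.

(** By [cosZ] at [theta = l t], [L l] is the average of [exp (- l^alpha |t|^alpha)] over a standard
    Gaussian [t]; the behaviour of [L] near 0 is then that of [1 - e^(-u)]. *)
Let one_sub_LE (l : R) : 0 <= l ->
  1 - L l = \int[mu]_t ((1 - expR (- (l `^ alpha * `|t| `^ alpha))) * phi t)
  /\ mu.-integrable setT
       (fun t => ((1 - expR (- (l `^ alpha * `|t| `^ alpha))) * phi t)%:E).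
Proof.
move=> l0.
have mE : measurable_fun setT (fun t : R => expR (- (l `^ alpha * `|t| `^ alpha))).
  apply: measurableT_comp; first exact: measurable_expR.
  apply: measurableT_comp => //; exact: measurable_funM.
have iE : mu.-integrable setT (fun t => (expR (- (l `^ alpha * `|t| `^ alpha)) * phi t)%:E).
  apply: integrable_gauss => // t.
  rewrite ger0_norm ?expR_ge0// (@le_trans _ _ 1)//; last first.
    by rewrite lerDl exprn_even_ge0.
  by rewrite -expR0 ler_expR oppr_le0 mulr_ge0 ?powR_ge0.
have i1 := integrable_normal_pdf (0 : R) 1.
have -> : (fun t => ((1 - expR (- (l `^ alpha * `|t| `^ alpha))) * phi t)%:E) =
   (fun t => (phi t)%:E - (expR (- (l `^ alpha * `|t| `^ alpha)) * phi t)%:E)%E.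
  by apply/funext => t; rewrite -EFinB mulrBl mul1r.
split; last exact: integrableB.
under eq_Rintegral do rewrite mulrBl mul1r.
rewrite RintegralB//; congr (_ - _).
  by rewrite /Rintegral integral_normal_pdf.
rewrite /L expect_gauss; last exact: measurable_funM.
apply: eq_Rintegral => t _; congr (_ * _).
under eq_Rintegral do rewrite mulrAC [l * t]mulrC.
rewrite cosZ normrM (powRM _ (normr_ge0 _) (normr_ge0 _)) (ger0_norm l0).
by rewrite mulrC.
Qed.

Lemma laplace_le (l : R) : 0 <= l -> 1 - L l <= l `^ alpha * m.
Proof.
move=> l0; have [-> i1] := one_sub_LE l0.
rewrite -RintegralZl//; apply: le_Rintegral => //.
  exact: (integrableZl measurableT (l `^ alpha) int_powa).
move=> t _; rewrite mulrA ler_wpM2r ?normal_pdf_ge0//.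
by have := expR_ge1Dx (- (l `^ alpha * `|t| `^ alpha)); lra.
Qed.

(** From [1 - e^(-u) >= u - u^2] for [u >= 0], with [u = l^alpha |t|^alpha]; the square is
    controlled by [|t|^(2 alpha) <= 1 + t^4]. *)
Lemma laplace_ge (l : R) : 0 <= l ->
  l `^ alpha * m - (l `^ alpha) ^+ 2 * C <= 1 - L l.
Proof.
move=> l0; have [-> i1] := one_sub_LE l0.
have i2 := (integrableZl measurableT (l `^ alpha) int_powa).
have i3 := (integrableZl measurableT ((l `^ alpha) ^+ 2) (@integrable_gauss_poly R)).
rewrite -!RintegralZl//; last exact: integrable_gauss_poly.
rewrite -RintegralB//; apply: le_Rintegral => //.
  exact: (integrableB measurableT i2 i3).
move=> t _; rewrite !mulrA -mulrBl ler_wpM2r ?normal_pdf_ge0//.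
set u := l `^ alpha * _.
have u0 : 0 <= u by rewrite mulr_ge0 ?powR_ge0.
apply: (@le_trans _ _ (u - u ^+ 2)).
  rewrite lerD2l lerN2 exprMn ler_wpM2l ?sqr_ge0//.
rewrite expRN.
have : (expR u)^-1 <= (1 + u)^-1 by rewrite lef_pV2 ?posrE ?expR_gt0 ?expR_ge1Dx//; lra.
have : (1 + u)^-1 <= 1 - u + u ^+ 2.
  rewrite -div1r ler_pdivrMr; last by lra.
  have : 0 <= u ^+ 3 by rewrite exprn_ge0.
  lra.
lra.
Qed.

(** Comparison with [(1 - cos t) / 2], which lies below [|t|^alpha] and has Gaussian average
    [(1 - e^(-1/2)) / 2] by [gauss_cos]. *)
Lemma gauss_moment_gt0 : 0 < m.
Proof.
have e1 : expR (- (1 : R) ^+ 2 / 2) < 1.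
  rewrite -[ltRHS]expR0 ltr_expR; lra.
apply: (@lt_le_trans _ _ (2^-1 * (1 - expR (- (1 : R) ^+ 2 / 2)))).
  by rewrite mulr_gt0 ?invr_gt0// subr_gt0.
rewrite -gauss_cos.
have i0 : 1 = \int[mu]_t phi t by rewrite /Rintegral integral_normal_pdf.
rewrite [X in X - _]i0.
rewrite -RintegralB//; [|exact: integrable_normal_pdf|exact: integrable_gauss_cos].
have i1 : mu.-integrable setT (fun t => (phi t - cos (1 * t) * phi t)%:E).
  exact: (integrableB measurableT (integrable_normal_pdf _ _) (integrable_gauss_cos _)).
rewrite -RintegralZl//; apply: le_Rintegral => //.
  exact: (integrableZl measurableT _ i1).
move=> t _; rewrite mul1r -[X in X - _]mul1r -mulrBl mulrA ler_wpM2r ?normal_pdf_ge0//.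
have [t1|t1] := leP 1 `|t|.
  apply: (@le_trans _ _ 1); last by rewrite -(powRr0 `|t|) ler_powR// ltW.
  have := cos_geN1 t; lra.
have := one_sub_cos_le t.
have [->|t0] := eqVneq t 0; first by rewrite expr0n cos0; have := powR_ge0 `|0 : R| alpha; lra.
have : t ^+ 2 <= `|t| `^ alpha.
  rewrite -(real_normK (num_real t)) -powR_mulrn//.
  by apply: ger_powR; rewrite ?normr_gt0 ?t0 ltW.
have := sqr_ge0 t; lra.
Qed.

End StableLaplace.

Lemma near_pinfty_powR_ge (R : realType) (a M : R) : 0 < a ->
  \forall h \near +oo, M <= h `^ a.
Proof.
move=> a0; near=> h.
have hM : (`|M| + 1) `^ a^-1 <= h by near: h; exact: nbhs_pinfty_ge.
have M1 : 0 <= `|M| + 1 by rewrite addr_ge0.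
apply: (@le_trans _ _ (`|M| + 1)).
  by rewrite (le_trans (ler_norm _))// lerDl.
rewrite -[leLHS]powRr1// -(mulVf (lt0r_neq0 a0)) powRrM.
by apply: ge0_ler_powR => //; rewrite ?nnegrE ?powR_ge0// ?ltW// (le_trans _ hM)// powR_ge0.
Unshelve. all: by end_near. Qed.

Lemma near_pinfty_powRV_le (R : realType) (a e : R) : 0 < a -> 0 < e ->
  \forall h \near +oo, (h `^ a)^-1 <= e.
Proof.
move=> a0 e0; near=> h.
have : e^-1 <= h `^ a by near: h; exact: near_pinfty_powR_ge.
move=> he; rewrite -[e]invrK lef_pV2// posrE ?invr_gt0//.
by rewrite (lt_le_trans _ he)// invr_gt0.
Unshelve. all: by end_near. Qed.

Lemma near_pinfty_scale (R : realType) (c : R) (Q : R -> Prop) : 0 < c ->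
  (\forall h \near +oo, Q h) -> \forall h \near +oo, Q (c * h).
Proof.
move=> c0 [M [Mr QM]]; exists (c^-1 * M); split; first exact: num_real.
by move=> h Mh; apply: QM; rewrite mulrC ltr_pdivrMr// mulrC in Mh.
Qed.

Lemma powRV (R : realType) (x a : R) : 0 <= x -> x^-1 `^ a = (x `^ a)^-1.
Proof. by move=> x0; rewrite -powR_inv1// -powRrM mulN1r powRN. Qed.

Lemma le_one_sub_expRN (R : realType) (u : R) : 0 <= u <= 1 ->
  u <= 2 * (1 - expR (- u)).
Proof.
move=> /andP[u0 u1].
have := expR_ge1Dx u; have := expRxMexpNx_1 u; have := expR_gt0 (- u).
move: (expR (- u)) (expR u) => e e' e0 ee e1.
have h : e * (1 + u) <= 1 by rewrite -[leRHS]ee mulrC ler_wpM2r// ltW.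
have e2 : 0 <= 1 - e by nra.
nra.
Qed.

(** * Two-sided tail of a stable variable *)

Section StableTail.
Context {R : realType} {d : measure_display} {T : measurableType d}.
Variables (P : probability T R) (alpha : R) (Z : T -> R).
Hypothesis alpha02 : 0 < alpha < 2.
Hypothesis mZ : measurable_fun setT Z.
Hypothesis cosZ : forall theta : R,
  \int[P]_w cos (theta * Z w) = expR (- (`|theta| `^ alpha)).

Notation mu := (@lebesgue_measure R).
Notation phi := (@normal_pdf R 0 1).
Local Notation m := (gauss_moment alpha).
Let C := \int[mu]_t ((1 + t ^+ 4) * phi t).
Let a0 : 0 < alpha. Proof. by case/andP: alpha02. Qed.
Let a2 : alpha < 2. Proof. by case/andP: alpha02. Qed.
Let m0 : 0 < m. Proof. exact: gauss_moment_gt0. Qed.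
Let C0 : 0 <= C.
Proof.
apply: Rintegral_ge0 => t _; rewrite mulr_ge0 ?normal_pdf_ge0//.
by rewrite addr_ge0// exprn_even_ge0.
Qed.

(** For [h > 0], the event [|Z| > h] is [Y h < e^(-1/2)], and [Y h ^+ k] is the Laplace kernel at
    scale [sqrt k / h]. Polynomials in [Y h] thus have computable expectations and can approximate
    the indicator of the event. *)
Let Y (h : R) (w : T) := expR (- (h^-1 * Z w) ^+ 2 / 2).
Let pr (h : R) := fine (P [set w | h < `|Z w|]).
Let tail h := h `^ alpha * pr h.

Let mpr h : measurable [set w | h < `|Z w|].
Proof.
rewrite -[X in measurable X]setTI.
have mA : measurable_fun setT (fun w => `|Z w|) by exact: measurableT_comp.
by have := mA measurableT `]h, +oo[%classic (measurable_itv _); rewrite set_itvoy.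
Qed.

Let mY h : measurable_fun setT (Y h).
Proof.
apply: measurableT_comp; first exact: measurable_expR.
apply: measurable_funM => //; apply: measurableT_comp => //.
by apply: measurable_funX; exact: measurable_funM.
Qed.

Let Y01 h w : 0 < Y h w <= 1.
Proof.
rewrite expR_gt0/= -expR0 ler_expR mulNr oppr_le0.
by rewrite divr_ge0// sqr_ge0.
Qed.

Let EYk h k : 0 < h -> (0 < k)%N ->
  `|h `^ alpha * (1 - \int[P]_w (Y h w ^+ k))
    - Num.sqrt k%:R `^ alpha * m| <= (Num.sqrt k%:R `^ alpha) ^+ 2 * C * (h `^ alpha)^-1.
Proof.
move=> h0 k0.
pose l := Num.sqrt k%:R / h.
have l0 : 0 <= l by rewrite divr_ge0 ?sqrtr_ge0// ltW.
have -> : \int[P]_w (Y h w ^+ k) = \int[P]_w expR (- (l * Z w) ^+ 2 / 2).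
  apply: eq_Rintegral => w _; rewrite -expRM_natl; congr expR.
  rewrite /l; have -> : Num.sqrt k%:R / h * Z w = Num.sqrt k%:R * (h^-1 * Z w) by rewrite mulrA.
  by rewrite [in RHS]exprMn sqr_sqrtr// !mulNr mulrN mulrA.
have := laplace_le alpha02 mZ cosZ l0.
have := laplace_ge alpha02 mZ cosZ l0.
have -> : l `^ alpha = Num.sqrt k%:R `^ alpha / h `^ alpha.
  by rewrite /l powRM ?sqrtr_ge0 ?invr_ge0 ?(ltW h0)// powRV ?(ltW h0).
have : 0 < h `^ alpha by exact: powR_gt0.
move: (\int[P]_w _) (Num.sqrt k%:R `^ alpha) (h `^ alpha) => u s H H0.
rewrite -/C => h1 h2.
have {}h1 : s * m - s ^+ 2 * C / H <= H * (1 - u).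
  have : H * (s / H * m - (s / H) ^+ 2 * C) <= H * (1 - u) by rewrite ler_pM2l.
  by apply: le_trans; rewrite le_eqVlt; apply/orP; left; apply/eqP; field; rewrite gt_eqF.
have {}h2 : H * (1 - u) <= s * m.
  have : H * (1 - u) <= H * (s / H * m) by rewrite ler_pM2l.
  by move/le_trans; apply; rewrite le_eqVlt; apply/orP; left; apply/eqP; field; rewrite gt_eqF.
rewrite ler_distlC; apply/andP; split; last by lra.
rewrite lerBlDr; apply: (le_trans h2); rewrite lerDl.
by rewrite divr_ge0 ?(ltW H0)// mulr_ge0 ?sqr_ge0.
Qed.

Let intY h k : P.-integrable setT (EFin \o (fun w => Y h w ^+ k)).
Proof.
apply: (@integrable_ubound _ _ _ _ _ 1); first exact: measurable_funX.
move=> w; have /andP[y0 y1] := Y01 h w.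
by rewrite ger0_norm ?exprn_ge0 ?(ltW y0)// exprn_ile1// ltW.
Qed.

(* The alternating coefficients sum to 0, so the expectation only involves the
   differences [1 - E Y ^ k], whose asymptotics are given by [EYk]. *)
Let Epoly (n N : nat) : (0 < n)%N -> (0 < N)%N -> exists I D, forall h, 0 < h ->
  `|h `^ alpha * \int[P]_w ((1 - Y h w ^+ n) ^+ N) - I| <= D * (h `^ alpha)^-1.
Proof.
move=> n0 N0.
pose b i : R := (-1) ^+ i *+ 'C(N, i).
have bsum : \sum_(i < N.+1) b i = 0.
  have := exprDn (1 : R) (-1) N; rewrite subrr expr0n (gtn_eqF N0) /= => e.
  by apply: (etrans _ (esym e)); apply: eq_bigr => i _; rewrite /b expr1n mul1r.
pose c i : R := Num.sqrt (n * i)%:R `^ alpha.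
exists (- \sum_(i < N.+1) b i * (c i * m)), (\sum_(i < N.+1) `|b i| * (c i ^+ 2 * C)) => h h0.
have -> : \int[P]_w ((1 - Y h w ^+ n) ^+ N) =
    \sum_(i < N.+1) b i * \int[P]_w (Y h w ^+ (n * i)).
  have -> : (fun w => (1 - Y h w ^+ n) ^+ N) =
      (fun w => \sum_(i < N.+1) b i * Y h w ^+ (n * i)).
    apply/funext => w; rewrite exprDn; apply: eq_bigr => i _.
    by rewrite expr1n mul1r exprNn -exprM /b mulrnAl.
  rewrite /Rintegral; under eq_integral do rewrite -sumEFin.
  rewrite integral_sum//; last first.
    by move=> i; exact: (integrableZl measurableT (b i) (intY h (n * i))).
  under eq_bigr => i _.
    rewrite (_ : (\int[P]_w _)%E = (b i * \int[P]_w (Y h w ^+ (n * i)))%:E); last first.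
      rewrite -RintegralZl// /Rintegral fineK//.
      exact: (integrable_fin_num measurableT (integrableZl measurableT (b i) (intY h (n * i)))).
    over.
  by rewrite sumEFin.
have -> : h `^ alpha * \sum_(i < N.+1) b i * \int[P]_w (Y h w ^+ (n * i)) =
   - \sum_(i < N.+1) b i * (h `^ alpha * (1 - \int[P]_w (Y h w ^+ (n * i)))).
  rewrite mulr_sumr -sumrN.
  rewrite [LHS](_ : _ = h `^ alpha * (\sum_(i < N.+1) b i) -
    \sum_(i < N.+1) b i * (h `^ alpha * (1 - \int[P]_w (Y h w ^+ (n * i))))).
    by rewrite bsum mulr0 sub0r sumrN.
  rewrite mulr_sumr -sumrB; apply: eq_bigr => i _; ring.
rewrite -opprD normrN -sumrB (le_trans (ler_norm_sum _ _ _))// mulr_suml.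
apply: ler_sum => i _; rewrite -mulrBr normrM -mulrA ler_wpM2l//.
have [i0|i0] := posnP i; last by rewrite EYk// muln_gt0 n0.
rewrite /c i0 muln0; under eq_Rintegral do rewrite expr0.
rewrite sqrtr0 powR0 ?gt_eqF// !mul0r expr0n/= !mul0r subr0.
by rewrite Rintegral_cst//= probability_setT/= mulr1 subrr mulr0 normr0.
Qed.

Let int1Y_le h : 0 < h -> h `^ alpha * (1 - \int[P]_w Y h w) <= m.
Proof.
move=> h0; have hi : 0 <= h^-1 by rewrite invr_ge0 ltW.
have := laplace_le alpha02 mZ cosZ hi; rewrite powRV ?(ltW h0)//.
by have H0 := powR_gt0 alpha h0; rewrite mulrC ler_pdivlMr// mulrC.
Qed.

Let int1Y_ge h : 0 < h -> m - C * (h `^ alpha)^-1 <= h `^ alpha * (1 - \int[P]_w Y h w).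
Proof.
move=> h0; have hi : 0 <= h^-1 by rewrite invr_ge0 ltW.
have := laplace_ge alpha02 mZ cosZ hi; rewrite powRV ?(ltW h0)//.
have H0 := powR_gt0 alpha h0; rewrite -/C => h1.
apply: (@le_trans _ _ (h `^ alpha * ((h `^ alpha)^-1 * m - (h `^ alpha)^-1 ^+ 2 * C))).
  by rewrite le_eqVlt; apply/orP; left; apply/eqP; field; rewrite gt_eqF.
by rewrite ler_pM2l.
Qed.

Let int1YE h : \int[P]_w (1 - Y h w) = 1 - \int[P]_w Y h w.
Proof.
rewrite RintegralB//; last exact: (intY h 1).
  by rewrite Rintegral_cst//= probability_setT/= mulr1.
by apply: (@integrable_ubound _ _ _ _ (cst 1) 1) => // w; rewrite normr1.
Qed.

Let Y_le h w c : 0 < h -> 0 <= c -> c * h <= `|Z w| -> Y h w <= expR (- c ^+ 2 / 2).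
Proof.
move=> h0 c0 cZ; rewrite ler_expR !mulNr lerN2 ler_pM2r ?invr_gt0//.
rewrite -[leRHS]real_normK ?num_real// lerXn2r ?nnegrE//.
by rewrite normrM gtr0_norm ?invr_gt0// mulrC ler_pdivlMr.
Qed.

Let Y_ge h w c : 0 < h -> `|Z w| <= c * h -> expR (- c ^+ 2 / 2) <= Y h w.
Proof.
move=> h0 cZ; rewrite ler_expR !mulNr lerN2 ler_pM2r ?invr_gt0//.
have c0 : 0 <= c by rewrite -(pmulr_lge0 _ h0) (le_trans _ cZ).
rewrite -[leLHS]real_normK ?num_real// lerXn2r ?nnegrE//.
by rewrite normrM gtr0_norm ?invr_gt0// mulrC ler_pdivrMr.
Qed.

Let ind_le1 (A : set T) (w : T) : `|\1_A w : R| <= 1.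
Proof. by rewrite indicE; case: (_ \in _); rewrite ?normr1 ?normr0. Qed.

(** A Markov bound for [tail]: on [|Z| > h] the variable [1 - Y h] is at least [1 - e^(-1/2)], while
    [h^alpha E (1 - Y h) <= m]. *)
Let B := m / (1 - expR (- 1 ^+ 2 / 2)).

Let e12 : expR (- 1 ^+ 2 / 2) < 1 :> R.
Proof. by rewrite -[ltRHS]expR0 ltr_expR; lra. Qed.

Let tail_le h : 0 < h -> 0 <= tail h <= B.
Proof.
move=> h0; have H0 := powR_gt0 alpha h0.
rewrite mulr_ge0 ?(ltW H0) ?fine_ge0//=.
rewrite ler_pdivlMr ?subr_gt0//.
apply: le_trans (int1Y_le h0); rewrite -mulrA ler_pM2l// -int1YE.
rewrite /pr -Rintegral_indicator// -RintegralZr//; last first.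
  by apply: (@integrable_ubound _ _ _ _ _ 1).
apply: (@le_Rintegral_ubound _ _ _ _ _ _ 1).
- by apply: measurable_funM.
- exact: measurable_funB.
- move=> w; rewrite normrM -[leRHS]mulr1 ler_pM//.
  by rewrite ger0_norm ?subr_ge0 ?(ltW e12)// lerBlDr lerDl expR_ge0.
- move=> w; have /andP[y0 y1] := Y01 h w.
  by rewrite ger0_norm ?subr_ge0// lerBlDr lerDl ltW.
- move=> w; have /andP[y0 y1] := Y01 h w; rewrite indicE.
  have [/set_mem/= hw|_] := boolP (_ \in _); last by rewrite mul0r subr_ge0.
  by rewrite mul1r lerD2l lerN2 Y_le// mul1r ltW.
Qed.

(** The step polynomial in [Y h], with thresholds [e^(-1/2)] and [e^(-c^2/2)] for [c] slightly below
    1, has a scaled expectation [E h] that converges to some [I] and is trapped between [tail] at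
    [h] and at [c h]. Since [I] depends on [rho], this bounds the oscillation of [tail] rather than
    identifying its limit. *)
Let tail_cauchy (rho : R) : 0 < rho < 2^-1 ->
  exists I, [/\ 0 <= I + rho, I <= 2 * B + m + 1 &
   \forall h \near +oo, (1 - rho) * (I - rho - rho * m) <= tail h /\
                        (1 - rho) * tail h <= I + rho].
Proof.
move=> /andP[r0 r1].
(* Chosen so that [c^alpha >= c^2 >= 1 - rho]: moving from level [h] to [c h] costs at most a factor
   [1 - rho]. *)
pose eps := rho / 2.
pose c := 1 - eps.
have c0 : 0 < c by rewrite /c /eps; lra.
have c1 : c < 1 by rewrite /c /eps; lra.
have y1y0 : expR (- 1 ^+ 2 / 2) < expR (- c ^+ 2 / 2).
  by rewrite ltr_expR; nra.
have y01 : expR (- c ^+ 2 / 2) < 1 by rewrite -[ltRHS]expR0 ltr_expR; nra.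
have rho1 : 0 < rho < 1 by rewrite r0/=; lra.
have [n [N [n0 N0 s1 s0]]] := step_polynomial (expR_gt0 _) y1y0 y01 rho1.
have [I [D hI]] := Epoly n0 N0.
pose E h := h `^ alpha * \int[P]_w ((1 - Y h w ^+ n) ^+ N).
have mp h : measurable_fun setT (fun w => (1 - Y h w ^+ n) ^+ N).
  by apply: measurable_funX; apply: measurable_funB => //; exact: measurable_funX.
have p01 h w : 0 <= (1 - Y h w ^+ n) ^+ N <= 1.
  have /andP[y0 y1] := Y01 h w.
  have k0 : 0 <= Y h w ^+ n by rewrite exprn_ge0// ltW.
  have k1 : Y h w ^+ n <= 1 by rewrite exprn_ile1// ltW.
  by rewrite exprn_ge0 ?exprn_ile1 ?subr_ge0// lerBlDr lerDl.
have up h : 0 < h -> (1 - rho) * tail h <= E h.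
  move=> h0; have H0 := powR_gt0 alpha h0.
  rewrite /E mulrCA ler_pM2l// /pr -Rintegral_indicator// -RintegralZl//; last first.
    by apply: (@integrable_ubound _ _ _ _ _ 1).
  apply: (@le_Rintegral_ubound _ _ _ _ _ _ 1) => //.
  - exact: measurable_funM.
  - move=> w; rewrite normrM -[leRHS]mulr1 ler_pM//.
    by rewrite ger0_norm; lra.
  - by move=> w; have /andP[q0 q1] := p01 h w; rewrite ger0_norm.
  - move=> w; have /andP[y0 y1] := Y01 h w; rewrite indicE.
    have [/set_mem/= hw|_] := boolP (_ \in _); last by rewrite mulr0; have /andP[] := p01 h w.
    by rewrite mulr1 s1// (ltW y0) Y_le// mul1r ltW.
(* On [|Z| <= c h] the polynomial is at most [rho (1 - Y h)]. The factor [1 - Y h] is essential: its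
   expectation is of order [h^-alpha], so the error stays below [rho m] after scaling, whereas a
   constant error would blow up. *)
have lo h : 0 < h -> c `^ alpha * (E h - rho * m)
     <= tail (c * h).
  move=> h0; have H0 := powR_gt0 alpha h0.
  rewrite /E /tail powRM ?(ltW c0) ?(ltW h0)// -mulrA ler_pM2l ?powR_gt0//.
  have := int1Y_le h0; rewrite -int1YE => iY.
  rewrite lerBlDr; apply: (@le_trans _ _ (h `^ alpha * pr (c * h) +
      rho * (h `^ alpha * \int[P]_w (1 - Y h w)))); last first.
    by rewrite lerD2l ler_wpM2l// ltW.
  rewrite mulrCA -mulrDr ler_pM2l//.
  have iind : P.-integrable setT (EFin \o \1_[set w | (c * h < `|Z w|)%R]).
    by apply: (@integrable_ubound _ _ _ _ _ 1).
  have i1Y : P.-integrable setT (EFin \o (fun w => 1 - Y h w)).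
    apply: (@integrable_ubound _ _ _ _ _ 1); first exact: measurable_funB.
    move=> w; have /andP[y0 y1] := Y01 h w.
    by rewrite ger0_norm ?subr_ge0// lerBlDr lerDl ltW.
  rewrite /pr -Rintegral_indicator// -RintegralZl// -RintegralD//; last first.
    exact: (integrableZl measurableT rho i1Y).
  apply: (@le_Rintegral_ubound _ _ _ _ _ _ 2) => //.
  - apply: measurable_funD => //; apply: measurable_funM => //.
    exact: measurable_funB.
  - by move=> w; have /andP[q0 q1] := p01 h w; rewrite ger0_norm//; lra.
  - move=> w; have /andP[y0 y1] := Y01 h w.
    rewrite (le_trans (ler_normD _ _))//.
    have := ind_le1 [set w | (c * h < `|Z w|)%R] w.
    rewrite normrM !ger0_norm ?subr_ge0 ?(ltW r0)//; nra.
  - move=> w; have /andP[y0 y1] := Y01 h w; rewrite indicE.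
    have [/set_mem/= hw|/negP hw] := boolP (_ \in _).
      have : 0 <= rho * (1 - Y h w) by rewrite mulr_ge0 ?subr_ge0// ltW.
      by have /andP[_] := p01 h w; lra.
    rewrite add0r s0// y1 andbT Y_ge// leNgt; apply/negP => ?.
    by apply: hw; rewrite inE.
have near1 : \forall h \near +oo, 0 < h /\ `|E h - I| <= rho.
  have [D0|D0] := leP D 0; near=> h; (have h0 : 0 < h by near: h; exact: nbhs_pinfty_gt);
    split => //; apply: (le_trans (hI h h0)).
    by apply: (@le_trans _ _ 0); rewrite ?(ltW r0)// mulr_le0_ge0// invr_ge0 powR_ge0.
  rewrite mulrC -ler_pdivlMr//; near: h.
  exact: near_pinfty_powRV_le a0 (divr_gt0 r0 D0).
have ci0 : 0 < c^-1 by rewrite invr_gt0.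
have near2 := near_pinfty_scale ci0 near1.
have ca : 1 - rho <= c `^ alpha.
  apply: (@le_trans _ _ (c ^+ 2)); first by rewrite /c /eps; nra.
  rewrite -powR_mulrn ?(ltW c0)//; apply: ger_powR; first by rewrite c0 ltW.
  exact: ltW.
have ca1 : c `^ alpha <= 1.
  by have := ge0_ler_powR (ltW a0) (ltW c0 : c \in Num.nneg) (ler01 : 1 \in Num.nneg) (ltW c1); rewrite powR1.
have [h [h0 hh]] := filter_ex near1; move: hh.
rewrite ler_distl => /andP[I1 I2].
have ch0 : 0 < c * h by rewrite mulr_gt0.
have /andP[t0 t1] := tail_le h0.
have /andP[t2 t3] := tail_le ch0.
exists I; split.
- have : 0 <= (1 - rho) * tail h by rewrite mulr_ge0//; lra.
  by have := up h h0; lra.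
- have := lo h h0; move: I1 I2 t0 t1 t2 t3 m0; move: (E h) (tail _) (tail _) => E' t t' I1 I2 t0 t1 t2 t3 m0' l1.
  have [neg|pos] := leP (E' - rho * m) 0; first by nra.
  have : 2^-1 * (E' - rho * m) <= c `^ alpha * (E' - rho * m).
    by rewrite ler_pM2r//; lra.
  nra.
- apply: filterS2 near1 near2 => g [g0 hg] [cg0 hcg].
  have /andP[I5 I6] : I - rho <= E g <= I + rho.
    rewrite -ler_distl; exact: hg.
  have /andP[I3 I4] : I - rho <= E (c^-1 * g) <= I + rho.
    rewrite -ler_distl; exact: hcg.
  have /andP[t4 t5] := tail_le g0.
  have := up g g0; have := lo _ cg0; rewrite mulVKf ?gt_eqF// => l1 u1.
  split; first last.
    exact: le_trans u1 I6.
  have [neg|pos] := leP (I - rho - rho * m) 0.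
    apply: (@le_trans _ _ 0) => //; apply: mulr_ge0_le0 => //.
    by rewrite subr_ge0 ltW//; case/andP: rho1.
  apply: le_trans l1; apply: (@le_trans _ _ (c `^ alpha * (I - rho - rho * m))).
    by rewrite ler_pM2r.
  have ca0 : 0 < c `^ alpha by exact: powR_gt0.
  apply: (ler_wpM2l (ltW ca0)).
  exact: lerD I3 (lexx _).
Unshelve. all: by end_near. Qed.

Lemma cvg_tail : cvg (tail h @[h --> +oo]).
Proof.
apply: cauchy_cvg; apply: cauchy_exP => e e0.
have B0 : 0 <= B by rewrite divr_ge0 ?(ltW m0)// subr_ge0 ltW.
(* [rho * k] bounds both deviations of [tail h] from [I], given [I <= 2 B + m + 1]; [rho <= 1/4]
   controls the division by [1 - rho]. *)
pose k := 2 * (2 * B + m + 2) + (1 + m).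
have k0 : 0 < k by rewrite /k; have := m0; lra.
pose rho := Num.min (4^-1) (e / 2 / k).
have rk : rho * k <= e / 2 by rewrite -ler_pdivlMr// /rho ge_min lexx orbT.
have r4 : rho <= 4^-1 by rewrite /rho ge_min lexx.
have r0 : 0 < rho by rewrite lt_min invr_gt0 divr_gt0// ?divr_gt0//; lra.
have rr : 0 < rho < 2^-1 by rewrite r0/=; lra.
have [I [I0 I1 nI]] := tail_cauchy rr.
have arith t : (1 - rho) * (I - rho - rho * m) <= t -> (1 - rho) * t <= I + rho ->
    I - e < t < I + e.
  have : rho * m * rho >= 0 by rewrite !mulr_ge0 ?ltW.
  move: rk r4 r0 I0 I1 m0 B0; rewrite /k; move: m B => m' B' *.
  by apply/andP; split; nra.
exists I; suff : \forall h \near +oo, ball I e (tail h) by [].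
apply: filterS nI => h [h1 h2].
by rewrite /ball/= ltr_distlC; exact: arith.
Qed.

(** Split [E (1 - Y h)], of size [m h^-alpha], at [|Z| = del h]. Below,
    [1 - Y h <= 2 del^2 (1 - Y (del h))], which contributes at most [2 del^(2 - alpha) m] after
    scaling; for small [del] this is not all of [m], so the part [|Z| > del h] keeps a positive
    share. *)
Lemma tail_lim_gt0 (K : R) : tail h @[h --> +oo] --> K -> 0 < K.
Proof.
move=> tK.
(* The solution of [2 del^(2 - alpha) = 1/2]: small values account for at most half of [m]. *)
pose del : R := 4^-1 `^ (2 - alpha)^-1.
have del0 : 0 < del by rewrite powR_gt0// invr_gt0.
have D0 : 0 < del `^ alpha by exact: powR_gt0.
have dela : 2 * (del ^+ 2 / del `^ alpha) = 2^-1.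
  rewrite -powR_mulrn ?(ltW del0)// -powRB; last by rewrite (gt_eqF del0) implybT.
  rewrite /del -powRrM mulVf ?powRr1 ?invr_ge0//; last by rewrite gt_eqF// subr_gt0.
  by field.
have key h : 0 < h -> C * (h `^ alpha)^-1 <= m / 4 ->
    m / 4 * del `^ alpha <= tail (del * h).
  move=> h0 Ch.
  have H0 := powR_gt0 alpha h0.
  have dh0 : 0 < del * h by rewrite mulr_gt0.
  have l1 := int1Y_ge h0.
  have l2 := int1Y_le dh0.
  have key1 : 1 - \int[P]_w Y h w <=
      2 * del ^+ 2 * (1 - \int[P]_w Y (del * h) w) + pr (del * h).
    have iind : P.-integrable setT (EFin \o \1_[set w | (del * h < `|Z w|)%R]).
      by apply: (@integrable_ubound _ _ _ _ _ 1).
    have i1Y g : P.-integrable setT (EFin \o (fun w => 1 - Y g w)).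
      apply: (@integrable_ubound _ _ _ _ _ 1); first exact: measurable_funB.
      move=> w; have /andP[y0 y1] := Y01 g w.
      by rewrite ger0_norm ?subr_ge0// lerBlDr lerDl ltW.
    have i2Y := integrableZl measurableT (2 * del ^+ 2) (i1Y (del * h)).
    rewrite -!int1YE /pr -Rintegral_indicator// -RintegralZl// -RintegralD//.
    apply: le_Rintegral => //; first exact: (integrableD measurableT i2Y iind).
    move=> w _; have /andP[y0 y1] := Y01 h w; have /andP[y2 y3] := Y01 (del * h) w.
    rewrite indicE; have [/set_mem/= hw|/negP hw] := boolP (_ \in _).
      have : 0 <= 2 * del ^+ 2 * (1 - Y (del * h) w).
        by rewrite !mulr_ge0 ?subr_ge0// ltW.
      move=> z0; apply: (@le_trans _ _ 1); last by rewrite lerDr.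
      by rewrite lerBlDr lerDl ltW.
    rewrite addr0.
    have {}hw : `|Z w| <= del * h.
      by rewrite leNgt; apply/negP => hw'; apply: hw; rewrite inE.
    pose u := ((del * h)^-1 * Z w) ^+ 2 / 2.
    have u0 : 0 <= u by rewrite divr_ge0 ?sqr_ge0.
    have u1 : u <= 2^-1.
      rewrite /u ler_pdivrMr// mulVf// -[leLHS]real_normK ?num_real//.
      rewrite exprn_ile1 ?normr_ge0// normrM gtr0_norm ?invr_gt0//.
      by rewrite mulrC ler_pdivrMr// mul1r.
    have -> : Y (del * h) w = expR (- u) by rewrite /Y mulNr.
    have -> : Y h w = expR (- (del ^+ 2 * u)).
      rewrite /Y mulNr /u; congr (expR (- _)); field.
      by rewrite !gt_eqF.
    have := expR_ge1Dx (- (del ^+ 2 * u)).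
    have u11 : 0 <= u <= 1 by rewrite u0 (le_trans u1)// invf_le1// ler1n.
    have := ler_wpM2l (sqr_ge0 del) (le_one_sub_expRN u11).
    move: (del ^+ 2) (expR (- (_ * _))) (expR _) => q e e'.
    move: (q * u) => qu; lra.
  have : h `^ alpha * (1 - \int[P]_w Y h w) <= 2^-1 * m + (del `^ alpha)^-1 * tail (del * h).
    apply: (@le_trans _ _ (h `^ alpha * (2 * del ^+ 2 * (1 - \int[P]_w Y (del * h) w) + pr (del * h)))).
      by rewrite ler_pM2l.
    rewrite -dela /tail; move: l2; rewrite powRM ?(ltW del0) ?(ltW h0)//.
    move: (Rintegral _ _ _) (pr _) => E p l2.
    have -> : h `^ alpha * (2 * del ^+ 2 * (1 - E) + p) =
       2 * (del ^+ 2 / del `^ alpha) * (del `^ alpha * h `^ alpha * (1 - E))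
       + (del `^ alpha)^-1 * (del `^ alpha * h `^ alpha * p) by field; rewrite gt_eqF.
    rewrite lerD2r ler_pM2l//.
    by rewrite mulr_gt0// divr_gt0// exprn_gt0.
  move=> k2; rewrite mulrC -ler_pdivlMl//.
  move: l1 Ch k2; move: (_ * (1 - _)) (C * _) (_ * tail _) => x y z.
  move: m => m'; lra.
apply: (@lt_le_trans _ _ (m / 4 * del `^ alpha)).
  by rewrite mulr_gt0// divr_gt0.
have ci0 : 0 < del^-1 by rewrite invr_gt0.
apply: (cvgr_to_ge tK); near=> h.
have -> : h = del * (del^-1 * h) by rewrite mulVKf// gt_eqF.
have h0 : 0 < del^-1 * h by rewrite mulr_gt0//; near: h; exact: nbhs_pinfty_gt.
apply: key => //.
near: h; apply: (near_pinfty_scale (Q := fun h => C * (h `^ alpha)^-1 <= m / 4)) => //.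
have : 0 < (C + 1)^-1 * (m / 4).
  by rewrite mulr_gt0 ?divr_gt0// invr_gt0 ltr_pwDr.
move=> /(near_pinfty_powRV_le a0); apply: filterS => h hh.
apply: (@le_trans _ _ ((C + 1) * (h `^ alpha)^-1)).
  by rewrite ler_wpM2r ?invr_ge0 ?powR_ge0// lerDl.
apply: le_trans (ler_wpM2l _ hh) _; first by rewrite addr_ge0.
by rewrite mulVKf// gt_eqF// ltr_pwDr.
Unshelve. all: by end_near. Qed.

End StableTail.

(** * One-sided tail of a stable variable *)

Section Symmetry.
Context {R : realType} {d : measure_display} {T : measurableType d}.
Variable P : probability T R.
Notation mu := (@lebesgue_measure R).
Notation phi := (@normal_pdf R 0 1).
Local Notation C := (\int[mu]_t ((1 + t ^+ 4) * phi t)).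

Lemma normal_pdf_shift (z x : R) : normal_pdf z 1 x = phi (x - z).
Proof. by rewrite !normal_pdfE// /normal_fun subr0. Qed.

Lemma gauss_shift_moment_le (z : R) :
  (\int[mu]_x ((x - z) ^+ 2 * phi (x - z))%:E <= C%:E)%E.
Proof.
have d1 : (fun x : R => x - z)^`()%classic = cst 1.
  by apply/funext => x; rewrite derive1E deriveB// derive_id derive_cst subr0.
have cphi : continuous phi by exact: continuous_normal_pdf.
have := @increasing_ge0_integration_by_substitutionT R (fun x => x - z)
  (fun u => u ^+ 2 * phi u).
rewrite d1 => H.
have -> : (\int[mu]_x ((x - z) ^+ 2 * phi (x - z))%:E =
  \int[mu]_x (x ^+ 2 * phi x)%:E)%E.
  rewrite H.
  - by apply: eq_integral => x _; rewrite /= fctE/= mulr1.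
  - by move=> x y xy; rewrite ltrD2r.
  - by move=> x; exact: cst_continuous.
  - exact: is_cvg_cst.
  - exact: is_cvg_cst.
  - move=> x; exact: ex_derive.
  - exact: cvg_addrr_Ny.
  - exact: cvg_addrr.
  - move=> x; apply: cvgM; last exact: cphi.
    exact: sqr_continuous.
  - by move=> x; rewrite mulr_ge0 ?sqr_ge0 ?normal_pdf_ge0.
rewrite /Rintegral fineK; last exact: (integrable_fin_num measurableT (@integrable_gauss_poly R)).
apply: ge0_le_integral => //.
- by move=> x _; rewrite lee_fin mulr_ge0 ?sqr_ge0 ?normal_pdf_ge0.
- apply/measurable_EFinP/measurable_funM; last exact: measurable_normal_pdf.
  exact: measurable_funX.
- exact: (measurable_int _ (@integrable_gauss_poly R)).
- move=> x _; rewrite lee_fin ler_wpM2r ?normal_pdf_ge0//.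
  have -> : x ^+ 4 = (x ^+ 2) ^+ 2 by rewrite -exprM.
  have := sqr_ge0 (x ^+ 2 - 1); have := sqr_ge0 (x ^+ 2 ); nra.
Qed.

(** Chebyshev's inequality, with [C] as an upper bound for the unit variance, from
    [x^2 <= 1 + x^4]. *)
Lemma normal_prob_far (z l : R) (A : set R) : measurable A -> 0 < l ->
  (forall x, A x -> l <= `|x - z|) ->
  (normal_prob z 1 A <= (C / l ^+ 2)%:E)%E.
Proof.
move=> mA l0 Al.
have mf : measurable_fun setT (fun x : R => (x - z) ^+ 2 * phi (x - z)).
  apply: measurable_funM; first by apply: measurable_funX; exact: measurable_funB.
  apply: measurableT_comp; first exact: measurable_normal_pdf.
  exact: measurable_funB.
apply: (@le_trans _ _ (\int[mu]_x ((l ^+ 2)^-1%:E * ((x - z) ^+ 2 * phi (x - z))%:E))%E).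
  rewrite /normal_prob integral_mkcond.
  apply: ge0_le_integral => //.
  - by move=> x _; rewrite patchE; case: ifP => // _; rewrite lee_fin normal_pdf_ge0.
  - apply/(measurable_restrictT _ _).1 => //; apply: measurable_funTS.
    by apply/measurable_EFinP; exact: measurable_normal_pdf.
  - by apply: measurable_funeM; apply/measurable_EFinP.
  - move=> x _; rewrite patchE; case: ifPn => [/set_mem xA|_]; last first.
      rewrite -[point]/(0%E) -EFinM lee_fin.
      by rewrite mulr_ge0 ?invr_ge0 ?sqr_ge0// mulr_ge0 ?sqr_ge0 ?normal_pdf_ge0.
    rewrite normal_pdf_shift -EFinM lee_fin mulrA ler_peMl ?normal_pdf_ge0//.
    rewrite mulrC ler_pdivlMr ?exprn_gt0// mul1r -[leRHS]real_normK ?num_real//.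
    by rewrite lerXn2r ?nnegrE ?(ltW l0)// Al.
rewrite ge0_integralZl//.
- rewrite mulrC EFinM lee_pmul2l ?lte_fin ?invr_gt0 ?exprn_gt0//.
  exact: gauss_shift_moment_le.
- exact/measurable_EFinP.
- by move=> x _; rewrite lee_fin mulr_ge0 ?sqr_ge0 ?normal_pdf_ge0.
- by rewrite lee_fin invr_ge0 sqr_ge0.
Qed.

Section Smoothing.
Variable Z : T -> R.
Hypothesis mZ : measurable_fun setT Z.
Hypothesis sinZ : forall theta : R, \int[P]_w sin (theta * Z w) = 0.

Let mpdf (s : R) : measurable_fun setT
  (fun z : T * measurableTypeR R => phi (z.2 - s * Z z.1)).
Proof.
apply: measurableT_comp; first exact: measurable_normal_pdf.
apply: measurable_funB; first exact: measurable_snd.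
apply: measurable_funM => //; exact: (measurableT_comp mZ measurable_fst).
Qed.

Let int_sin_cos (f : R -> R) (g : T -> R) : measurable_fun setT f ->
  (forall x, `|f x| <= 1) -> measurable_fun setT g ->
  P.-integrable setT (EFin \o (f \o g)).
Proof.
move=> mf f1 mg; apply: (@integrable_ubound _ _ _ _ _ 1); first exact: measurableT_comp.
by move=> w; exact: f1.
Qed.

(** The two sides are the densities at [x] of [Z + G] and [- Z + G], for [G] a standard Gaussian
    independent of [Z]. Each is a Gaussian average of [E cos ((x + s Z) t)] with [s = -1] or
    [s = 1]; the addition formula and [sinZ] leave only [cos (x t) * E cos (s t Z)], which is even
    in [s]. *)
Lemma expect_gauss_shift_sym (x : R) :
  \int[P]_w phi (x - Z w) = \int[P]_w phi (x + Z w).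
Proof.
have phiE u : phi u = normal_peak 1 * expR (- u ^+ 2 / 2).
  by rewrite normal_pdfE// /normal_fun subr0 expr1n.
have main (s : R) : measurable_fun setT (fun w => x + s * Z w) ->
    \int[P]_w phi (x + s * Z w) = normal_peak 1 *
     \int[mu]_t (cos (x * t) * (\int[P]_w cos (s * t * Z w)) * phi t).
  move=> ms.
  under eq_Rintegral do rewrite phiE.
  rewrite RintegralZl//; last first.
    apply: (@integrable_ubound _ _ _ _ _ 1).
      apply: measurableT_comp; first exact: measurable_expR.
      apply: measurable_funM => //; apply: measurableT_comp => //.
      exact: measurable_funX.
    move=> w; rewrite ger0_norm ?expR_ge0// -expR0 ler_expR mulNr oppr_le0.
    by rewrite divr_ge0 ?sqr_ge0.
  congr (_ * _); rewrite expect_gauss//; apply: eq_Rintegral => t _; congr (_ * _).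
  transitivity (\int[P]_w (cos (x * t) * cos (s * t * Z w) - sin (x * t) * sin (s * t * Z w))).
    apply: eq_Rintegral => w _; rewrite -cosD; congr cos; ring.
  have ic : P.-integrable setT (EFin \o (cos \o (fun w => s * t * Z w))).
    apply: int_sin_cos; [exact: measurable_cos|exact: cos_max|exact: measurable_funM].
  have is' : P.-integrable setT (EFin \o (sin \o (fun w => s * t * Z w))).
    apply: int_sin_cos; [exact: measurable_sin|exact: sin_max|exact: measurable_funM].
  rewrite RintegralB//; first last.
  - exact: (integrableZl measurableT (sin (x * t)) is').
  - exact: (integrableZl measurableT (cos (x * t)) ic).
  rewrite RintegralZl// [X in _ - X]RintegralZl//.
  by rewrite sinZ mulr0 subr0.
have m1 (s : R) : measurable_fun setT (fun w => x + s * Z w).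
  by apply: measurable_funD => //; exact: measurable_funM.
transitivity (\int[P]_w phi (x + -1 * Z w)).
  by apply: eq_Rintegral => w _; rewrite mulN1r.
transitivity (\int[P]_w phi (x + 1 * Z w)); last first.
  by apply: eq_Rintegral => w _; rewrite mul1r.
apply: (etrans (main (-1) (m1 (-1)))); apply: (etrans _ (esym (main 1 (m1 1)))).
congr (_ * _); apply: eq_Rintegral => t _; congr (_ * _ * _).
by apply: eq_Rintegral => w _; rewrite mul1r mulN1r mulNr cosN.
Qed.

Let kern (A : set R) (s : R) (z : T * measurableTypeR R) :=
  (phi (z.2 - s * Z z.1) * \1_A z.2)%:E.

Let mkern A s : measurable A -> measurable_fun setT (kern A s).
Proof.
move=> mA; apply/measurable_EFinP/measurable_funM => //.
apply: measurableT_comp; first exact: measurable_indic.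
exact: measurable_snd.
Qed.

Let kern_ge0 A s z : (0 <= kern A s z)%E.
Proof. by rewrite lee_fin mulr_ge0 ?normal_pdf_ge0. Qed.

Let kernE A s w : measurable A ->
  (\int[mu]_x kern A s (w, x) = normal_prob (s * Z w) 1 A)%E.
Proof.
move=> mA; rewrite /normal_prob [RHS]integral_mkcond; apply: eq_integral => x _.
rewrite /kern patchE indicE /=; case: ifPn => _; last by rewrite mulr0.
by rewrite mulr1 (normal_pdf_shift (s * Z w)).
Qed.

Let measurable_normal_prob A s : measurable A ->
  measurable_fun setT (fun w => normal_prob (s * Z w) 1 A).
Proof.
move=> mA.
have := measurable_fun_fubini_tonelli_F (m2 := mu) _ (mkern s mA) (kern_ge0 A s).
by apply: eq_measurable_fun => w _; rewrite /fubini_F kernE.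
Qed.

(** [normal_prob (Z w) 1 A] is the conditional probability that [Z + G] lies in [A]; integrating the
    densities of the previous lemma over [A] shows that [Z + G] and [- Z + G] have the same law. *)
Lemma expect_normal_prob_sym (A : set R) : measurable A ->
  (\int[P]_w normal_prob (Z w) 1 A = \int[P]_w normal_prob (- Z w) 1 A)%E.
Proof.
move=> mA.
have main (s : R) : (\int[P]_w normal_prob (s * Z w) 1 A =
    \int[mu]_(x in A) (\int[P]_w phi (x - s * Z w))%:E)%E.
  have := fubini_tonelli (m1 := P) (m2 := mu) _ (mkern s mA) (kern_ge0 A s).
  have e2 x : (\int[P]_w kern A s (w, x) = if x \in A then (\int[P]_w phi (x - s * Z w))%:E else 0)%E.
    rewrite /kern /= indicE; case: ifPn => _.
      under eq_integral do rewrite mulr1.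
      rewrite /Rintegral fineK//; apply: (integrable_fin_num measurableT).
      apply: (@integrable_ubound _ _ _ _ _ (normal_peak 1)).
        apply: measurableT_comp; first exact: measurable_normal_pdf.
        by apply: measurable_funB => //; exact: measurable_funM.
      by move=> w; rewrite ger0_norm ?normal_pdf_ge0// normal_pdf_ub.
    by apply: integral0_eq => w _; rewrite mulr0.
  under eq_integral do rewrite kernE//.
  under [X in _ = X -> _]eq_integral do rewrite e2.
  move=> ->; rewrite [RHS]integral_mkcond; apply: eq_integral => x _.
  by rewrite patchE.
transitivity (\int[P]_w normal_prob (1 * Z w) 1 A)%E.
  by apply: eq_integral => w _; rewrite mul1r.
transitivity (\int[P]_w normal_prob (-1 * Z w) 1 A)%E; last first.
  by apply: eq_integral => w _; rewrite mulN1r.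
apply: (etrans (main 1)); apply: (etrans _ (esym (main (-1)))).
apply: eq_integral => x _; congr EFin.
transitivity (\int[P]_w phi (x - Z w)).
  by apply: eq_Rintegral => w _; rewrite mul1r.
rewrite expect_gauss_shift_sym.
by apply: eq_Rintegral => w _; rewrite mulN1r opprK.
Qed.

(* Both laws are convolved with the standard Gaussian, which moves mass farther
   than [l] with probability at most [C / l ^ 2]. *)
Lemma tail_sym_le (h l : R) : 0 < l ->
  (1 - C / l ^+ 2) * fine (P [set w | h + l < Z w]) <=
  fine (P [set w | h - l < - Z w]) + C / l ^+ 2.
Proof.
move=> l0.
have mS (s c : R) : measurable [set w | c < s * Z w].
  rewrite -[X in measurable X]setTI.
  have mA : measurable_fun setT (fun w => s * Z w) by exact: measurable_funM.
  by have := mA measurableT `]c, +oo[%classic (measurable_itv _); rewrite set_itvoy.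
have mS1 : measurable [set w | h + l < Z w].
  by have := mS 1 (h + l); under eq_set do rewrite mul1r.
have mS2 : measurable [set w | h - l < - Z w].
  by have := mS (-1) (h - l); under eq_set do rewrite mulN1r.
pose A := `[h, +oo[%classic : set R.
have mA : measurable A by exact: measurable_itv.
pose c := C / l ^+ 2.
have c0 : 0 <= c.
  rewrite divr_ge0 ?sqr_ge0//; apply: Rintegral_ge0 => t _.
  by rewrite mulr_ge0 ?normal_pdf_ge0// addr_ge0// exprn_even_ge0.
have := expect_normal_prob_sym mA.
have np0 z : (0 <= normal_prob z 1 A)%E by exact: measure_ge0.
have iE (S : set T) (k : R) : measurable S -> 0 <= k ->
    (\int[P]_w (k * \1_S w)%:E = (k * fine (P S))%:E)%E.
  move=> mS' k0; under eq_integral do rewrite EFinM.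
  rewrite ge0_integralZl//; [|exact/measurable_EFinP/measurable_indic].
  by rewrite integral_indic// setIT EFinM prob_fineK.
have lo : (((1 - c) * fine (P [set w | (h + l < Z w)%R]))%:E <=
    \int[P]_w normal_prob (Z w) 1 A)%E.
  have [c1|c1] := leP (1 - c) 0.
    apply: (@le_trans _ _ 0%E); last exact: integral_ge0.
    by rewrite lee_fin mulr_le0_ge0// fine_ge0.
  rewrite -iE ?(ltW c1)//; apply: ge0_le_integral => //.
  - by move=> w _; rewrite lee_fin mulr_ge0// ltW.
  - by apply/measurable_EFinP/measurable_funM => //; exact: measurable_indic.
  - have := measurable_normal_prob 1 mA.
    by apply: eq_measurable_fun => w _; rewrite mul1r.
  - move=> w _; rewrite indicE; have [/set_mem/= hw|_] := boolP (_ \in _); last first.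
      by rewrite mulr0; exact: np0.
    rewrite mulr1.
    have -> : A = ~` `]-oo, h[%classic by rewrite setCitvl.
    rewrite probability_setC ?measurable_itv// EFinB leeB//.
    apply: normal_prob_far => // x; rewrite /= in_itv/= => xh.
    rewrite ler_normr; apply/orP; right; lra.
have hi : (\int[P]_w normal_prob (- Z w) 1 A <=
   (fine (P [set w | (h - l < - Z w)%R]) + c)%:E)%E.
  pose S := [set w | h - l < - Z w].
  have -> : (fine (P S) + c)%:E = (\int[P]_w (1 * \1_S w)%:E + \int[P]_w (cst c%:E) w)%E.
    by rewrite iE// mul1r integral_cst//= probability_setT mule1.
  rewrite -ge0_integralD//; first last.
  - by apply/measurable_EFinP/measurable_funM => //; exact: measurable_indic.
  apply: ge0_le_integral => //.
  - have := measurable_normal_prob (-1) mA.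
    by apply: eq_measurable_fun => w _; rewrite mulN1r.
  - apply: emeasurable_funD => //.
    by apply/measurable_EFinP/measurable_funM => //; exact: measurable_indic.
  - move=> w _; rewrite indicE mul1r; have [/set_mem/= hw|/negP hw] := boolP (_ \in _).
      apply: (@le_trans _ _ 1%E); first exact: probability_le1.
      by rewrite -EFinD lee_fin lerDl.
    rewrite /= add0e.
    apply: normal_prob_far => // x; rewrite /A /= in_itv/= andbT => xh.
    have : ~ (h - l < - Z w) by move=> ?; apply: hw; rewrite inE.
    move/negP; rewrite -leNgt => ?.
    rewrite ler_normr; apply/orP; left; lra.
by move=> e; move: lo; rewrite e => /le_trans/(_ hi); rewrite lee_fin.
Qed.
End Smoothing.

End Symmetry.

(** A comparison of tails at the levels [r h] and [h / r], with [r] arbitrarily close to 1,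
    determines the limit: for [r^alpha = 1 + eta] the rescaling costs a factor [1 + eta]. Both the
    one-sided tail and the big jump are obtained in this way. *)
Lemma cvg_scale_squeeze (R : realType) (alpha K : R) (f t : R -> R) :
  0 < alpha -> 0 <= K -> t h @[h --> +oo] --> K ->
  (forall r e, 1 < r -> 0 < e -> \forall h \near +oo,
    (r `^ alpha)^-1 * t (r * h) - e <= f h <= r `^ alpha * t (r^-1 * h) + e) ->
  f h @[h --> +oo] --> K.
Proof.
move=> a0 K0 tK H; apply/cvgrPdist_le => e e0.
(* Since [eta <= 1], the upper estimate [(1 + eta) (K + eta) + eta] exceeds [K] by at most
   [eta (K + 3)]. *)
pose eta := Num.min 1 (e / (K + 3)).
have K3 : 0 < K + 3 by rewrite ltr_wpDl.
have eta0 : 0 < eta by rewrite lt_min ltr01 divr_gt0.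
have eta1 : eta <= 1 by rewrite ge_min lexx.
have etae : eta * (K + 3) <= e by rewrite -ler_pdivlMr// ge_min lexx orbT.
pose r := (1 + eta) `^ alpha^-1.
have ra : r `^ alpha = 1 + eta.
  by rewrite /r -powRrM mulVf ?gt_eqF// powRr1// addr_ge0// ltW.
have r0 : 0 < r by rewrite powR_gt0// addr_gt0.
have r1 : 1 < r.
  have := @gt0_ltr_powR _ alpha^-1 _ 1 (1 + eta).
  by rewrite powR1; apply; rewrite ?invr_gt0// ?nnegrE ?ltrDl// addr_ge0// ltW.
have tn : \forall h \near +oo, K - eta <= t h <= K + eta.
  move/cvgrPdist_le : tK => /(_ eta eta0); apply: filterS => h.
  by rewrite ler_distlC.
have rV0 : 0 < r^-1 by rewrite invr_gt0.
have arith (x y z : R) : K - eta <= x <= K + eta -> K - eta <= y <= K + eta ->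
    (1 + eta)^-1 * x - eta <= z <= (1 + eta) * y + eta -> `|K - z| <= e.
  move=> /andP[x1 x2] /andP[y1 y2] /andP[z1 z2].
  have z3 : x <= (1 + eta) * (z + eta).
    by rewrite -ler_pdivrMl ?addr_gt0// -lerBlDr.
  rewrite ler_distlC; apply/andP; split; nra.
apply: filterS3 (H r eta r1 eta0) (near_pinfty_scale r0 tn) (near_pinfty_scale rV0 tn).
by move=> h; rewrite ra => h1 h2 h3; exact: arith h2 h3 h1.
Qed.

(** Chebyshev errors of order [h^-2] disappear at the scale [h^-alpha], as [alpha < 2]. *)
Lemma near_pinfty_powR_sqr_le (R : realType) (alpha c e : R) : alpha < 2 -> 0 < e ->
  \forall h \near +oo, h `^ alpha * (c / h ^+ 2) <= e.
Proof.
move=> a2 e0.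
have b0 : 0 < 2 - alpha by rewrite subr_gt0.
have e1 : 0 < e / (`|c| + 1) by rewrite divr_gt0// ltr_wpDl.
apply: filterS2 (near_pinfty_powRV_le b0 e1) (nbhs_pinfty_gt (num_real 0)) => h hh h0.
have -> : h `^ alpha * (c / h ^+ 2) = c * (h `^ (2 - alpha))^-1.
  rewrite -powR_mulrn ?ltW// mulrCA; congr (_ * _).
  rewrite powRB ?(gt_eqF h0) ?implybT// invf_div//.
rewrite (le_trans (ler_norm _))// normrM [X in _ * X]ger0_norm ?invr_ge0 ?powR_ge0//.
apply: (@le_trans _ _ ((`|c| + 1) * (h `^ (2 - alpha))^-1)).
  by rewrite ler_wpM2r ?invr_ge0 ?powR_ge0// lerDl.
by rewrite mulrC -ler_pdivlMr// ltr_wpDl.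
Qed.

Section StableOneSidedTail.
Context {R : realType} {d : measure_display} {T : measurableType d}.
Variables (P : probability T R) (alpha : R) (Z : T -> R).
Hypothesis alpha02 : 0 < alpha < 2.
Hypothesis mZ : measurable_fun setT Z.
Hypothesis cosZ : forall theta : R,
  \int[P]_w cos (theta * Z w) = expR (- (`|theta| `^ alpha)).
Hypothesis sinZ : forall theta : R, \int[P]_w sin (theta * Z w) = 0.

Let a (h : R) := fine (P [set w | h < Z w]).
Let b (h : R) := fine (P [set w | h < - Z w]).
Let t h := h `^ alpha * fine (P [set w | h < `|Z w|]).

Let mgt (U : T -> R) h : measurable_fun setT U -> measurable [set w | h < U w].
Proof.
move=> mU; rewrite -[X in measurable X]setTI.
by have := mU measurableT `]h, +oo[%classic (measurable_itv _); rewrite set_itvoy.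
Qed.

Let mN : measurable_fun setT (fun w => - Z w). Proof. exact: measurableT_comp. Qed.

Let abE h : 0 < h -> fine (P [set w | h < `|Z w|]) = a h + b h.
Proof.
move=> h0; rewrite /a /b -fineD ?fin_num_measure//; try exact: mgt.
rewrite -measureU; [|exact: mgt|exact: mgt|].
  congr (fine (P _)); apply/seteqP; split => w /=.
    by rewrite ltr_normr => /orP[]; [left|right].
  by rewrite ltr_normr => -[->|->]; rewrite ?orbT.
apply/seteqP; split => w //= [h1 h2]; lra.
Qed.

Let le_a h h' : h <= h' -> a h' <= a h.
Proof.
move=> hh; apply: le_fine_prob; try exact: mgt.
by move=> w /=; exact: le_lt_trans.
Qed.

Let pr01 (S : set T) : measurable S -> 0 <= fine (P S) <= 1.
Proof.
move=> mS; rewrite fine_ge0//= -lee_fin prob_fineK//; exact: probability_le1.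
Qed.

Notation mu := (@lebesgue_measure R).
Notation phi := (@normal_pdf R 0 1).
Local Notation C := (\int[mu]_t ((1 + t ^+ 4) * phi t)).

Let ab_le h l : 0 < l -> a (h + l) <= b (h - l) + 2 * (C / l ^+ 2).
Proof.
move=> l0; have := tail_sym_le mZ sinZ h l0.
have /andP[_ a1] := pr01 (mgt (h + l) mZ).
have c0 : 0 <= C / l ^+ 2.
  rewrite divr_ge0 ?sqr_ge0//; apply: Rintegral_ge0 => x _.
  by rewrite mulr_ge0 ?normal_pdf_ge0// addr_ge0// exprn_even_ge0.
move: a1; rewrite -/(a _) -/(b _); move: (a _) (b _) (C / _) c0 => x y c c0; nra.
Qed.

Let ba_le h l : 0 < l -> b (h + l) <= a (h - l) + 2 * (C / l ^+ 2).
Proof.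
move=> l0.
have sN theta : \int[P]_w sin (theta * - Z w) = 0.
  under eq_Rintegral do rewrite mulrN -mulNr.
  exact: sinZ.
have := tail_sym_le mN sN h l0.
have /andP[_ a1] := pr01 (mgt (h + l) mN).
have c0 : 0 <= C / l ^+ 2.
  rewrite divr_ge0 ?sqr_ge0//; apply: Rintegral_ge0 => x _.
  by rewrite mulr_ge0 ?normal_pdf_ge0// addr_ge0// exprn_even_ge0.
under [X in fine (P X) + _]eq_set do rewrite opprK.
move: a1; rewrite -/(a _) -/(b _); move: (a _) (b _) (C / _) c0 => x y c c0; nra.
Qed.

(** Smoothing at width [l = (r - 1) x / 2] around [(r + 1) x / 2] compares each one-sided tail at
    [r x] with the opposite one at [x], up to [O(x^-2)]. Hence [2 a h] lies, up to a negligible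
    error, between the two-sided tails at [r h] and at [h / r]. *)
Lemma stable_tail : exists K : R, [/\ 0 < K,
  h `^ alpha * fine (P [set w | h < Z w]) @[h --> +oo] --> K &
  h `^ alpha * fine (P [set w | h < `|Z w|]) @[h --> +oo] --> 2 * K].
Proof.
have /andP[a0 a2] := alpha02.
have /cvg_ex[K tK] := cvg_tail alpha02 mZ cosZ.
have K0 : 0 < K := tail_lim_gt0 alpha02 mZ cosZ tK.
exists (K / 2); split; first by rewrite divr_gt0.
  suff H : 2 * (h `^ alpha * a h) @[h --> +oo] --> K.
    have -> : (fun h => h `^ alpha * a h) = (fun h => 2^-1 * (2 * (h `^ alpha * a h))).
      by apply/funext => h; rewrite mulKf.
    by rewrite mulrC; apply: cvgM; [exact: cvg_cst|exact: H].
  apply: (cvg_scale_squeeze a0 (ltW K0) tK) => r e r1 e0.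
  have r0 : 0 < r by exact: lt_trans r1.
  (* [c / h^2] is the smoothing error at the level [h / r], whence the factor [r^2]; it also bounds
     the error at the level [h]. *)
  pose c := 8 * C * r ^+ 2 / (r - 1) ^+ 2.
  have C0 : 0 <= C.
    apply: Rintegral_ge0 => x _.
    by rewrite mulr_ge0 ?normal_pdf_ge0// addr_ge0// exprn_even_ge0.
  have rm1 : 0 < r - 1 by rewrite subr_gt0.
  have ab2 x : 0 < x -> a (r * x) <= b x + 8 * C / ((r - 1) * x) ^+ 2 /\
      b (r * x) <= a x + 8 * C / ((r - 1) * x) ^+ 2.
    move=> x0; pose l := (r - 1) * x / 2.
    have l0 : 0 < l by rewrite divr_gt0// mulr_gt0.
    have := ab_le ((r + 1) * x / 2) l0; have := ba_le ((r + 1) * x / 2) l0.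
    have -> : (r + 1) * x / 2 + l = r * x by rewrite /l; field.
    have -> : (r + 1) * x / 2 - l = x by rewrite /l; field.
    have -> : 2 * (C / l ^+ 2) = 8 * C / ((r - 1) * x) ^+ 2.
      by rewrite /l; field; rewrite !gt_eqF.
    by [].
  apply: filterS2 (nbhs_pinfty_gt (num_real 0)) (near_pinfty_powR_sqr_le c a2 e0) => h h0 hc.
  have H0 := powR_gt0 alpha h0.
  have rh0 : 0 < r^-1 * h by rewrite mulr_gt0// invr_gt0.
  have hr : r^-1 * h <= h by rewrite ler_piMl ?(ltW h0)// invf_le1// ltW.
  have hr2 : h <= r * h by rewrite ler_peMl ?(ltW h0)// ltW.
  have [l1 l2] := ab2 h h0.
  have [u1 u2] := ab2 _ rh0.
  rewrite mulrA divff ?gt_eqF// mul1r in u1 u2.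
  have e1 : 8 * C / ((r - 1) * h) ^+ 2 <= c / h ^+ 2.
    have -> : c / h ^+ 2 = 8 * C / ((r - 1) * h) ^+ 2 * r ^+ 2.
      by rewrite /c; field; rewrite !gt_eqF.
    rewrite ler_peMr ?exprn_ege1 ?(ltW r1)// divr_ge0 ?sqr_ge0// mulr_ge0//.
  have e2 : 8 * C / ((r - 1) * (r^-1 * h)) ^+ 2 = c / h ^+ 2.
    by rewrite /c; field; rewrite !gt_eqF.
  rewrite e2 in u1 u2.
  have rV0 : 0 <= r^-1 by rewrite invr_ge0 ltW.
  rewrite /t (powRM alpha (ltW r0) (ltW h0)) (powRM alpha rV0 (ltW h0)) (powRV alpha (ltW r0)).
  have ra0 : r `^ alpha != 0 by rewrite gt_eqF// powR_gt0.
  rewrite !abE ?mulr_gt0 ?invr_gt0// -!mulrA mulKf// mulVKf//.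
  have la := le_a hr2; have ua := le_a hr.
  apply/andP; split.
    rewrite lerBlDr; apply: (@le_trans _ _ (h `^ alpha * (2 * a h + c / h ^+ 2))).
      rewrite ler_pM2l//.
      have : 8 * C / ((r - 1) * h) ^+ 2 <= c / h ^+ 2 := e1.
      move: la l2; move: (a _) (a _) (b _) (_ / _) (_ / _) => ? ? ? ? ?; lra.
    rewrite mulrDr; move: hc; move: (h `^ alpha) (a h) (c / _) => x y z; lra.
  apply: (@le_trans _ _ (h `^ alpha * (a (r^-1 * h) + b (r^-1 * h) + c / h ^+ 2))).
    rewrite mulrCA ler_pM2l//.
    move: ua u1; move: (a _) (a _) (b _) (c / _) => x y z ?; lra.
  by rewrite mulrDr lerD2l.
by rewrite mulrC divfK.
Qed.

End StableOneSidedTail.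

(** * Linear images of independent variables *)

(** Boxes are stable under intersection and generate the product sigma-algebra, so they determine a
    finite measure. *)
Lemma measure_tuple_unique (R : realType) n
    (m1 m2 : {measure set (n.-tuple R) -> \bar R}) :
  (m1 setT < +oo)%E ->
  (forall A : 'I_n -> set R, (forall i, measurable (A i)) ->
    m1 [set x | forall i, A i (tnth x i)] = m2 [set x | forall i, A i (tnth x i)]) ->
  forall A : set (n.-tuple R), measurable A -> m1 A = m2 A.
Proof.
move=> m1T m12.
pose G : set (set (n.-tuple R)) := [set B | exists2 A : 'I_n -> set R,
  (forall i, measurable (A i)) & B = [set x | forall i, A i (tnth x i)]].
have mG B : G B -> measurable B.
  move=> [A mA ->].
  have -> : [set x | forall i, A i (tnth x i)] =
      \big[setI/setT]_(i < n) ((fun x : n.-tuple R => tnth x i) @^-1` A i).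
    apply/seteqP; split => x /=.
      by move=> Ax; elim/big_ind : _ => //= B C; split.
    by move=> + i; rewrite (bigD1 i)//= => -[].
  apply: bigsetI_measurable => i _; rewrite -[X in measurable X]setTI.
  exact: (measurable_tnth i).
have GT : G setT by exists (fun=> setT) => //; apply/seteqP; split.
apply: (measure_unique G (fun=> setT)) => //.
- apply/seteqP; split; last first.
    apply: smallest_sub; first exact: sigma_algebra_measurable.
    by move=> B GB; exact: mG.
  apply: smallest_sub; first exact: smallest_sigma_algebra.
  move=> B; rewrite -bigcup_seq/= => -[i /= _ [A mA <-]].
  apply: sub_sigma_algebra; exists (fun j => if j == i then A else setT).
    by move=> j; case: ifP.
  apply/seteqP; split => x /=; first by move=> [_ Ax] j; case: eqP => // ->.
  by move=> /(_ i); rewrite eqxx.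
- move=> B C [A mA ->] [A' mA' ->]; exists (fun i => A i `&` A' i).
    by move=> i; exact: measurableI.
  apply/seteqP; split => x /=; first by move=> [h1 h2] i; split.
  by move=> h; split => i; case: (h i).
- by apply/seteqP; split => // x _; exists 0%N.
- by move=> B [A mA ->]; exact: m12.
Qed.

Section Product.
Context {R : realType} {d : measure_display} {T : measurableType d}.
Variable P : probability T R.

Lemma Rintegral_sum (I : Type) (s : seq I) (f : I -> T -> R) :
  (forall i, P.-integrable setT (EFin \o f i)) ->
  \int[P]_w (\sum_(i <- s) f i w) = \sum_(i <- s) \int[P]_w f i w.
Proof.
move=> fi; rewrite /Rintegral; under eq_integral do rewrite -sumEFin.
rewrite integral_sum//.
under eq_bigr => i _.
  rewrite (_ : (\int[P]_w _)%E = (\int[P]_w f i w)%:E); last first.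
    by rewrite /Rintegral fineK// (integrable_fin_num measurableT (fi i)).
  over.
by rewrite sumEFin.
Qed.

Lemma normr_Rintegral_le (f : T -> R) (M : R) : measurable_fun setT f ->
  (forall w, `|f w| <= M) -> `|\int[P]_w f w| <= M.
Proof.
move=> mf fM; have fi := integrable_ubound P mf fM.
apply: (le_trans (le_normr_Rintegral measurableT fi)).
apply: (@le_trans _ _ (\int[P]_w cst M w)).
  apply: (@le_Rintegral_ubound _ _ _ _ _ _ M) => //.
  - exact: measurableT_comp.
  - by move=> w; rewrite normr_id.
  - by move=> w; rewrite ger0_norm// (le_trans _ (fM w)).
by rewrite Rintegral_cst//= probability_setT/= mulr1.
Qed.

(* Uniform approximation of a bounded function by its level sets reduces the
   factorization to indicators. *)
Lemma expect_mul_indep (W : T -> R) (V : T -> R) (g : R -> R) :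
  measurable_fun setT W -> (forall w, `|W w| <= 1) -> measurable_fun setT V ->
  measurable_fun setT g -> (forall x, `|g x| <= 1) ->
  (forall A : set R, measurable A ->
    \int[P]_w (W w * \1_A (V w)) = \int[P]_w W w * \int[P]_w \1_A (V w)) ->
  \int[P]_w (W w * g (V w)) = \int[P]_w W w * \int[P]_w g (V w).
Proof.
move=> mW W1 mV mg g1 H.
(* The shift by 1 makes the argument of the truncation nonnegative, so [g] is within [1 / n] of the
   step function [gn n], and the levels from 0 to [2 n] exhaust its range. *)
pose A (n k : nat) : set R := [set x | Num.truncn (n%:R * (g x + 1)) == k].
have u0 (n : nat) x : 0 <= n%:R * (g x + 1).
  by rewrite mulr_ge0// -lerBlDr sub0r; have := g1 x; rewrite ler_norml => /andP[].
have mA n k : measurable (A n k).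
  rewrite /A -[X in measurable X]setTI.
  have mu : measurable_fun setT (fun x => n%:R * (g x + 1)).
    by apply: measurable_funM => //; exact: measurable_funD.
  have -> : [set x | Num.truncn (n%:R * (g x + 1)) == k] =
      (fun x => n%:R * (g x + 1)) @^-1` `[k%:R, k.+1%:R[%classic.
    by apply/seteqP; split => x /=; rewrite in_itv/= truncn_eq ?u0.
  by apply: mu => //; exact: measurable_itv.
pose gn (n : nat) x : R := \sum_(k < (2 * n).+1) (k%:R / n%:R - 1) * \1_(A n k) x.
have gnE (n : nat) x : (0 < n)%N -> gn n x = (Num.truncn (n%:R * (g x + 1)))%:R / n%:R - 1.
  move=> n0.
  have tn : (Num.truncn (n%:R * (g x + 1)) < (2 * n).+1)%N.
    have /andP[t1 _] := truncn_itv (u0 n x); rewrite -(ltr_nat R); apply: (le_lt_trans t1).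
    rewrite -natr1 natrM.
    have : g x <= 1 by have := g1 x; rewrite ler_norml => /andP[].
    have : 0 <= n%:R :> R by [].
    move: (n%:R) (g x) => a b; nra.
  rewrite /gn (bigD1 (Ordinal tn))//= big1 ?addr0.
    by rewrite indicE mem_set ?mulr1//= /A/=.
  move=> k kt; rewrite indicE memNset ?mulr0// /A/= => /eqP e.
  by move/eqP: kt; apply; apply/val_inj.
have gn_near (n : nat) x : (0 < n)%N -> `|g x - gn n x| <= n%:R^-1.
  move=> n0; rewrite gnE//.
  have /andP[t1 t2] := truncn_itv (u0 n x).
  have n0' : 0 < n%:R :> R by rewrite ltr0n.
  rewrite -(ler_pM2l n0') mulfV ?gt_eqF// -[X in X * _]gtr0_norm// -normrM.
  have -> : n%:R * (g x - ((Num.truncn (n%:R * (g x + 1)))%:R / n%:R - 1)) =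
     n%:R * (g x + 1) - (Num.truncn (n%:R * (g x + 1)))%:R by field; rewrite gt_eqF.
  rewrite ger0_norm ?subr_ge0//.
  by rewrite lerBlDl natr1 ltW.
have mgn n : measurable_fun setT (gn n).
  by apply: measurable_sum => k; apply: measurable_funM => //; exact: measurable_indic.
have iW : P.-integrable setT (EFin \o W) by exact: (integrable_ubound P mW W1).
have ind1 n k w : `|\1_(A n k) (V w) : R| <= 1.
  by rewrite indicE; case: (_ \in _); rewrite ?normr1 ?normr0.
have mind n k : measurable_fun setT (fun w => \1_(A n k) (V w) : R).
  by apply: measurableT_comp => //; apply: measurable_indic.
have iind n k : P.-integrable setT (EFin \o (fun w => \1_(A n k) (V w))).
  exact: (integrable_ubound P (mind n k) (ind1 n k)).
have iWind n k : P.-integrable setT (EFin \o (fun w => W w * \1_(A n k) (V w))).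
  apply: (@integrable_ubound _ _ _ _ _ 1); first exact: measurable_funM.
  by move=> w; rewrite normrM -[leRHS]mulr1 ler_pM.
have Hn (n : nat) : \int[P]_w (W w * gn n (V w)) = \int[P]_w W w * \int[P]_w gn n (V w).
  have -> : (fun w => W w * gn n (V w)) = (fun w => \sum_(k < (2 * n).+1)
      (k%:R / n%:R - 1) * (W w * \1_(A n k) (V w))).
    by apply/funext => w; rewrite /gn mulr_sumr; apply: eq_bigr => k _; rewrite mulrCA.
  rewrite Rintegral_sum; last first.
    by move=> k; exact: (integrableZl measurableT _ (iWind n k)).
  rewrite [X in _ = _ * X]Rintegral_sum; last first.
    by move=> k; exact: (integrableZl measurableT _ (iind n k)).
  rewrite mulr_sumr; apply: eq_bigr => k _.
  by rewrite RintegralZl// H// [in RHS]RintegralZl// mulrCA.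
have main (n : nat) : (0 < n)%N ->
   `|\int[P]_w (W w * g (V w)) - \int[P]_w W w * \int[P]_w g (V w)| <= 2 * n%:R^-1.
  move=> n0.
  have mgV : measurable_fun setT (fun w => g (V w)) by exact: measurableT_comp.
  have mgnV : measurable_fun setT (fun w => gn n (V w)) by exact: measurableT_comp.
  have igV : P.-integrable setT (EFin \o (fun w => g (V w))).
    by apply: (@integrable_ubound _ _ _ _ _ 1).
  have gn2 w : `|gn n (V w)| <= 2.
    rewrite -[gn n _](subrKC (g (V w))) (le_trans (ler_normD _ _))//.
    rewrite distrC.
    have := gn_near n (V w) n0; have := g1 (V w).
    have : n%:R^-1 <= 1 :> R by rewrite invf_le1 ?ltr0n// ler1n.
    lra.
  have ignV : P.-integrable setT (EFin \o (fun w => gn n (V w))).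
    by apply: (@integrable_ubound _ _ _ _ _ 2).
  have iWgV : P.-integrable setT (EFin \o (fun w => W w * g (V w))).
    apply: (@integrable_ubound _ _ _ _ _ 1); first exact: measurable_funM.
    by move=> w; rewrite normrM -[leRHS]mulr1 ler_pM.
  have iWgnV : P.-integrable setT (EFin \o (fun w => W w * gn n (V w))).
    apply: (@integrable_ubound _ _ _ _ _ 2); first exact: measurable_funM.
    by move=> w; rewrite normrM -[leRHS]mul1r ler_pM.
  have -> : \int[P]_w (W w * g (V w)) - \int[P]_w W w * \int[P]_w g (V w) =
     \int[P]_w (W w * (g (V w) - gn n (V w))) - \int[P]_w W w * \int[P]_w (g (V w) - gn n (V w)).
    under [X in _ = X - _]eq_Rintegral do rewrite mulrBr.
    rewrite RintegralB// [in RHS]RintegralB// Hn; ring.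
  have h1 : `|\int[P]_w (W w * (g (V w) - gn n (V w)))| <= n%:R^-1.
    apply: normr_Rintegral_le.
      by apply: measurable_funM => //; exact: measurable_funB.
    by move=> w; rewrite normrM -[leRHS]mul1r ler_pM ?gn_near.
  have h2 : `|\int[P]_w (g (V w) - gn n (V w))| <= n%:R^-1.
    apply: normr_Rintegral_le; first exact: measurable_funB.
    by move=> w; exact: gn_near.
  have h3 : `|\int[P]_w W w| <= 1 by exact: normr_Rintegral_le.
  rewrite (le_trans (ler_normB _ _))// mulr2n mulrDl mul1r lerD//.
  by rewrite normrM -[leRHS]mul1r ler_pM.
apply/eqP; rewrite -subr_eq0 -normr_le0; apply/ler_addgt0Pl => e e0.
rewrite addr0.
pose n := (Num.truncn (2 / e)).+1.
apply: le_trans (main n isT) _.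
rewrite ler_pdivrMr// mulrC -ler_pdivrMr// ltW//; exact: truncnS_gt.
Qed.

Section Family.
Variables (n : nat) (Z : 'I_n -> T -> R).
Hypothesis mZ : forall i, measurable_fun setT (Z i).
Hypothesis indepZ : forall A : 'I_n -> set R, (forall i, measurable (A i)) ->
  P [set w | forall i, A i (Z i w)] = (\prod_(i < n) P (Z i @^-1` A i))%E.

Let bdd (g : R -> R) := measurable_fun setT g /\ (forall x, `|g x| <= 1).

Let bdd_indic (A : set R) : measurable A -> bdd (\1_A).
Proof.
move=> mA; split; first exact: measurable_indic.
by move=> x; rewrite indicE; case: (_ \in _); rewrite ?normr1 ?normr0.
Qed.

Let mprod (Q : pred 'I_n) (g : 'I_n -> R -> R) : (forall i, bdd (g i)) ->
  measurable_fun setT (fun w => \prod_(i | Q i) g i (Z i w)).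
Proof.
move=> gb; rewrite (_ : (fun _ => _) = (fun w => \prod_i (if Q i then g i (Z i w) else 1))).
  apply: measurable_prod => i _; case: (Q i) => //.
  exact: (measurableT_comp (gb i).1 (mZ i)).
by apply/funext => w; rewrite big_mkcond.
Qed.

Let prod1 (Q : pred 'I_n) (g : 'I_n -> R -> R) w : (forall i, bdd (g i)) ->
  `|\prod_(i | Q i) g i (Z i w)| <= 1.
Proof.
move=> gb; rewrite normr_prod; apply: prodr_ile1 => i _.
by rewrite normr_ge0 (gb i).2.
Qed.

Let fine_prod (F : 'I_n -> \bar R) : (forall i, F i \is a fin_num) ->
  (\prod_(i < n) F i)%E = (\prod_(i < n) fine (F i))%:E.
Proof.
move=> Ff; rewrite -prodEFin; apply: eq_bigr => i _; by rewrite fineK.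
Qed.

(** Induction on the number [m] of factors allowed to be arbitrary, the others being indicators. The
    case [m = 0] is the definition of independence; each step frees one factor by
    [expect_mul_indep]. *)
Lemma expect_prod (g : 'I_n -> R -> R) :
  (forall i, measurable_fun setT (g i)) -> (forall i x, `|g i x| <= 1) ->
  \int[P]_w (\prod_(i < n) g i (Z i w)) = \prod_(i < n) \int[P]_w g i (Z i w).
Proof.
move=> mg g1; have gb i : bdd (g i) by split.
move: g gb {mg g1}.
suff H m g : (forall i, bdd (g i)) ->
    (forall i : 'I_n, (m <= i)%N -> exists2 A : set R, measurable A & g i = \1_A) ->
    \int[P]_w (\prod_(i < n) g i (Z i w)) = \prod_(i < n) \int[P]_w g i (Z i w).
  move=> g gb; apply: (H n) => // i ni; have := ltn_ord i.
  by rewrite ltnNge ni.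
elim: m g => [g gb gA|m IH g gb gA].
  have [A hA] := choice (fun i => (let: ex_intro2 A mA e := gA i isT in
    ex_intro (fun A => measurable A /\ g i = \1_A) A (conj mA e))).
  have -> : (fun w => \prod_(i < n) g i (Z i w)) = \1_[set w | forall i, A i (Z i w)].
    apply/funext => w; rewrite indicE.
    have [/set_mem/= hw|/negP hw] := boolP (_ \in _).
      by apply: big1 => i _; rewrite (hA i).2 indicE mem_set.
    have [i hi] : exists i, ~ A i (Z i w).
      by apply/existsNP => h; apply: hw; rewrite inE.
    by rewrite (bigD1 i)//= (hA i).2 indicE memNset// mul0r.
  have mpre i : measurable (Z i @^-1` A i).
    by rewrite -[X in measurable X]setTI; apply: mZ => //; exact: (hA i).1.
  have mI : measurable [set w | forall i, A i (Z i w)].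
    have -> : [set w | forall i, A i (Z i w)] = \big[setI/setT]_(i < n) (Z i @^-1` A i).
      apply/seteqP; split => x /=.
        by move=> Ax; elim/big_ind : _ => //= B C; split.
      by move=> + i; rewrite (bigD1 i)//= => -[].
    by apply: bigsetI_measurable.
  rewrite Rintegral_indicator// indepZ; last by move=> i; exact: (hA i).1.
  rewrite fine_prod/=; last by move=> i; rewrite fin_num_measure.
  apply: eq_bigr => i _; rewrite (hA i).2 -Rintegral_indicator//.
have [nm|mn] := leqP n m.
  apply: IH => // i mi; have := ltn_ord i.
  by rewrite ltnNge (leq_trans nm mi).
pose i0 := Ordinal mn.
pose Q h i := if i == i0 then h else g i.
have Qb h : bdd h -> forall i, bdd (Q h i) by move=> hb i; rewrite /Q; case: eqP.
have IHQ (A : set R) : measurable A ->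
   \int[P]_w (\prod_(i < n | i != i0) g i (Z i w) * \1_A (Z i0 w)) =
   \prod_(i < n | i != i0) \int[P]_w g i (Z i w) * \int[P]_w \1_A (Z i0 w).
  move=> mA.
  have := IH (Q (\1_A)) (Qb _ (bdd_indic mA)).
  have hQ (i : 'I_n) : (m <= i)%N -> exists2 B : set R, measurable B & Q (\1_A) i = \1_B.
    move=> mi; rewrite /Q; case: eqP => [_|ne]; first by exists A.
    apply: gA; rewrite ltn_neqAle mi andbT; apply/eqP => e.
    by apply: ne; apply/val_inj.
  move=> /(_ hQ).
  under eq_Rintegral => w _.
    rewrite (bigD1 i0)//= {1}/Q eqxx mulrC.
    rewrite (eq_bigr (fun i => g i (Z i w))); last by move=> i /negPf ni; rewrite /Q ni.
    over.
  move=> ->; rewrite (bigD1 i0)//= {1}/Q eqxx mulrC; congr (_ * _).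
  by apply: eq_bigr => i /negPf ni; rewrite /Q ni.
have EW : \int[P]_w (\prod_(i < n | i != i0) g i (Z i w)) =
   \prod_(i < n | i != i0) \int[P]_w g i (Z i w).
  have := IHQ setT measurableT; rewrite indicT.
  under eq_Rintegral do rewrite mulr1.
  by move=> ->; rewrite Rintegral_cst//= probability_setT/= !mulr1.
rewrite [RHS](bigD1 i0)//= mulrC -EW.
under eq_Rintegral do rewrite (bigD1 i0)//= mulrC.
apply: expect_mul_indep => //.
- exact: mprod.
- by move=> w; exact: prod1.
- exact: (gb i0).1.
- exact: (gb i0).2.
- by move=> A mA; rewrite IHQ// EW.
Qed.

Hypothesis sinZ : forall i theta, \int[P]_w sin (theta * Z i w) = 0.

(** The addition formulas split off one variable at a time; every term with a factor
    [sin (c i * Z i)] has expectation 0, so only the product of cosines survives. *)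
Lemma expect_cis_sum (c : 'I_n -> R) :
  \int[P]_w cos (\sum_(i < n) c i * Z i w) =
    \prod_(i < n) \int[P]_w cos (c i * Z i w) /\
  \int[P]_w sin (\sum_(i < n) c i * Z i w) = 0.
Proof.
have mcZ (i : 'I_n) : measurable_fun setT (fun w => c i * Z i w) by exact: measurable_funM.
have bcos i : bdd (fun x => cos (c i * x)).
  split; last by move=> x; exact: cos_max.
  apply: measurableT_comp; first exact: measurable_cos.
  exact: measurable_funM.
have bsin i : bdd (fun x => sin (c i * x)).
  split; last by move=> x; exact: sin_max.
  apply: measurableT_comp; first exact: measurable_sin.
  exact: measurable_funM.
pose U m w := \sum_(i < n | (i < m)%N) c i * Z i w.
have mU m : measurable_fun setT (U m).
  rewrite (_ : U m = (fun w => \sum_(i < n) (if (i < m)%N then c i * Z i w else 0))).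
    by apply: measurable_sum => i; case: (_ < _)%N.
  by apply/funext => w; rewrite /U big_mkcond.
have mcU m : measurable_fun setT (fun w => cos (U m w)).
  by apply: measurableT_comp => //; exact: measurable_cos.
have msU m : measurable_fun setT (fun w => sin (U m w)).
  by apply: measurableT_comp => //; exact: measurable_sin.
have int2 (f : T -> R) (Q : pred 'I_n) (g : 'I_n -> R -> R) :
    measurable_fun setT f -> (forall w, `|f w| <= 1) -> (forall i, bdd (g i)) ->
    P.-integrable setT (EFin \o (fun w => f w * \prod_(i | Q i) g i (Z i w))).
  move=> mf f1 gb; apply: (@integrable_ubound _ _ _ _ _ 1).
    by apply: measurable_funM => //; exact: mprod.
  by move=> w; rewrite normrM -[leRHS]mulr1 ler_pM// prod1.
(* The factors of index at least [m] are kept arbitrary so that the induction hypothesis can be used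
   twice, with the cosine and with the sine of [c i * Z i] at index [m]. *)
suff H m (g : 'I_n -> R -> R) : (forall i, bdd (g i)) -> (m <= n)%N ->
   \int[P]_w (cos (U m w) * \prod_(i < n | (m <= i)%N) g i (Z i w)) =
   \prod_(i < n | (i < m)%N) \int[P]_w cos (c i * Z i w) *
     \prod_(i < n | (m <= i)%N) \int[P]_w g i (Z i w) /\
   \int[P]_w (sin (U m w) * \prod_(i < n | (m <= i)%N) g i (Z i w)) = 0.
  have [] := H n _ bcos (leqnn n).
  have p0 (F : 'I_n -> R) : \prod_(i < n | (n <= i)%N) F i = 1.
    by apply: big_pred0 => i; rewrite leqNgt ltn_ord.
  have pn (F : 'I_n -> R) : \prod_(i < n | (i < n)%N) F i = \prod_(i < n) F i.
    by apply: eq_bigl => i; rewrite ltn_ord.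
  have Un w : U n w = \sum_(i < n) c i * Z i w.
    by apply: eq_bigl => i; rewrite ltn_ord.
  under eq_Rintegral do rewrite p0 mulr1 Un.
  under [X in _ -> X = 0 -> _]eq_Rintegral do rewrite p0 mulr1 Un.
  by rewrite p0 mulr1 pn.
elim: m g => [g gb _|m IH g gb mn].
  have U0 w : U 0%N w = 0 by apply: big_pred0.
  under eq_Rintegral do rewrite U0 cos0 mul1r.
  under [X in _ /\ X = 0]eq_Rintegral do rewrite U0 sin0 mul0r.
  rewrite Rintegral_cst// mul0r big_pred0// mul1r; split => //.
  by apply: expect_prod => i; [exact: (gb i).1|exact: (gb i).2].
pose i0 := Ordinal mn.
pose Q h i := if i == i0 then h i else g i.
have Qb h : (forall i, bdd (h i)) -> forall i, bdd (Q h i) by move=> hb i; rewrite /Q; case: eqP.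
have split1 (F : 'I_n -> R) : \prod_(i < n | (m <= i)%N) F i =
    F i0 * \prod_(i < n | (m < i)%N) F i.
  rewrite (bigD1 i0)//=; congr (_ * _); apply: eq_bigl => i.
  by rewrite [RHS]ltn_neqAle andbC eq_sym.
have split2 (F : 'I_n -> R) : \prod_(i < n | (i < m.+1)%N) F i =
    F i0 * \prod_(i < n | (i < m)%N) F i.
  rewrite (bigD1 i0)//=; congr (_ * _); apply: eq_bigl => i.
  by rewrite ltnS [RHS]ltn_neqAle andbC.
have US w : U m.+1 w = U m w + c i0 * Z i0 w.
  rewrite /U (bigD1 i0)//= addrC; congr (_ + _); apply: eq_bigl => i.
  by rewrite ltnS [RHS]ltn_neqAle andbC.
have Qi0 h x : Q h i0 x = h i0 x by rewrite /Q eqxx.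
have Qgt h (F : (R -> R) -> 'I_n -> R) :
    \prod_(i < n | (m < i)%N) F (Q h i) i = \prod_(i < n | (m < i)%N) F (g i) i.
  apply: eq_bigr => i mi; rewrite /Q; case: eqP => // e.
  by move: mi; rewrite e ltnn.
have [] := IH _ (Qb _ bcos) (ltnW mn).
rewrite split1 (Qgt _ (fun h i => \int[P]_w h (Z i w))).
under eq_Rintegral => w _ do rewrite split1 (Qgt _ (fun h i => h (Z i w))) Qi0 mulrA.
under [X in _ -> X = 0 -> _]eq_Rintegral => w _
  do rewrite split1 (Qgt _ (fun h i => h (Z i w))) Qi0 mulrA.
under [X in _ = _ * (X * _) -> _]eq_Rintegral => w _ do rewrite Qi0.
move=> cc sc.
have [] := IH _ (Qb _ bsin) (ltnW mn).
rewrite split1 (Qgt _ (fun h i => \int[P]_w h (Z i w))).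
under eq_Rintegral => w _ do rewrite split1 (Qgt _ (fun h i => h (Z i w))) Qi0 mulrA.
under [X in _ -> X = 0 -> _]eq_Rintegral => w _
  do rewrite split1 (Qgt _ (fun h i => h (Z i w))) Qi0 mulrA.
under [X in _ = _ * (X * _) -> _]eq_Rintegral => w _ do rewrite Qi0.
rewrite sinZ mul0r mulr0 => cs ss.
have mul1 (x y : R) : `|x| <= 1 -> `|y| <= 1 -> `|x * y| <= 1.
  by move=> x1 y1; rewrite normrM -[leRHS]mulr1 ler_pM.
have mc0 : measurable_fun setT (fun w => cos (c i0 * Z i0 w)).
  exact: (measurableT_comp (bcos i0).1 (mZ i0)).
have ms0 : measurable_fun setT (fun w => sin (c i0 * Z i0 w)).
  exact: (measurableT_comp (bsin i0).1 (mZ i0)).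
have iT (f f0 : T -> R) : measurable_fun setT f -> measurable_fun setT f0 ->
    (forall w, `|f w| <= 1) -> (forall w, `|f0 w| <= 1) ->
    P.-integrable setT (EFin \o (fun w => f w * f0 w * \prod_(i < n | (m < i)%N) g i (Z i w))).
  move=> mf mf0 f1 f01; apply: int2 => //; first exact: measurable_funM.
  by move=> w; exact: mul1.
split.
  under eq_Rintegral => w _ do rewrite US cosD mulrBl.
  rewrite RintegralB//; [|by apply: iT => // w; rewrite ?cos_max ?sin_max..].
  by rewrite cc ss subr0 split2 mulrCA !mulrA.
under eq_Rintegral => w _ do rewrite US sinD mulrDl.
rewrite RintegralD//; [|by apply: iT => // w; rewrite ?cos_max ?sin_max..].
by rewrite sc cs addr0.
Qed.

End Family.

End Product.

(** * Linear images of i.i.d. stable variables: spectral measure and exchangeability *)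

Section LinearModel.
Context {R : realType} {d : measure_display} {T : measurableType d}.
Variables (P : probability T R) (alpha : R) (m n : nat).
Hypothesis alpha0 : 0 < alpha.
Variables (A : 'I_m -> 'I_n.+1 -> R) (S : 'I_n.+1 -> {RV P >-> R}).
Hypothesis indepS : independent S.
Hypothesis idS : identically_distributed S.
Hypothesis stS : standard_stable P alpha (S ord0).

Definition linear_image (w : T) : m.-tuple R :=
  [tuple \sum_(k < n.+1) A i k * S k w | i < m].
Local Notation X := linear_image.

Lemma iid_stable_cos_sin i theta :
  \int[P]_w cos (theta * S i w) = expR (- (`|theta| `^ alpha)) /\
  \int[P]_w sin (theta * S i w) = 0.
Proof.
have same (f : R -> R) : measurable_fun setT f -> (forall x, `|f x| <= 1) ->
    \int[P]_w f (S i w) = \int[P]_w f (S ord0 w).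
  move=> mf f1.
  have ij j : (\int[P]_w (f (S j w))%:E = \int[distribution P (S j)]_x (f x)%:E)%E.
    rewrite integral_distribution//; first exact/measurable_EFinP.
    apply: (@integrable_ubound _ _ _ P (f \o S j) 1); first exact: measurableT_comp.
    by move=> w; exact: f1.
  rewrite /Rintegral !ij; congr fine; apply: eq_measure_integral => B mB _.
  exact: idS.
have := stS theta; rewrite /charfun /expect_cis => -[c s].
split.
  rewrite (same (fun x => cos (theta * x)))//; last by move=> x; exact: cos_max.
  apply: measurableT_comp; first exact: measurable_cos.
  exact: measurable_funM.
rewrite (same (fun x => sin (theta * x)))//; last by move=> x; exact: sin_max.
apply: measurableT_comp; first exact: measurable_sin.
exact: measurable_funM.
Qed.

Lemma measurable_linear_image : measurable_fun setT X.
Proof.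
apply/measurable_fun_tnthP => i.
rewrite (_ : _ \o _ = (fun w => \sum_(k < n.+1) A i k * S k w)).
  by apply: measurable_sum => k; exact: measurable_funM.
by apply/funext => w; rewrite /= tnth_mktuple.
Qed.

Let col k : m.-tuple R := [tuple A i k | i < m].
Let rho k := Num.sqrt (dot (col k) (col k)).

Let dot_col theta w : dot theta (X w) = \sum_(k < n.+1) dot theta (col k) * S k w.
Proof.
rewrite /dot; under eq_bigr do rewrite tnth_mktuple mulr_sumr.
rewrite exchange_big/=; apply: eq_bigr => k _; rewrite mulr_suml.
by apply: eq_bigr => i _; rewrite tnth_mktuple mulrA.
Qed.

Lemma charfun_linear_image theta :
  charfun_vec P X theta =
  ((expR (- \sum_(k < n.+1) `|\sum_(i < m) tnth theta i * A i k| `^ alpha))%:C)%C.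
Proof.
have mS i : measurable_fun setT (S i) by [].
have sinS i t : \int[P]_w sin (t * S i w) = 0 by case: (iid_stable_cos_sin i t).
have [hc hs] := expect_cis_sum mS indepS sinS (fun k => dot theta (col k)).
rewrite /charfun_vec /expect_cis.
under eq_Rintegral do rewrite dot_col.
under [X in (_ +i* X)%C]eq_Rintegral do rewrite dot_col.
rewrite hc hs; congr (_ +i* _)%C.
under eq_bigr => k _ do rewrite (iid_stable_cos_sin k _).1.
have dotE k : dot theta (col k) = \sum_(i < m) tnth theta i * A i k.
  by apply: eq_bigr => i _; rewrite tnth_mktuple.
rewrite -sumrN expR_sum; apply: eq_bigr => k _; rewrite dotE.
reflexivity.
Qed.

Let measurable_dot (theta : m.-tuple R) : measurable_fun setT (fun x : m.-tuple R => dot theta x).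
Proof.
apply: measurable_sum => i; apply: measurable_funM => //.
exact: measurable_tnth.
Qed.

Let measurable_sphere : measurable (sphere R m).
Proof.
have mf : measurable_fun setT (fun x : m.-tuple R => dot x x).
  apply: measurable_sum => i; apply: measurable_funM; exact: measurable_tnth.
rewrite (_ : sphere R m = setT `&` (fun x : m.-tuple R => dot x x) @^-1` [set 1]).
  by apply: mf => //; exact: measurable_set1.
by rewrite setTI; apply/seteqP; split.
Qed.

Let dotN (x y : m.-tuple R) : dot x (oppt y) = - dot x y.
Proof.
by rewrite /dot -sumrN; apply: eq_bigr => i _; rewrite tnth_mktuple mulrN.
Qed.

Let dotNN (x : m.-tuple R) : dot (oppt x) (oppt x) = dot x x.
Proof.
by rewrite /dot; apply: eq_bigr => i _; rewrite !tnth_mktuple mulrNN.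
Qed.

Let opptK (x : m.-tuple R) : oppt (oppt x) = x.
Proof. by apply: eq_from_tnth => i; rewrite !tnth_mktuple opprK. Qed.

(** The spectral measure puts mass [rho k ^ alpha / 2] at plus and minus the normalized [k]-th
    column. For a zero column the inverse of [rho k] is 0 by convention and [unit k] is the zero
    vector, off the sphere, but its mass vanishes. *)
Let unit k : m.-tuple R := [tuple (rho k)^-1 * A i k | i < m].
Let wt k := rho k `^ alpha / 2.
Let wt_ge0 k : 0 <= wt k. Proof. by rewrite divr_ge0 ?powR_ge0. Qed.

Let atoms (j : nat) : {measure set (m.-tuple R) -> \bar R} :=
  let k : 'I_n.+1 := inord j in
  mscale (NngNum (wt_ge0 k)) (measure_add (dirac (unit k)) (dirac (oppt (unit k)))).

Let Lam : {measure set (m.-tuple R) -> \bar R} := msum atoms n.+1.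

Let LamE B : Lam B = (\sum_(k < n.+1) wt k * ((unit k \in B)%:R + (oppt (unit k) \in B)%:R))%:E.
Proof.
transitivity (\sum_(k < n.+1) atoms k B)%E; first by [].
rewrite -sumEFin; apply: eq_bigr => k _.
transitivity ((wt (inord k))%:E *
    measure_add (dirac (unit (inord k))) (dirac (oppt (unit (inord k)))) B)%E; first by [].
by rewrite inord_val measure_addE /= !diracE.
Qed.

Let Lam_fin : fin_num_fun Lam.
Proof. by move=> B mB; rewrite LamE. Qed.

Let LamF : {finite_measure set (m.-tuple R) -> \bar R} :=
  HB.pack_for (FiniteMeasure.type (m.-tuple R) R) (Measure.sort Lam)
    (@Measure_isFinite.Build _ _ _ (Measure.sort Lam) Lam_fin).

Let rho_sqr k : rho k ^+ 2 = dot (col k) (col k).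
Proof.
by rewrite sqr_sqrtr// /dot sumr_ge0// => i _; rewrite -expr2 sqr_ge0.
Qed.

Let rho_eq0 k : rho k = 0 -> forall i, A i k = 0.
Proof.
move=> r0 i; have := rho_sqr k; rewrite r0 expr0n /dot => /esym/eqP.
rewrite psumr_eq0 => [/allP/(_ i)|j _]; last by rewrite -expr2 sqr_ge0.
by rewrite mem_index_enum tnth_mktuple -expr2 sqrf_eq0 => /(_ isT)/eqP.
Qed.

Let dot_unit theta k : dot theta (unit k) = (rho k)^-1 * dot theta (col k).
Proof.
rewrite /dot mulr_sumr; apply: eq_bigr => i _.
by rewrite !tnth_mktuple mulrCA.
Qed.

Let unit_sphere k : rho k != 0 -> (unit k \in sphere R m) /\ (oppt (unit k) \in sphere R m).
Proof.
move=> r0; have e : dot (unit k) (unit k) = 1.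
  rewrite dot_unit (_ : dot (unit k) (col k) = dot (col k) (unit k)); last first.
    by apply: eq_bigr => i _; rewrite mulrC.
  by rewrite dot_unit -rho_sqr expr2 !mulKf// mulVf.
by split; rewrite inE /sphere/= ?dotNN.
Qed.

Let wt0 k : rho k = 0 -> wt k = 0.
Proof. by move=> r0; rewrite /wt r0 powR0 ?mul0r// gt_eqF. Qed.

Let Lam_integral theta :
  \int[Lam]_(x in sphere R m) (`|dot theta x| `^ alpha) =
  \sum_(k < n.+1) `|\sum_(i < m) tnth theta i * A i k| `^ alpha.
Proof.
pose f (x : m.-tuple R) := (`|dot theta x| `^ alpha)%:E.
have mf : measurable_fun (sphere R m) f.
  apply: measurable_funTS; apply/measurable_EFinP.
  apply: (@measurableT_comp _ _ _ _ _ _ (fun x => x `^ alpha) _ (fun x => `|dot theta x|)).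
    exact: measurable_powR.
  exact: measurableT_comp.
have f0 x : sphere R m x -> (0 <= f x)%E by move=> _; rewrite lee_fin powR_ge0.
suff -> : \int[Lam]_(x in sphere R m) (`|dot theta x| `^ alpha) =
    fine (\sum_(k < n.+1) (`|\sum_(i < m) tnth theta i * A i k| `^ alpha)%:E)%E.
  by rewrite sumEFin.
rewrite /Rintegral ge0_integral_measure_sum//; congr fine; apply: eq_bigr => k _.
rewrite /atoms inord_val ge0_integral_mscale// ge0_integral_measure_add//.
rewrite !integral_dirac// !diracE.
have e : `|\sum_(i < m) tnth theta i * A i k| = `|dot theta (col k)|.
  by congr `|_|; apply: eq_bigr => i _; rewrite tnth_mktuple.
rewrite e /=.
have [r0|r0] := eqVneq (rho k) 0.
  rewrite wt0// mul0e; congr EFin.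
  rewrite (_ : dot theta (col k) = 0) ?normr0 ?powR0 ?gt_eqF//.
  by apply: big1 => i _; rewrite tnth_mktuple (rho_eq0 r0) mulr0.
have [-> ->] := unit_sphere r0.
rewrite !mul1e dotN normrN -EFinD -EFinM; congr EFin.
have rk0 : 0 <= rho k by exact: sqrtr_ge0.
have rV0 : 0 <= (rho k)^-1 by rewrite invr_ge0.
rewrite dot_unit normrM (ger0_norm rV0) powRM// powRV// /wt.
by field; rewrite powR_eq0 (negbTE r0).
Qed.

Lemma symmetric_stable_linear_image : symmetric_stable P alpha X.
Proof.
split; first exact: measurable_linear_image.
exists LamF; split.
- rewrite [LHS]LamE big1// => k _.
  have [r0|r0] := eqVneq (rho k) 0; first by rewrite wt0// mul0r.
  have [/set_mem u1 /set_mem u2] := unit_sphere r0.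
  by rewrite !memNset ?addr0 ?mulr0//=; apply.
- move=> B mB; rewrite [LHS]LamE [RHS]LamE; congr EFin; apply: eq_bigr => k _.
  have e x : (x \in oppt @^-1` B) = (oppt x \in B).
    by apply/idP/idP => /set_mem h; apply/mem_set.
  by rewrite !e opptK addrC.
- by move=> theta; rewrite charfun_linear_image -Lam_integral.
Qed.

(** A permutation of the rows is undone by a permutation of the columns, that is, of the variables
    [S k], and the joint law of i.i.d. variables is invariant under the latter because it is so on
    boxes. *)
Lemma exchangeable_linear_image :
  (forall s : 'S_m, exists sg : 'S_n.+1, forall i k, A (s i) (sg k) = A i k) ->
  exchangeable P X.
Proof.
move=> HA s B mB; have [sg hsg] := HA s.
pose V (t : 'S_n.+1) (w : T) : n.+1.-tuple R := [tuple S (t k) w | k < n.+1].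
have mV t : measurable_fun setT (V t).
  apply/measurable_fun_tnthP => i.
  rewrite (_ : _ \o _ = S (t i))//.
  by apply/funext => w; rewrite /= tnth_mktuple.
pose L (x : n.+1.-tuple R) : m.-tuple R := [tuple \sum_(k < n.+1) A i k * tnth x k | i < m].
have mL : measurable_fun setT L.
  apply/measurable_fun_tnthP => i.
  rewrite (_ : _ \o _ = (fun x => \sum_(k < n.+1) A i k * tnth x k)).
    by apply: measurable_sum => k; apply: measurable_funM => //; exact: measurable_tnth.
  by apply/funext => x; rewrite /= tnth_mktuple.
have eX : X = L \o V 1%g.
  apply/funext => w; apply: eq_from_tnth => i; rewrite !tnth_mktuple.
  by apply: eq_bigr => k _; rewrite tnth_mktuple perm1.
have esX : (fun w => permt s (X w)) = L \o V sg.
  apply/funext => w; apply: eq_from_tnth => i; rewrite !tnth_mktuple.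
  rewrite (reindex_inj (@perm_inj _ sg)); apply: eq_bigr => k _.
  by rewrite hsg tnth_mktuple.
rewrite esX eX !comp_preimage.
have mLB : measurable (L @^-1` B) by rewrite -[X in measurable X]setTI; exact: mL.
pose W (t : 'S_n.+1) : {mfun T >-> n.+1.-tuple R} :=
  HB.pack (V t) (isMeasurableFun.Build _ _ _ _ (V t) (mV t)).
have rect t (C : 'I_n.+1 -> set R) : (forall i, measurable (C i)) ->
    P (V t @^-1` [set x | forall i, C i (tnth x i)]) =
    (\prod_(i < n.+1) P (S ord0 @^-1` C i))%E.
  move=> mC.
  have -> : V t @^-1` [set x | forall i, C i (tnth x i)] =
      [set w | forall j, C (t^-1%g j) (S j w)].
    apply/seteqP; split => w /= h j.
      by have := h (t^-1%g j); rewrite tnth_mktuple permKV.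
    by have := h (t j); rewrite tnth_mktuple permK.
  rewrite (@indepS (fun j => C (t^-1%g j)) (fun j => mC _)) (reindex_inj (@perm_inj _ t)); apply: eq_bigr => k _.
  by rewrite permK; exact: idS.
apply: (@measure_tuple_unique _ _ (distribution P (W sg)) (distribution P (W 1%g))) => //.
  by rewrite /= /distribution /pushforward preimage_setT probability_setT ltry.
by move=> C mC; rewrite [LHS]rect// [RHS]rect.
Qed.

End LinearModel.

(** * Color processes and their moments *)

Section ColorMoments.
Context {R : realType} (I : finType).
Implicit Types (p : R) (q : {set {set I}} -> R) (A : {set I}).

(** Inclusion-exclusion as an induction on the number of zeros of [y]: with [A] the set of ones of
    [y], the other terms of the sum sit at configurations with strictly fewer zeros. *)
Lemma ffun_law_unique (mu nu : {ffun I -> bool} -> R) :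
  (forall A, \sum_(y : {ffun I -> bool} | [forall i in A, y i]) mu y =
             \sum_(y : {ffun I -> bool} | [forall i in A, y i]) nu y) ->
  mu =1 nu.
Proof.
move=> H y.
have [k] := ubnP #|[set i | ~~ y i]%SET|; elim: k y => // k IH y yk.
pose A := [set i | y i]%SET.
have := H A.
have Ay : [forall i in A, y i] by apply/forall_inP => i; rewrite inE.
rewrite (bigD1 y)//= [in RHS](bigD1 y)//=.
rewrite (eq_bigr nu); first by move/addIr.
move=> z /andP[/forall_inP Az zy]; apply: IH.
rewrite ltnS in yk; apply: leq_trans yk; apply: proper_card.
rewrite properE; apply/andP; split.
  apply/fintype.subsetP => i; rewrite !inE; apply: contra => yi.
  by apply: Az; rewrite inE.
apply/negP => /fintype.subsetP h; move/eqP: zy; apply; apply/ffunP => i.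
apply/idP/idP => [zi|yi]; last by apply: Az; rewrite inE.
by apply/negPn/negP => nyi; have := h i; rewrite !inE nyi zi => /(_ isT).
Qed.

(* Given the partition, all of A is colored 1 iff the blocks meeting A are. *)
Lemma color_moment p q A : partition_pmf q ->
  \sum_(y : {ffun I -> bool} | [forall i in A, y i]) color_law p q y =
  \sum_(pi : {set {set I}}) q pi * p ^+ #|[set finset.pblock pi i | i in A]%SET|.
Proof.
move=> [_ qpart _]; rewrite /color_law exchange_big/=; apply: eq_bigr => pi _.
rewrite -mulr_sumr.
have [->|q0] := eqVneq (q pi) 0; first by rewrite !mul0r.
congr (_ * _).
have partpi := qpart _ q0.
have /and3P[/eqP covpi tipi _] := partpi.
have pbl i : finset.pblock pi i \in pi.
  by apply: finset.pblock_mem; rewrite covpi finset.in_setT.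
pose w (b : bool) : R := if b then p else 1 - p.
pose blocks := [set finset.pblock pi i | i in A]%SET.
(* The constraint factorizes over blocks: [F B b] is the weight of color [b], set to 0 when [B]
   meets [A] and [b] is false. The sum over colorings then becomes a product of two-term sums. *)
pose F (B : {set I}) b := w b * ((B \in blocks) ==> b)%:R.
rewrite (exchange_big_dep (fun c : {ffun {set I} -> bool} =>
  c \in pffun_on false (mem pi) predT))/=; last by move=> y c _ /andP[].
transitivity (\sum_(c in pffun_on false (mem pi) (predT : pred bool)) \prod_(B in pi) F B (c B)).
  apply: eq_bigr => c cpi.
  pose yc := [ffun i => c (finset.pblock pi i)].
  have [cA|ncA] := boolP [forall i in A, yc i].
    rewrite (big_pred1 yc); last first.
      move=> y; rewrite cpi /=; apply/andP/eqP => [[_ /forallP h]|->].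
        by apply/ffunP => i; rewrite ffunE; apply/esym/eqP.
      by split => //; apply/forallP => i; rewrite ffunE.
    apply: eq_bigr => B Bpi; rewrite /F.
    have [/imsetP[i iA e]|_] := boolP (B \in blocks); last by rewrite mulr1.
    by move/forall_inP: cA => /(_ i iA); rewrite ffunE -e => ->; rewrite mulr1.
  rewrite big_pred0; last first.
    move=> y; apply/negbTE; apply/negP => /andP[/forall_inP Ay /andP[_ /forallP h]].
    move/negP: ncA; apply; apply/forall_inP => i iA.
    by rewrite ffunE (eqP (h i)); exact: Ay.
  have [i iA ci] : exists2 i, i \in A & ~~ c (finset.pblock pi i).
    by move: ncA; rewrite negb_forall_in => /exists_inP[i iA]; rewrite ffunE; exists i.
  rewrite (bigD1 (finset.pblock pi i))//= /F (negbTE ci).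
  by rewrite (imset_f (finset.pblock pi) iA) mulr0 mul0r.
rewrite -(big_distr_big false (mem pi) predT F).
rewrite (eq_bigr (fun B => if B \in blocks then p else 1)); last first.
  move=> B _; rewrite big_bool /F /w; case: (_ \in _); rewrite /= ?mulr1 ?mulr0 ?addr0//.
  by rewrite addrC subrK.
rewrite -big_mkcondr/=.
rewrite (eq_bigl (mem blocks)); first by rewrite prodr_const.
move=> B /=; rewrite andb_idl// => /imsetP[i _ ->]; exact: pbl.
Qed.

End ColorMoments.

Section ColorProcessMoments.
Context {R : realType} {d : measure_display} {T : measurableType d}.
Variables (P : probability T R) (I : finType) (Y : I -> T -> bool).
Hypothesis mY : forall i, measurable [set w | Y i w].

Let mE (y : {ffun I -> bool}) : measurable [set w | forall i, Y i w = y i].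
Proof.
have -> : [set w | forall i, Y i w = y i] =
    \big[setI/setT]_(i : I) (if y i then [set w | Y i w] else ~` [set w | Y i w]).
  apply/seteqP; split => w /=.
    move=> h; elim/big_ind : _ => [//|B C|i _]; first by split.
    by case: ifP => yi /=; rewrite h yi.
  move=> + i; rewrite (bigD1 i)//= => -[+ _].
  by case: ifP => yi //= /negP/negbTE.
apply: bigsetI_measurable => i _; case: ifP => // _; exact: measurableC.
Qed.

Lemma prob_all_true (A : {set I}) :
  fine (P [set w | forall i, i \in A -> Y i w]) =
  \sum_(y : {ffun I -> bool} | [forall i in A, y i])
     fine (P [set w | forall i, Y i w = y i]).
Proof.
have mA : measurable [set w | forall i, i \in A -> Y i w].
  have -> : [set w | forall i, i \in A -> Y i w] =
      \big[setI/setT]_(i in A) [set w | Y i w].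
    apply/seteqP; split => w /=.
      by move=> h; elim/big_ind : _ => //= B C; split.
    by move=> + i iA; rewrite (bigD1 i)//= => -[].
  exact: bigsetI_measurable.
rewrite -Rintegral_indicator//.
under eq_bigr do rewrite -Rintegral_indicator//.
rewrite -big_filter -Rintegral_sum; last first.
  move=> y; apply: (@integrable_ubound _ _ _ _ _ 1); first exact: measurable_indic.
  by move=> w; rewrite indicE; case: (_ \in _); rewrite ?normr1 ?normr0.
apply: eq_Rintegral => w _; rewrite big_filter.
pose yw := [ffun i => Y i w].
have ind1 (y : {ffun I -> bool}) : \1_[set w | forall i, Y i w = y i] w = (y == yw)%:R :> R.
  rewrite indicE; congr (nat_of_bool _)%:R; apply/idP/eqP => [/set_mem/= h|->].
    by apply/ffunP => i; rewrite ffunE h.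
  by apply/mem_set => i /=; rewrite ffunE.
under eq_bigr do rewrite ind1.
have [Aw|nAw] := boolP [forall i in A, yw i].
  rewrite (bigD1 yw)//= eqxx big1 ?addr0; last by move=> y /andP[_ /negPf ->].
  rewrite indicE mem_set// => i iA.
  by move/forall_inP: Aw => /(_ i iA); rewrite ffunE.
rewrite big1; last first.
  move=> y Ay; case: eqP => // e; move: nAw; rewrite -e; by rewrite Ay.
rewrite indicE memNset// => h; move/negP: nAw; apply.
by apply/forall_inP => i iA; rewrite ffunE; exact: h.
Qed.

Lemma color_process_moment : color_process P Y -> exists (p : R) (q : {set {set I}} -> R),
  [/\ 0 <= p <= 1, partition_pmf q & forall A : {set I},
   fine (P [set w | forall i, i \in A -> Y i w]) =
   \sum_(pi : {set {set I}}) q pi * p ^+ #|[set finset.pblock pi i | i in A]%SET|].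
Proof.
move=> [p [q [p01 qp h]]]; exists p, q; split => // A.
rewrite prob_all_true -color_moment//; apply: eq_bigr => y _.
by rewrite h.
Qed.

Lemma color_process_of_moment (p : R) (q : {set {set I}} -> R) :
  0 <= p <= 1 -> partition_pmf q -> (forall A : {set I},
   fine (P [set w | forall i, i \in A -> Y i w]) =
   \sum_(pi : {set {set I}}) q pi * p ^+ #|[set finset.pblock pi i | i in A]%SET|) ->
  color_process P Y.
Proof.
move=> p01 qp h; exists p, q; split => // y.
rewrite -prob_fineK//; congr EFin; move: y; apply: ffun_law_unique => A.
by rewrite -prob_all_true h color_moment.
Qed.

End ColorProcessMoments.

(** * Color processes on three points *)

Section ThreeColors.
Context {R : realType} {d : measure_display} {T : measurableType d}.
Variables (P : probability T R) (Y : 'I_3 -> T -> bool) (nu : nat -> R).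
Hypothesis mY : forall i, measurable [set w | Y i w].
Hypothesis nuY : forall A : {set 'I_3},
  fine (P [set w | forall i, i \in A -> Y i w]) = nu #|A|.

Let o0 : 'I_3 := ord0.
Let o1 : 'I_3 := Ordinal (isT : 1 < 3)%N.
Let o2 : 'I_3 := Ordinal (isT : 2 < 3)%N.

Let I3P (i : 'I_3) : [\/ i = o0, i = o1 | i = o2].
Proof.
case: i => [[|[|[|//]]] h]; [constructor 1|constructor 2|constructor 3]; exact/val_inj.
Qed.

Let setT3 : [set: 'I_3]%SET = [set o0; o1; o2]%SET.
Proof. by apply/setP => i; rewrite !inE; case: (I3P i) => ->. Qed.

Let imset_pair (b : 'I_3 -> {set 'I_3}) i j :
  [set b k | k in [set i; j]]%SET = [set b i; b j]%SET.
Proof. by rewrite imsetU1 imset_set1. Qed.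

Let card_imset3 (b : 'I_3 -> {set 'I_3}) : #|[set b k | k in [set: 'I_3]]%SET| =
  ((b o0 != b o1) && (b o0 != b o2) + (b o1 != b o2).+1)%N.
Proof.
rewrite setT3 -finset.setUA [in LHS]imsetU1 imset_pair cardsU1 cards2 !inE negb_or.
by rewrite andbC.
Qed.

(** The combination is an average over partitions. One block contributes [2 p - 3 p + p = 0], two
    blocks [2 p^2 - (p + 2 p^2) + p = 0], and singletons [p (1 - p) (1 - 2 p)], which is nonnegative
    for [p <= 1/2]; and [p] is [nu 1]. *)
Lemma color3_necessary : nu 1 <= 2^-1 -> color_process P Y ->
  0 <= 2 * nu 3 - 3 * nu 2 + nu 1.
Proof.
move=> nu1 /(color_process_moment mY)[p [q [/andP[p0 p1] [q0 _ q1] h]]].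
pose b (pi : {set {set 'I_3}}) i := finset.pblock pi i.
have h1 : nu 1 = \sum_pi q pi * p.
  have := h [set o0]%SET; rewrite nuY cards1 => ->.
  by apply: eq_bigr => pi _; rewrite imset_set1 cards1.
have h2 i j : i != j -> nu 2 = \sum_pi q pi * p ^+ (b pi i != b pi j).+1.
  move=> ij; have := h [set i; j]%SET; rewrite nuY cards2 ij => ->.
  by apply: eq_bigr => pi _; rewrite imset_pair cards2.
have h3 : nu 3 = \sum_pi q pi * p ^+ ((b pi o0 != b pi o1) && (b pi o0 != b pi o2) + (b pi o1 != b pi o2).+1).
  have := h [set: 'I_3]%SET; rewrite nuY cardsT card_ord => ->.
  by apply: eq_bigr => pi _; rewrite card_imset3.
have pnu : nu 1 = p by rewrite h1 -mulr_suml q1 mul1r.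
have -> : 2 * nu 3 - 3 * nu 2 + nu 1 = 2 * nu 3 - nu 2 - nu 2 - nu 2 + nu 1 by ring.
rewrite {1}(h2 o0 o1)// {1}(h2 o0 o2)// (h2 o1 o2)// h3 [in X in _ + X]h1.
rewrite mulr_sumr -!sumrB -big_split/=; apply: sumr_ge0 => pi _.
have ph : p <= 2^-1 by rewrite -pnu.
have q0' := q0 pi.
have e : b pi o0 = b pi o1 -> (b pi o0 == b pi o2) = (b pi o1 == b pi o2) by move=> ->.
have e' : b pi o0 = b pi o2 -> (b pi o1 == b pi o2) = (b pi o0 == b pi o1).
  by move=> ->; rewrite eq_sym.
suff : 0 <= 2 * p ^+ ((b pi o0 != b pi o1) && (b pi o0 != b pi o2) + (b pi o1 != b pi o2).+1)
   - p ^+ (b pi o0 != b pi o1).+1 - p ^+ (b pi o0 != b pi o2).+1 - p ^+ (b pi o1 != b pi o2).+1 + p.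
  by move=> /(mulr_ge0 q0'); rewrite !mulrDr !mulrN mulrCA.
have [e01|n01] := eqVneq (b pi o0) (b pi o1).
  rewrite (e e01) /=; case: eqVneq => _ /=; rewrite ?expr1 ?expr2; nra.
have [e02|n02] := eqVneq (b pi o0) (b pi o2).
  rewrite (e' e02) (negbTE n01) /= expr1 expr2; nra.
case: eqVneq => _ /=; first by rewrite expr1 !expr2; nra.
have -> : (1 + 2 = 3)%N by [].
have : 0 <= p * (1 - p) * (1 - 2 * p) by rewrite !mulr_ge0//; lra.
rewrite !exprS expr0; lra.
Qed.

(** The five partitions of three points as fibers of label functions: one block, then the isolation
    of the point 2, 1 or 0, then singletons. *)
Let g (k : 'I_5) (i : 'I_3) : nat := nth 0%N (nth [::] [:: [:: 0; 0; 0]; [:: 0; 0; 1];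
  [:: 0; 1; 0]; [:: 1; 0; 0]; [:: 0; 1; 2]]%N k) i.

Let gpart k := finset.preim_partition (g k) [set: 'I_3]%SET.

Let gpartP k : finset.partition (gpart k) [set: 'I_3]%SET.
Proof. exact: finset.preim_partitionP. Qed.

Let gpblock k i j : (finset.pblock (gpart k) i == finset.pblock (gpart k) j) = (g k i == g k j).
Proof.
have /and3P[/eqP cov tI _] := gpartP k.
rewrite finset.eq_pblock//; last by rewrite cov finset.in_setT.
apply: (finset.pblock_equivalence_partition (R := fun x y => g k x == g k y)); rewrite ?finset.in_setT//.
by split=> // /eqP->.
Qed.

(* [wA], [wB], [wC] are the weights of the one-block partition, of each of the
   three partitions with two blocks, and of the partition into singletons. *)
Lemma color3_sufficient (p wA wB wC : R) :
  0 <= p <= 1 -> 0 <= wA -> 0 <= wB -> 0 <= wC -> wA + 3 * wB + wC = 1 ->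
  nu 1 = p -> nu 2 = wA * p + wB * (p + 2 * p ^+ 2) + wC * p ^+ 2 ->
  nu 3 = wA * p + 3 * wB * p ^+ 2 + wC * p ^+ 3 ->
  color_process P Y.
Proof.
move=> p01 A0 B0 C0 w1 n1 n2 n3.
pose wt (k : 'I_5) : R := nth 0 [:: wA; wB; wB; wB; wC] k.
(* The image under [gpart] of the weights on labels: sums against [q] become sums over the five
   labels. *)
pose q (pi : {set {set 'I_3}}) : R := \sum_(k < 5) wt k * (pi == gpart k)%:R.
have sum5 (F : 'I_5 -> R) : \sum_(k < 5) F k =
   F (inord 0) + F (inord 1) + F (inord 2) + F (inord 3) + F (inord 4).
  rewrite !big_ord_recr big_ord0 /= add0r.
  by congr (F _ + F _ + F _ + F _ + F _); apply/val_inj; rewrite /= inordK.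
have qsum (F : {set {set 'I_3}} -> R) : \sum_pi q pi * F pi = \sum_(k < 5) wt k * F (gpart k).
  rewrite /q; under eq_bigr do rewrite mulr_suml.
  rewrite exchange_big/=; apply: eq_bigr => k _.
  rewrite (bigD1 (gpart k))//= eqxx mulr1 big1 ?addr0// => pi /negPf ->.
  by rewrite mulr0 mul0r.
have wt0 k : 0 <= wt k by rewrite /wt; case: k => [[|[|[|[|[|//]]]]] h].
apply: (@color_process_of_moment _ _ _ _ _ _ _ p q) => //.
  split.
  - by move=> pi; apply: sumr_ge0 => k _; rewrite mulr_ge0.
  - move=> pi; have [k /eqP ->|no] := pickP (fun k => pi == gpart k).
      by move=> _; exact: gpartP.
    by rewrite /q big1 ?eqxx// => k _; rewrite (no k) mulr0.
  - have := qsum (fun=> 1); under eq_bigr do rewrite mulr1.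
    move=> ->; under eq_bigr do rewrite mulr1.
    by rewrite sum5 /wt !inordK//= -w1; ring.
move=> A; rewrite nuY qsum.
have cA : (#|A| <= 3)%N by rewrite -[X in (_ <= X)%N](card_ord 3) max_card.
move: cA; rewrite leq_eqVlt => /orP[/eqP cA|].
  have -> : A = [set: 'I_3]%SET.
    by apply/eqP; rewrite eqEcard finset.subsetT cardsT card_ord cA.
  rewrite cardsT card_ord n3 sum5; do 5!rewrite card_imset3 !gpblock.
  by rewrite /g /wt !inordK//=; ring.
rewrite ltnS leq_eqVlt => /orP[/cards2P[i [j [ij ->]]]|].
  rewrite cards2 ij n2 sum5; do 5!rewrite imset_pair cards2 gpblock.
  rewrite /g /wt !inordK//=.
  by move: ij; case: (I3P i) => ->; case: (I3P j) => -> //= _; ring.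
rewrite ltnS leq_eqVlt => /orP[/cards1P[i ->]|].
  rewrite cards1 n1 sum5; do 5!rewrite imset_set1 cards1.
  have pw : p = (wA + 3 * wB + wC) * p by rewrite w1 mul1r.
  by rewrite /wt !inordK//= !expr1 [LHS]pw; ring.
rewrite ltnS leqn0 cards_eq0 => /eqP ->.
have -> : nu #|(finset.set0 : {set 'I_3})| = 1.
  rewrite -nuY (_ : [set w | _] = setT) ?probability_setT//.
  by apply/seteqP; split => // w _ i; rewrite finset.in_set0.
rewrite sum5; do 5!rewrite imset0 cards0.
by rewrite /wt !inordK//= !expr0 -[LHS]w1; ring.
Qed.

End ThreeColors.

(** * The single big jump *)

Lemma cvg_pinfty_scale (R : realType) (c l : R) (f : R -> R) : 0 < c ->
  f h @[h --> +oo] --> l -> f (c * h) @[h --> +oo] --> l.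
Proof.
move=> c0 fl; apply/cvgrPdist_le => e e0.
apply: (near_pinfty_scale (Q := fun h => `|l - f h| <= e)) => //.
by move/cvgrPdist_le : fl; apply.
Qed.

Section BigJump.
Context {R : realType} {d : measure_display} {T : measurableType d}.
Variables (P : probability T R) (alpha : R) (m n : nat).
Hypothesis alpha0 : 0 < alpha.
Variables (c : 'I_m -> 'I_n.+1 -> R) (S : 'I_n.+1 -> {RV P >-> R}).
Hypothesis c0 : forall i k, 0 <= c i k.
Hypothesis indepS : independent S.
Hypothesis idS : identically_distributed S.
Variables (K K' : R).
Hypothesis K0 : 0 <= K.
Hypothesis cvgK : h `^ alpha * fine (P [set w | h < S ord0 w]) @[h --> +oo] --> K.
Hypothesis cvgK' : h `^ alpha * fine (P [set w | h < `|S ord0 w|]) @[h --> +oo] --> K'.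
Variables (A : {set 'I_m}) (mm : 'I_n.+1 -> R).
(* [mm k] is the minimum of [c i k] over [i \in A]. *)
Hypothesis mm_le : forall i k, i \in A -> mm k <= c i k.
Hypothesis mm_ex : forall k, exists2 i, i \in A & c i k = mm k.

Let a (h : R) := fine (P [set w | h < S ord0 w]).
Let pr (h : R) := fine (P [set w | h < `|S ord0 w|]).
Let event (h : R) := [set w | forall i, i \in A -> h < \sum_(k < n.+1) c i k * S k w].
Let M := 1 + \sum_(i < m) \sum_(k < n.+1) c i k.

Let M0 : 0 < M.
Proof. by rewrite ltr_pwDl// sumr_ge0// => i _; exact: sumr_ge0. Qed.

Let row_le i : \sum_(k < n.+1) c i k <= M.
Proof.
rewrite /M (bigD1 i)//= addrCA lerDl addr_ge0// sumr_ge0// => j _.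
exact: sumr_ge0.
Qed.

Let c_le i k : c i k <= M.
Proof.
apply: le_trans (row_le i); rewrite (bigD1 k)//= lerDl; exact: sumr_ge0.
Qed.

Let mm0 k : 0 <= mm k.
Proof. by have [i _ <-] := mm_ex k. Qed.

Let mm_M k : mm k <= M.
Proof. by have [i _ <-] := mm_ex k. Qed.

Let mgt (U : T -> R) h : measurable_fun setT U -> measurable [set w | h < U w].
Proof.
move=> mU; rewrite -[X in measurable X]setTI.
by have := mU measurableT `]h, +oo[%classic (measurable_itv _); rewrite set_itvoy.
Qed.

Let mS k : measurable_fun setT (S k). Proof. by []. Qed.
Let mabsS k : measurable_fun setT (fun w => `|S k w|).
Proof. exact: measurableT_comp. Qed.

Let mevent h : measurable (event h).
Proof.
have -> : event h = \big[setI/setT]_(i in A) [set w | h < \sum_(k < n.+1) c i k * S k w].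
  apply/seteqP; split => w /=.
    by move=> E; elim/big_ind : _ => //= B C; split.
  by move=> + i iA; rewrite (bigD1 i)//= => -[].
apply: bigsetI_measurable => i _; apply: mgt.
by apply: measurable_sum => k; exact: measurable_funM.
Qed.

Let preS k (B : set R) : measurable B -> measurable (S k @^-1` B).
Proof. by move=> mB; rewrite -[X in measurable X]setTI; exact: mS. Qed.

Let aE k h : fine (P [set w | h < S k w]) = a h.
Proof.
congr fine; have := idS k ord0 (measurable_itv `]h, +oo[).
by rewrite /distribution /pushforward set_itvoy.
Qed.

Let absB h : measurable [set x : R | h < `|x|].
Proof.
rewrite -[X in measurable X]setTI.
have mA : measurable_fun setT (fun x : R => `|x|) by exact: normr_measurable.
by have := mA measurableT `]h, +oo[%classic (measurable_itv _); rewrite set_itvoy.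
Qed.

Let prE k h : P [set w | h < `|S k w|] = P [set w | h < `|S ord0 w|].
Proof. exact: idS (absB h). Qed.

Let pairE k l h : k != l ->
  fine (P ([set w | h < `|S k w|] `&` [set w | h < `|S l w|])) = pr h ^+ 2.
Proof.
move=> kl; pose B (i : 'I_n.+1) := if (i == k) || (i == l) then [set x : R | h < `|x|] else setT.
have mB i : measurable (B i) by rewrite /B; case: ifP.
have := @indepS B mB.
have -> : [set w | forall i, B i (S i w)] = [set w | h < `|S k w|] `&` [set w | h < `|S l w|].
  apply/seteqP; split => w /=.
    by move=> H; have := H k; have := H l; rewrite /B !eqxx ?orbT.
  move=> [hk hl] i; rewrite /B; case: ifP => // /orP[] /eqP -> //.
move=> ->; rewrite (bigD1 k)//= (bigD1 l)/=; last by rewrite eq_sym.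
rewrite big1 ?mule1; last first.
  move=> i /andP[/negPf ik /negPf il]; rewrite /B ik il/= preimage_setT.
  exact: probability_setT.
rewrite /B !eqxx orbT /=.
rewrite [P (S k @^-1` _)](prE k) [P (S l @^-1` _)](prE l) fineM ?fin_num_measure//.
  exact: mgt.
exact: mgt.
Qed.

(** Counts ordered pairs of distinct indices whose variables both exceed [e] in absolute value. By
    independence its expectation is at most [(n + 1)^2 pr(e)^2], negligible against a single jump;
    it absorbs pointwise every configuration with two large variables. *)
Let N2 e w : R := \sum_(k < n.+1) \sum_(l < n.+1 | l != k)
  \1_([set w | e < `|S k w|] `&` [set w | e < `|S l w|]) w.

Let N2_ge0 e w : 0 <= N2 e w.
Proof. by apply: sumr_ge0 => k _; apply: sumr_ge0. Qed.

Let mG e k l : measurable ([set w | e < `|S k w|] `&` [set w | e < `|S l w|]).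
Proof. by apply: measurableI; exact: mgt. Qed.

Let int_indic (B : set T) : measurable B -> P.-integrable setT (EFin \o \1_B).
Proof.
move=> mB; apply: (@integrable_ubound _ _ _ _ _ 1); first exact: measurable_indic.
by move=> w; rewrite indicE; case: (_ \in _); rewrite ?normr1 ?normr0.
Qed.

Let iN2 e : P.-integrable setT (EFin \o N2 e) /\
  \int[P]_w N2 e w <= n.+1%:R ^+ 2 * pr e ^+ 2.
Proof.
pose F (k l : 'I_n.+1) := if l != k then
  ([set w | e < `|S k w|] `&` [set w | e < `|S l w|]) else set0.
have mF k l : measurable (F k l) by rewrite /F; case: ifP.
have N2E w : N2 e w = \sum_(x : 'I_n.+1 * 'I_n.+1) \1_(F x.1 x.2) w.
  rewrite -(pair_bigA _ (fun k l => \1_(F k l) w : R)) /=.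
  apply: eq_bigr => k _; rewrite big_mkcond; apply: eq_bigr => l _.
  by rewrite /F; case: ifP => //; rewrite indic0.
have ->: N2 e = (fun w => \sum_(x : 'I_n.+1 * 'I_n.+1) \1_(F x.1 x.2) w) by apply/funext.
split.
  apply: (@integrable_ubound _ _ _ _ _ (n.+1 * n.+1)%:R).
    by apply: measurable_sum => x; exact: measurable_indic.
  move=> w; rewrite (le_trans (ler_norm_sum _ _ _))//.
  rewrite (@le_trans _ _ (\sum_(x : 'I_n.+1 * 'I_n.+1) 1))//.
    by apply: ler_sum => x _; rewrite indicE; case: (_ \in _); rewrite ?normr1 ?normr0.
  by rewrite sumr_const card_prod card_ord.
rewrite Rintegral_sum; last by move=> x; exact: int_indic.
rewrite (@le_trans _ _ (\sum_(x : 'I_n.+1 * 'I_n.+1) pr e ^+ 2))//.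
  apply: ler_sum => -[k l] _ /=; rewrite Rintegral_indicator// /F.
  case: eqVneq => lk /=; first by rewrite measure0 sqr_ge0.
  by rewrite pairE// eq_sym.
by rewrite sumr_const card_prod card_ord -[leLHS]mulr_natl natrM -expr2.
Qed.

Let pos k := 0 < mm k.

Let sumaE (Q : pred 'I_n.+1) (x : 'I_n.+1 -> R) :
  \int[P]_w (\sum_(k | Q k) \1_([set w | x k < S k w]) w) = \sum_(k | Q k) a (x k).
Proof.
rewrite -(big_filter _ Q) /=.
under eq_Rintegral do rewrite -big_filter.
rewrite Rintegral_sum; last by move=> k; apply: int_indic; exact: mgt.
by apply: eq_bigr => k _; rewrite Rintegral_indicator ?aE//; exact: mgt.
Qed.

Let isuma (Q : pred 'I_n.+1) (x : 'I_n.+1 -> R) :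
  P.-integrable setT (EFin \o (fun w => \sum_(k | Q k) \1_([set w | x k < S k w]) w)).
Proof.
apply: (@integrable_ubound _ _ _ _ _ n.+1%:R).
  rewrite (_ : (fun _ => _) =
      (fun w => \sum_(k < n.+1) (if Q k then \1_([set w | x k < S k w]) w else 0))).
    apply: measurable_sum => k; case: (Q k) => //.
    by apply: measurable_indic; exact: mgt.
  by apply/funext => w; rewrite big_mkcond.
move=> w; rewrite (le_trans (ler_norm_sum _ _ _))// big_mkcond.
rewrite (@le_trans _ _ (\sum_(k < n.+1) 1))//; last by rewrite sumr_const card_ord.
apply: ler_sum => k _; case: (Q k) => //.
by rewrite indicE; case: (_ \in _); rewrite ?normr1 ?normr0.
Qed.

(** Once two variables are large, each large one has a large partner, so the number of large
    variables is bounded by [N2]. *)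
Let two_large g w k l : k != l -> g < `|S k w| -> g < `|S l w| ->
  forall k', g < `|S k' w| ->
  1 <= \sum_(l' < n.+1 | l' != k')
    (\1_([set w | g < `|S k' w|] `&` [set w | g < `|S l' w|]) w : R).
Proof.
move=> kl gk gl k' gk'.
have [l' l'k' gl'] : exists2 l', l' != k' & g < `|S l' w|.
  have [kk'|kk'] := eqVneq k k'; last by exists k.
  by exists l => //; rewrite -kk' eq_sym.
rewrite (bigD1 l')//= indicE mem_set//= lerDl; exact: sumr_ge0.
Qed.

Let rest_le i k w g : 0 <= g -> (forall l, l != k -> `|S l w| <= g) ->
  `|\sum_(l < n.+1 | l != k) c i l * S l w| <= M * g.
Proof.
move=> g0 H; rewrite (le_trans (ler_norm_sum _ _ _))//.
rewrite (@le_trans _ _ (\sum_(l < n.+1 | l != k) c i l * g))//.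
  by apply: ler_sum => l lk; rewrite normrM ger0_norm// ler_wpM2l// H.
rewrite -mulr_suml ler_wpM2r//; apply: le_trans (row_le i).
by rewrite [leRHS](bigD1 k)//= lerDr.
Qed.

(** With a single large variable, [S k > r h / mm k] pushes every [c i k * S k] with [i] in [A]
    above [r h], and the others subtract at most [M e h <= (r - 1) h]. With two large variables the
    subtracted [N2] dominates the sum. *)
Let lower r e h : 1 < r -> 0 < h -> 0 < e -> e * M <= r - 1 ->
  \sum_(k < n.+1 | pos k) a (r * h / mm k) - n.+1%:R ^+ 2 * pr (e * h) ^+ 2 <=
  fine (P (event h)).
Proof.
move=> r1 h0 e0 eM; have [i2 l2] := iN2 (e * h).
rewrite -sumaE lerBlDr -Rintegral_indicator//.
apply: le_trans (lerD (lexx _) l2).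
rewrite -RintegralD//; last exact: int_indic.
apply: le_Rintegral => //.
  exact: (integrableD measurableT (int_indic (mevent h)) i2).
move=> w _.
have rh0 : 0 < r * h by rewrite mulr_gt0// (lt_trans _ r1).
have eMr : e * M <= r by apply: le_trans eM _; rewrite lerBlDr lerDl.
have FG k : pos k -> r * h / mm k < S k w -> e * h < `|S k w|.
  move=> pk Fk; apply: le_lt_trans (lt_le_trans Fk (ler_norm _)).
  rewrite ler_pdivlMr// mulrAC ler_pM2r//.
  by apply: le_trans eMr; rewrite ler_pM2l.
have [[k [l [kl Gk Gl]]]|one] :=
    pselect (exists k l, [/\ k != l, e * h < `|S k w| & e * h < `|S l w|]).
  apply: (@le_trans _ _ (N2 (e * h) w)); last by rewrite lerDr.
  rewrite big_mkcond; apply: ler_sum => k' _.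
  case: ifPn => pk'; last by apply: sumr_ge0.
  rewrite indicE; have [/set_mem/= Fk'|_] := boolP (_ \in _); last by apply: sumr_ge0.
  exact: (two_large kl Gk Gl (FG _ pk' Fk')).
have [[k [pk Fk]]|no] := pselect (exists k, pos k /\ r * h / mm k < S k w); last first.
  rewrite big1 ?addr_ge0// => k pk; rewrite indicE memNset//= => Fk.
  by apply: no; exists k.
have Gk := FG _ pk Fk.
have small l : l != k -> `|S l w| <= e * h.
  move=> lk; rewrite leNgt; apply/negP => Gl; apply: one; exists l, k; split => //.
rewrite (bigD1 k)//= big1 ?addr0; last first.
  move=> l /andP[pl lk]; rewrite indicE memNset//= => Fl.
  by have := small _ lk; rewrite leNgt (FG _ pl Fl).
apply: (@le_trans _ _ 1); first by rewrite indicE; case: (_ \in _).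
rewrite indicE mem_set ?lerDl// => i iA.
have eh0 : 0 <= e * h by rewrite mulr_ge0 ?ltW.
have := rest_le i eh0 small; rewrite ler_norml => /andP[rest _].
rewrite (bigD1 k)//=.
have : r * h < c i k * S k w.
  move: Fk; rewrite ltr_pdivrMr// => Fk; apply: (lt_le_trans Fk).
  rewrite mulrC ler_wpM2r ?mm_le//.
  by rewrite -(pmulr_lge0 _ pk) mulrC ltW// (lt_trans rh0)// mulrC.
have : M * (e * h) <= (r - 1) * h by rewrite mulrA [M * e]mulrC ler_pM2r.
move: rest; move: (\sum_(_ < _ | _) _) (c i k * _) (M * _) => x y z; lra.
Qed.

(** If at most [S k] is large, the condition [X_i > h] at a row [i] of [A] where [c i k = mm k]
    leaves [mm k * S k > h / r], the others adding at most [(1 - 1/r) h]. In particular [mm k] is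
    positive, so columns with minimum 0 do not contribute. *)
Let upper r e h : 1 < r -> 0 < h -> 0 < e -> e * M <= 1 - r^-1 ->
  fine (P (event h)) <=
  \sum_(k < n.+1 | pos k) a (r^-1 * h / mm k) + n.+1%:R ^+ 2 * pr (e * h) ^+ 2.
Proof.
move=> r1 h0 e0 eM; have [i2 l2] := iN2 (e * h).
rewrite -sumaE -Rintegral_indicator//.
apply: le_trans (lerD (lexx _) l2).
rewrite -RintegralD//.
apply: le_Rintegral => //.
- exact: int_indic (mevent h).
- exact: (integrableD measurableT (isuma _ _) i2).
move=> w _; set rhs := (X in _ <= X).
have s0 : 0 <= \sum_(k < n.+1 | pos k) (\1_([set w | r^-1 * h / mm k < S k w]) w : R).
  exact: sumr_ge0.
rewrite indicE; have [/set_mem Ew|_] := boolP (_ \in _); last by rewrite addr_ge0.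
have [[k [l [kl Gk Gl]]]|one] :=
    pselect (exists k l, [/\ k != l, e * h < `|S k w| & e * h < `|S l w|]).
  apply: (@le_trans _ _ (N2 (e * h) w)); last by rewrite lerDr.
  apply: le_trans (two_large kl Gk Gl Gk) _.
  rewrite /N2 [leRHS](bigD1 k)//= lerDl; apply: sumr_ge0 => ? _; exact: sumr_ge0.
have [k small] : exists k, forall l, l != k -> `|S l w| <= e * h.
  have [[k Gk]|none] := pselect (exists k, e * h < `|S k w|).
    exists k => l lk; rewrite leNgt; apply/negP => Gl; apply: one.
    by exists l, k.
  exists ord0 => l _; rewrite leNgt; apply/negP => Gl; apply: none.
  by exists l.
have [i iA cik] := mm_ex k.
have eh0 : 0 <= e * h by rewrite mulr_ge0 ?ltW.
have := rest_le i eh0 small; rewrite ler_norml => /andP[_ rest].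
have := Ew i iA; rewrite (bigD1 k)//= cik => hE.
have rV0 : 0 < r^-1 by rewrite invr_gt0 (lt_trans _ r1).
have big : r^-1 * h < mm k * S k w.
  have : M * (e * h) <= (1 - r^-1) * h by rewrite mulrA [M * e]mulrC ler_pM2r.
  move: rest hE; move: (\sum_(_ < _ | _) _) (mm k * _) (M * _) (r^-1) => x y z u; lra.
have pk : pos k.
  rewrite /pos lt_neqAle mm0 andbT; apply/negP => /eqP m0.
  by move: big; rewrite -m0 mul0r ltNge mulr_ge0 ?ltW.
rewrite (le_trans _ (lerD (lexx _) (N2_ge0 _ _)))// addr0.
rewrite (bigD1 k)//= indicE mem_set/=; first by rewrite lerDl; exact: sumr_ge0.
by rewrite ltr_pdivrMr// [ltRHS]mulrC.
Qed.

Lemma big_jump : h `^ alpha * fine (P (event h)) @[h --> +oo] -->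
  K * \sum_(k < n.+1) mm k `^ alpha.
Proof.
pose t h := h `^ alpha * \sum_(k < n.+1 | pos k) a (h / mm k).
have Kt : t h @[h --> +oo] --> K * \sum_(k < n.+1) mm k `^ alpha.
  have -> : K * \sum_(k < n.+1) mm k `^ alpha = \sum_(k < n.+1 | pos k) mm k `^ alpha * K.
    rewrite mulr_sumr [RHS]big_mkcond; apply: eq_bigr => k _.
    case: ifPn => [_|]; first by rewrite mulrC.
    rewrite /pos lt_neqAle mm0 andbT negbK => /eqP <-.
    by rewrite powR0 ?mulr0// gt_eqF.
  have : \sum_(k < n.+1 | pos k) mm k `^ alpha *
      (((mm k)^-1 * h) `^ alpha * a ((mm k)^-1 * h)) @[h --> +oo] -->
      \sum_(k < n.+1 | pos k) mm k `^ alpha * K.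
    apply: cvg_big => [|k pk]; first exact: add_continuous.
    apply: cvgM; first exact: cvg_cst.
    have mk0 : 0 < (mm k)^-1 by rewrite invr_gt0.
    exact: (cvg_pinfty_scale mk0 cvgK).
  apply: cvg_trans; apply: near_eq_cvg; near=> h.
  have h0 : 0 <= h by near: h; exact: nbhs_pinfty_ge.
  rewrite /t mulr_sumr; apply: eq_bigr => k pk.
  rewrite powRM ?invr_ge0// powRV// -mulrA mulVKf ?gt_eqF ?powR_gt0//.
  by rewrite [h / _]mulrC.
apply: (cvg_scale_squeeze alpha0 _ Kt).
  by rewrite mulr_ge0// sumr_ge0// => k _; exact: powR_ge0.
move=> r e r1 e0.
have r0 : 0 < r by exact: lt_trans r1.
(* The relative size below which variables are harmless; as [1 - 1/r <= r - 1], it serves both the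
   lower and the upper bound. *)
pose q := (1 - r^-1) / M.
have q0 : 0 < q by rewrite divr_gt0// subr_gt0 invf_lt1.
have qM : q * M <= 1 - r^-1 by rewrite /q divfK// gt_eqF.
have qM' : q * M <= r - 1.
  apply: (le_trans qM); have -> : 1 - r^-1 = (r - 1) * r^-1 by field; rewrite gt_eqF.
  by rewrite ler_piMr ?subr_ge0 ?(ltW r1)// invf_le1// ltW.
(* Since [pr (q h)] is of order [h^-alpha], its square times [h^alpha] still decays like
   [h^-alpha]. *)
have err : \forall h \near +oo, h `^ alpha * (n.+1%:R ^+ 2 * pr (q * h) ^+ 2) <= e.
  pose B := n.+1%:R ^+ 2 * (K' + 1) ^+ 2 / (q `^ alpha) ^+ 2.
  have qa : 0 < q `^ alpha by exact: powR_gt0.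
  have B0 : 0 <= B by rewrite divr_ge0 ?sqr_ge0// mulr_ge0 ?sqr_ge0.
  have e1 : 0 < e / (B + 1) by rewrite divr_gt0// ltr_pwDr.
  have nT : \forall h \near +oo, (q * h) `^ alpha * pr (q * h) <= K' + 1.
    have := cvg_pinfty_scale q0 cvgK'.
    move/cvgrPdist_le => /(_ 1 ltr01); apply: filterS => h.
    by rewrite ler_distlC => /andP[].
  apply: filterS3 nT (near_pinfty_powRV_le alpha0 e1) (nbhs_pinfty_gt (num_real 0)).
  move=> h hT hV h0; have H0 := powR_gt0 alpha h0.
  have p0 : 0 <= pr (q * h) by rewrite fine_ge0.
  have : (q `^ alpha * h `^ alpha * pr (q * h)) ^+ 2 <= (K' + 1) ^+ 2.
    rewrite -powRM ?(ltW q0) ?(ltW h0)//; apply: lerXn2r => //; rewrite nnegrE.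
      by rewrite mulr_ge0 ?powR_ge0.
    by apply: le_trans hT; rewrite mulr_ge0 ?powR_ge0.
  have BV : B * (h `^ alpha)^-1 <= e.
    apply: (@le_trans _ _ ((B + 1) * (h `^ alpha)^-1)).
      by rewrite ler_wpM2r ?invr_ge0 ?powR_ge0// lerDl.
    by rewrite mulrC -ler_pdivlMr// ltr_pwDr.
  move=> h2; apply: le_trans BV.
  have -> : h `^ alpha * (n.+1%:R ^+ 2 * pr (q * h) ^+ 2) =
     n.+1%:R ^+ 2 * (q `^ alpha * h `^ alpha * pr (q * h)) ^+ 2 / (q `^ alpha) ^+ 2 * (h `^ alpha)^-1.
    by field; rewrite !gt_eqF.
  rewrite ler_pM2r ?invr_gt0// ler_pM2r ?invr_gt0 ?exprn_gt0//.
  by rewrite ler_wpM2l ?sqr_ge0.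
apply: filterS2 err (nbhs_pinfty_gt (num_real 0)) => h herr h0.
have H0 := powR_gt0 alpha h0.
have lo := lower r1 h0 q0 qM'.
have up := upper r1 h0 q0 qM.
have ra : 0 < r `^ alpha by exact: powR_gt0.
have rV0 : 0 <= r^-1 by rewrite invr_ge0 ltW.
rewrite /t (powRM alpha (ltW r0) (ltW h0)) (powRM alpha rV0 (ltW h0)) (powRV alpha (ltW r0)).
rewrite -!mulrA mulKf ?gt_eqF// mulVKf ?gt_eqF//.
apply/andP; split.
  rewrite lerBlDr; apply: le_trans (lerD (lexx _) herr).
  rewrite -mulrDr ler_pM2l//; move: lo; rewrite lerBlDr; exact.
apply: le_trans (lerD (lexx _) herr).
by rewrite -mulrDr ler_pM2l.
Unshelve. all: by end_near. Qed.

End BigJump.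

(** * The phase transition *)

Section Asymptotics.
Context {R : realType}.
Variables (alpha K t r : R) (nu : R -> nat -> R).
Hypothesis alpha0 : 0 < alpha.
Hypothesis K0 : 0 < K.
Hypothesis cvg1 : h `^ alpha * nu h 1 @[h --> +oo] --> K.
Hypothesis cvg2 : h `^ alpha * nu h 2 @[h --> +oo] --> K * t.
Hypothesis cvg3 : h `^ alpha * nu h 3 @[h --> +oo] --> K * r.

Let near2 (A B C : R -> Prop) : (\forall h \near +oo, A h) ->
  (\forall h \near +oo, B h) -> (forall h, A h -> B h -> C h) ->
  \forall h \near +oo, C h.
Proof.
move=> nA nB ABC; near=> h.
apply: ABC; near: h; [exact: nA|exact: nB].
Unshelve. all: by end_near. Qed.

Let cvg0 : nu h 1 @[h --> +oo] --> 0.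
Proof.
apply/cvgrPdist_le => e e0.
have e1 : 0 < e / (K + 1) by rewrite divr_gt0// ltr_wpDr// ltW.
have : \forall h \near +oo, `|K - h `^ alpha * nu h 1| <= 1.
  by move/cvgrPdist_le : cvg1 => /(_ 1 ltr01).
move=> H; apply: filterS3 H (near_pinfty_powRV_le alpha0 e1) (nbhs_pinfty_gt (num_real 0)).
move=> h hK hV h0; rewrite sub0r normrN.
have H0 := powR_gt0 alpha h0.
have : `|h `^ alpha * nu h 1| <= K + 1.
  rewrite -[X in `|X|](subrK K) (le_trans (ler_normD _ _))// addrC.
  by rewrite (gtr0_norm K0) lerD2l distrC.
rewrite normrM (gtr0_norm H0) mulrC -ler_pdivlMr// => /le_trans; apply.
rewrite -ler_pdivlMl; last by rewrite ltr_wpDr// ltW.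
by rewrite mulrC.
Qed.

Let near_gt0 (f : R -> R) (l : R) : 0 < l ->
  h `^ alpha * f h @[h --> +oo] --> l -> \forall h \near +oo, 0 < f h.
Proof.
move=> l0 cf; have H : \forall h \near +oo, 0 < h `^ alpha * f h by exact: (cvgr_gt l cf 0 l0).
have P0 : \forall h \near +oo, (0 : R) < h by exact: nbhs_pinfty_gt.
apply: (near2 H P0) => h hf h0.
by move: hf; rewrite pmulr_rgt0// powR_gt0.
Qed.

Let near_nu1 : \forall h \near +oo, 0 < nu h 1 < 2^-1.
Proof.
have half : (0 : R) < 2^-1 by rewrite invr_gt0.
have lt_half : \forall h \near +oo, nu h 1 < 2^-1 by exact: (cvgr_lt (0 : R) cvg0 _ half).
have gt_0 : \forall h \near +oo, 0 < nu h 1 by exact: (@near_gt0 (nu^~ 1) _ K0 cvg1).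
apply: near2 gt_0 lt_half _ => h p0 p1.
by rewrite p0.
Qed.

Lemma asymptotic_color_violation : 2 * r - 3 * t + 1 < 0 ->
  \forall h \near +oo,
    nu h 1 <= 2^-1 /\ 2 * nu h 3 - 3 * nu h 2 + nu h 1 < 0.
Proof.
move=> neg.
have l0 : 0 < - (2 * (K * r) - 3 * (K * t) + K).
  rewrite oppr_gt0; have -> : 2 * (K * r) - 3 * (K * t) + K = K * (2 * r - 3 * t + 1) by ring.
  by rewrite pmulr_rlt0.
have : h `^ alpha * - (2 * nu h 3 - 3 * nu h 2 + nu h 1) @[h --> +oo] -->
    - (2 * (K * r) - 3 * (K * t) + K).
  rewrite (_ : (fun h => _) = (fun h => - (2 * (h `^ alpha * nu h 3) -
      3 * (h `^ alpha * nu h 2) + h `^ alpha * nu h 1))); last first.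
    by apply/funext => h; ring.
  apply: cvgN; apply: cvgD => //; apply: cvgB; apply: cvgM => //; exact: cvg_cst.

move=> /(@near_gt0 (fun h => - (2 * nu h 3 - 3 * nu h 2 + nu h 1)) _ l0) lt0; apply: near2 near_nu1 lt0 _ => h /andP[_ /ltW p1].
by rewrite oppr_gt0.
Qed.

(** The expression is [E prod_i (Y_i - p)] with [p = nu h 1]. Given the partition every color has
    mean [p], so in a color process only the one-block partition contributes, and the value is
    [wA p (1 - p) (1 - 2 p)]. Its leading term is [nu h 3], as [p] tends to 0. *)
Let near_wA : 0 < r ->
  \forall h \near +oo, 0 < nu h 3 - 3 * nu h 1 * nu h 2 + 2 * nu h 1 ^+ 3.
Proof.
move=> r0; apply: (@near_gt0 _ (K * r - 3 * 0 * (K * t) + 2 * 0 ^+ 2 * K)).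
  by rewrite mulr0 mul0r subr0 expr0n mulr0 mul0r addr0 mulr_gt0.
rewrite (_ : (fun h => _) = (fun h => h `^ alpha * nu h 3 -
    3 * nu h 1 * (h `^ alpha * nu h 2) + 2 * nu h 1 ^+ 2 * (h `^ alpha * nu h 1))); last first.
  by apply/funext => h; ring.
apply: cvgD; first (apply: cvgB => //; apply: cvgM => //; apply: cvgM => //; exact: cvg_cst).
apply: cvgM => //; apply: cvgM; first exact: cvg_cst.
by rewrite expr2; apply: cvgM.
Qed.

(** The covariance of two colors is [(wA + wB) p (1 - p)]; multiplied by [1 - 2 p] and reduced by
    the third central moment it leaves [wB p (1 - p) (1 - 2 p)]. *)
Let near_wB : r < t ->
  \forall h \near +oo, 0 < (nu h 2 - nu h 1 ^+ 2) * (1 - 2 * nu h 1) -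
    (nu h 3 - 3 * nu h 1 * nu h 2 + 2 * nu h 1 ^+ 3).
Proof.
move=> rt; apply: (@near_gt0 _ ((K * t - 0 * K) * (1 - 2 * 0) -
   (K * r - 3 * 0 * (K * t) + 2 * 0 ^+ 2 * K))).
  rewrite (_ : _ - _ = K * (t - r)); last by ring.
  by rewrite mulr_gt0// subr_gt0.
rewrite (_ : (fun h => _) = (fun h => (h `^ alpha * nu h 2 - nu h 1 * (h `^ alpha * nu h 1)) *
    (1 - 2 * nu h 1) - (h `^ alpha * nu h 3 -
    3 * nu h 1 * (h `^ alpha * nu h 2) + 2 * nu h 1 ^+ 2 * (h `^ alpha * nu h 1)))); last first.
  by apply/funext => h; ring.
apply: cvgB.
  apply: cvgM; first by apply: cvgB => //; exact: cvgM.
  by apply: cvgB; [exact: cvg_cst|apply: cvgM => //; exact: cvg_cst].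
apply: cvgD; first (apply: cvgB => //; apply: cvgM => //; apply: cvgM => //; exact: cvg_cst).
apply: cvgM => //; apply: cvgM; first exact: cvg_cst.
by rewrite expr2; apply: cvgM.
Qed.

(** This is [(1 - wA - 3 wB) p (1 - p) (1 - 2 p)]; it expands to [2 nu_3 - 3 nu_2 + nu_1], the
    combination of the necessary condition. *)
Let near_wC : 0 < 2 * r - 3 * t + 1 ->
  \forall h \near +oo, 0 < nu h 1 * (1 - nu h 1) * (1 - 2 * nu h 1) -
    3 * (nu h 2 - nu h 1 ^+ 2) * (1 - 2 * nu h 1) +
    2 * (nu h 3 - 3 * nu h 1 * nu h 2 + 2 * nu h 1 ^+ 3).
Proof.
move=> pos; apply: (@near_gt0 _ (K * (1 - 0) * (1 - 2 * 0) -
   3 * (K * t - 0 * K) * (1 - 2 * 0) + 2 *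
   (K * r - 3 * 0 * (K * t) + 2 * 0 ^+ 2 * K))).
  rewrite (_ : _ + _ = K * (2 * r - 3 * t + 1)); last by ring.
  exact: mulr_gt0.
rewrite (_ : (fun h => _) = (fun h => h `^ alpha * nu h 1 * (1 - nu h 1) * (1 - 2 * nu h 1) -
    3 * (h `^ alpha * nu h 2 - nu h 1 * (h `^ alpha * nu h 1)) * (1 - 2 * nu h 1) +
    2 * (h `^ alpha * nu h 3 -
    3 * nu h 1 * (h `^ alpha * nu h 2) + 2 * nu h 1 ^+ 2 * (h `^ alpha * nu h 1)))); last first.
  by apply/funext => h; ring.
have c12 : 1 - 2 * nu h 1 @[h --> +oo] --> (1 - 2 * 0 : R).
  by apply: cvgB; [exact: cvg_cst|apply: cvgM => //; exact: cvg_cst].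
apply: cvgD.
  apply: cvgB; apply: cvgM => //; apply: cvgM => //; try exact: cvg_cst.
    by apply: cvgB => //; exact: cvg_cst.
  by apply: cvgB => //; exact: cvgM.
apply: cvgM; first exact: cvg_cst.
apply: cvgD; first (apply: cvgB => //; apply: cvgM => //; apply: cvgM => //; exact: cvg_cst).
apply: cvgM => //; apply: cvgM; first exact: cvg_cst.
by rewrite expr2; apply: cvgM.
Qed.

(* The weights solve the moment equations of [color3_sufficient]. *)
Lemma asymptotic_color_weights : 0 < r -> r < t -> 0 < 2 * r - 3 * t + 1 ->
  \forall h \near +oo, exists wA wB wC,
    [/\ 0 <= nu h 1 <= 1, 0 <= wA, 0 <= wB & 0 <= wC] /\
    [/\ wA + 3 * wB + wC = 1,
        nu h 2 = wA * nu h 1 + wB * (nu h 1 + 2 * nu h 1 ^+ 2) + wC * nu h 1 ^+ 2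
      & nu h 3 = wA * nu h 1 + 3 * wB * nu h 1 ^+ 2 + wC * nu h 1 ^+ 3].
Proof.
move=> r0 rt pos; apply: near2 near_nu1 (near2 (near_wA r0) (near2 (near_wB rt) (near_wC pos)
  (fun _ => @conj _ _)) (fun _ => @conj _ _)) _.
move=> h; move: (nu h 1) (nu h 2) (nu h 3) => p x y /andP[p0 p12] [wA [wB wC]].
have p1 : 0 < 1 - p.
  by rewrite subr_gt0 (lt_le_trans p12)// invf_le1// ler1n.
have p2 : 0 < 1 - 2 * p by rewrite subr_gt0 mulrC -ltr_pdivlMr// div1r.
have D0 : 0 < p * (1 - p) * (1 - 2 * p) by rewrite !mulr_gt0.
exists ((y - 3 * p * x + 2 * p ^+ 3) / (p * (1 - p) * (1 - 2 * p))).
exists (((x - p ^+ 2) * (1 - 2 * p) - (y - 3 * p * x + 2 * p ^+ 3)) /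
  (p * (1 - p) * (1 - 2 * p))).
exists ((p * (1 - p) * (1 - 2 * p) - 3 * (x - p ^+ 2) * (1 - 2 * p) +
    2 * (y - 3 * p * x + 2 * p ^+ 3)) / (p * (1 - p) * (1 - 2 * p))).
split; first split.
- by rewrite (ltW p0)/= -subr_ge0 ltW.
- exact: divr_ge0 (ltW wA) (ltW D0).
- exact: divr_ge0 (ltW wB) (ltW D0).
- exact: divr_ge0 (ltW wC) (ltW D0).
have q : [&& p != 0, 1 - p != 0 & 1 - 2 * p != 0] by rewrite !gt_eqF.
have {q}[pn /andP[p1n p2n]] := andP q.
by split; field; rewrite pn p1n p2n.
Qed.

End Asymptotics.

(** * The exponents c_1 and c_2 *)

Section Exponents.
Context {R : realType}.
Implicit Types a b c alpha : R.

Lemma powR_lt_exponent a c d : 0 < a < 1 -> c < d -> a `^ d < a `^ c.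
Proof.
move=> /andP[a0 a1] cd; rewrite /powR gt_eqF// ltr_expR ltr_nM2r//.
by rewrite ln_lt0// a0.
Qed.

(** [2 a^c + 2 b^c] is continuous and strictly decreasing in [c], from 4 at 0 to a value below 1 at
    2. *)
Lemma is_c1_exists a b : 0 < a < 1 -> 0 < b < 1 -> 2 * a ^+ 2 + 2 * b ^+ 2 < 1 ->
  exists! c, is_c1 a b c.
Proof.
move=> /[dup] a01 /andP[a0 a1] /[dup] b01 /andP[b0 b1] lt1.
pose f c : R := 2 * a `^ c + 2 * b `^ c.
have mono c d : c < d -> f d < f c.
  by move=> cd; rewrite ltrD// ltr_pM2l// powR_lt_exponent.
have f0 : 1 < f 0.
  by rewrite /f !powRr0 mulr1 -[ltLHS]addr0 ltrD// ltr1n.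
have f2 : f 2 < 1 by rewrite /f !powR_mulrn ?(ltW a0) ?(ltW b0).
have contf : continuous f.
  have cont x : 0 < x -> continuous (fun c : R => 2 * x `^ c).
    move=> x0 c; rewrite (_ : (fun c => _) = (fun c => 2 * expR (c * ln x))); last first.
      by apply/funext => d; rewrite /powR gt_eqF.
    apply: cvgM; first exact: cvg_cst.
    apply: (continuous_comp (f := fun c => c * ln x)); last exact: continuous_expR.
    by apply: cvgM; [exact: cvg_id|exact: cvg_cst].
  by move=> c; apply: cvgD; exact: cont.
have [c] : exists2 c, c \in `[0, 2] & f c = 1.
  apply: IVT => //; first exact: continuous_subspaceT.
  by rewrite ge_min le_max (ltW f0) (ltW f2) orbT.
rewrite in_itv/= => /andP[c0 c2] fc.
exists c; split.
  split => //; rewrite !lt_neqAle c0 c2 !andbT; apply/andP; split.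
    by apply/eqP => ce; move: f0; rewrite ce fc ltxx.
  by apply/eqP => ce; move: f2; rewrite -ce fc ltxx.
move=> d [_]; rewrite -/(f d) => fd.
have [cd|dc|//] := ltgtP c d.
  by have := mono _ _ cd; rewrite fd fc ltxx.
by have := mono _ _ dc; rewrite fd fc ltxx.
Qed.

Lemma gt_c1_lt1 a b c alpha : 0 < a < 1 -> 0 < b < 1 -> is_c1 a b c -> c < alpha ->
  2 * a `^ alpha + 2 * b `^ alpha < 1.
Proof.
by move=> a01 b01 [_ cE] ca; rewrite -[ltRHS]cE ltrD// ltr_pM2l// powR_lt_exponent.
Qed.

Lemma c2C a b : c2 a b = c2 b a.
Proof. by rewrite /c2 eq_sym distrC. Qed.

(** For [a < b], comparing [2 a^alpha] with [b^alpha] amounts to comparing [ln 2] with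
    [alpha (ln b - ln a)]. For [a = b], [2 a^alpha] always wins, in accordance with the infinite
    value of [c2]. *)
Let c2_compare a b alpha : 0 < a -> a <= b -> 0 < alpha ->
  ((alpha%:E < c2 a b)%E -> b `^ alpha < 2 * a `^ alpha) /\
  ((c2 a b < alpha%:E)%E -> 2 * a `^ alpha < b `^ alpha).
Proof.
move=> a0; rewrite le_eqVlt => /predU1P[<-|ab] alpha0.
  rewrite /c2 eqxx; split=> [_|].
    by rewrite mulrC ltr_pMr ?ltr1n// powR_gt0.
  by rewrite ltNge leey.
have b0 : 0 < b by exact: lt_trans ab.
have lab : 0 < ln b - ln a by rewrite subr_gt0 ltr_ln.
rewrite /c2 lt_eqF// ltr0_norm; last by rewrite -oppr_gt0 opprB.
rewrite opprB !lte_fin ltr_pdivlMr// ltr_pdivrMr//.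
have E2 : 2 * a `^ alpha = expR (ln 2 + alpha * ln a).
  by rewrite expRD lnK ?posrE// /powR gt_eqF.
have Eb : b `^ alpha = expR (alpha * ln b) by rewrite /powR gt_eqF.
rewrite E2 Eb !ltr_expR mulrBr ltrBlDr ltrBrDr; split => //.
Qed.

Lemma lt_c2_powR a b alpha : 0 < a -> 0 < b -> 0 < alpha -> (alpha%:E < c2 a b)%E ->
  Num.max a b `^ alpha < 2 * Num.min a b `^ alpha.
Proof.
move=> a0 b0 alpha0; case: (leP a b) => [ab|/ltW ba].
  exact: (c2_compare a0 ab alpha0).1.
rewrite c2C; exact: (c2_compare b0 ba alpha0).1.
Qed.

Lemma gt_c2_powR a b alpha : 0 < a -> 0 < b -> 0 < alpha -> (c2 a b < alpha%:E)%E ->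
  2 * Num.min a b `^ alpha < Num.max a b `^ alpha.
Proof.
move=> a0 b0 alpha0; case: (leP a b) => [ab|/ltW ba].
  exact: (c2_compare a0 ab alpha0).2.
rewrite c2C; exact: (c2_compare b0 ba alpha0).2.
Qed.

(** [c2] depends only on the ratio of [a] and [b], and [c1] then fixes the scale: the ratio
    [q = 2^(1/gam)] has logarithm [ln 2 / gam], and [b^eps = 1 / s] solves
    [2 (q^eps + 1) b^eps = 1]. *)
Lemma exists_critical_pair gam eps : 0 < gam < 2 -> 0 < eps < gam ->
  exists a b, [/\ 0 < a < 1, 0 < b < 1, 2 * a ^+ 2 + 2 * b ^+ 2 < 1,
    is_c1 a b eps & c2 a b = gam%:E].
Proof.
have halves (x y : R) : 2 * x + 2 * y = 1 -> 0 < x -> 0 < y -> x < 1 /\ y < 1.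
  by move=> *; lra.
move=> /andP[g0 g2] /andP[e0 eg].
have e2 : eps < 2 by exact: lt_trans g2.
pose q : R := 2 `^ gam^-1; pose s := 2 * (q `^ eps + 1).
have q0 : 0 < q by rewrite powR_gt0.
have q1 : 1 < q.
  have : 1 `^ gam^-1 < q by apply: gt0_ltr_powR; rewrite ?invr_gt0 ?nnegrE ?ltr1n.
  by rewrite powR1.
have qe0 : 0 < q `^ eps by rewrite powR_gt0.
have s0 : 0 < s by rewrite mulr_gt0// addr_gt0.
pose b := (s^-1) `^ eps^-1; pose a := q * b.
have b0 : 0 < b by apply: powR_gt0; rewrite invr_gt0.
have a0 : 0 < a by rewrite mulr_gt0.
have be : b `^ eps = s^-1.
  by rewrite /b -powRrM mulVf ?gt_eqF// powRr1// invr_ge0 ltW.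
have ae : a `^ eps = q `^ eps * s^-1 by rewrite /a powRM ?be// ltW.
have c1E : 2 * a `^ eps + 2 * b `^ eps = 1.
  rewrite ae be; have -> : 2 * (q `^ eps / s) + 2 / s = s / s by rewrite /s; ring.
  by rewrite divff// gt_eqF.
have lt1 x : 0 < x -> x `^ eps < 1 -> x < 1.
  move=> x0 xe; rewrite ltNge; apply/negP => x1; move: xe; rewrite ltNge => /negP; apply.
  have : 1 `^ eps <= x `^ eps by apply: ge0_ler_powR; rewrite ?nnegrE// ltW.
  by rewrite powR1.
have [/(lt1 _ a0) a1 /(lt1 _ b0) b1] := halves _ _ c1E (powR_gt0 eps a0) (powR_gt0 eps b0).
have a01 : 0 < a < 1 by rewrite a0.
have b01 : 0 < b < 1 by rewrite b0.
have isc : is_c1 a b eps by split => //; rewrite e0.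
exists a, b; split => //.
  by have := gt_c1_lt1 a01 b01 isc e2; rewrite !powR_mulrn ?(ltW a0) ?(ltW b0).
have ba : b < a by rewrite /a ltr_pMl.
rewrite /c2 gt_eqF//; congr EFin.
have -> : ln a - ln b = ln 2 / gam.
  by rewrite /a lnM ?posrE// addrK /q ln_powR mulrC.
have l2 : 0 < ln 2 :> R by rewrite ln_gt0// ltr1n.
rewrite gtr0_norm ?divr_gt0// invf_div mulrCA divff ?mulr1// gt_eqF//.
Qed.

End Exponents.

(** * Permutations of coordinates and exchangeable threshold events *)

Lemma perm_to_initial_segment (n : nat) (A : {set 'I_n}) :
  exists s : 'S_n, forall i, (s i \in A) = (i < #|A|)%N.
Proof.
pose l := enum A ++ enum (finset.setC A).
have size_l : size l = n by rewrite size_cat -!cardE cardsC card_ord.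
have uniq_l : uniq l.
  rewrite cat_uniq !enum_uniq andbT; apply/hasPn => x.
  by rewrite !mem_enum finset.in_setC.
pose f (i : 'I_n) := tnth (tcast size_l (in_tuple l)) i.
have fE i : f i = nth i l i by rewrite /f (tnth_nth i) val_tcast.
have inj_f : injective f.
  move=> i j; rewrite !fE (set_nth_default i) ?size_l// => /eqP.
  by rewrite nth_uniq ?size_l// => /eqP/val_inj.
exists (perm inj_f) => i; rewrite permE fE nth_cat -cardE.
case: ltnP => iA; first by rewrite -mem_enum mem_nth// -cardE.
apply/negbTE; rewrite -finset.in_setC -mem_enum mem_nth// -cardE.
by rewrite ltn_subLR// cardsC card_ord.
Qed.

Lemma perm_of_list (n : nat) (l : seq nat) : size l = n -> uniq l ->
  all (fun j => j < n)%N l -> exists s : 'S_n, forall i, s i = nth 0%N l i :> nat.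
Proof.
move=> size_l uniq_l all_l.
have lt_l (i : 'I_n) : (nth 0 l i < n)%N.
  by apply: (allP all_l); rewrite mem_nth ?size_l.
have inj_f : injective (fun i => Ordinal (lt_l i)).
  move=> i j /(congr1 val)/= /eqP; rewrite nth_uniq ?size_l// => /eqP.
  exact: val_inj.
by exists (perm inj_f) => i; rewrite permE.
Qed.

Section ExchangeableThreshold.
Context {R : realType} {d : measure_display} {T : measurableType d}.
Variables (P : probability T R) (n : nat) (X : T -> n.-tuple R).
Hypothesis mX : measurable_fun setT X.

Lemma measurable_threshold h i : measurable [set w | threshold X h i w].
Proof.
have : measurable_fun setT (fun w => tnth (X w) i).
  exact: (measurableT_comp (measurable_tnth i) mX).
move=> /(_ measurableT _ (measurable_itv `]h, +oo[)); rewrite setTI.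
congr measurable; apply/seteqP; split => w; by rewrite /= in_itv/= andbT.
Qed.

Lemma exchangeable_threshold h (A : {set 'I_n}) : exchangeable P X ->
  P [set w | forall i, i \in A -> threshold X h i w] =
  P [set w | forall i : 'I_n, (i < #|A|)%N -> threshold X h i w].
Proof.
move=> exX; have [s sA] := perm_to_initial_segment A.
pose B := [set x : n.-tuple R | forall i : 'I_n, (i < #|A|)%N -> h < tnth x i].
have mB : measurable B.
  rewrite (_ : B = \bigcap_(i in [set i : 'I_n | (i < #|A|)%N])
      ((fun x : n.-tuple R => tnth x i) @^-1` `]h, +oo[%classic)).
    apply: fin_bigcap_measurable => // i _; rewrite -[X in measurable X]setTI.
    exact: measurable_tnth.
  by apply/seteqP; split => x Bx i iA; have := Bx i iA; rewrite /= in_itv/= andbT.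
rewrite -[RHS](exX s B mB); congr (P _); apply/seteqP; split => w /= Bw i iA.
  by rewrite tnth_mktuple; apply: Bw; rewrite sA.
have := Bw (s^-1%g i); rewrite -sA permKV => /(_ iA).
by rewrite tnth_mktuple permKV.
Qed.

End ExchangeableThreshold.

(** * The coefficients of X_alpha and its joint tails *)

Section Model.
Context {R : realType}.
Variables (a b alpha : R).
Hypothesis a0 : 0 < a.
Hypothesis b0 : 0 < b.
Hypothesis alpha0 : 0 < alpha.
Hypothesis defX : X_defined a b alpha.

Let r := (1 - 2 * a `^ alpha - 2 * b `^ alpha) `^ alpha^-1.

(** The first six columns are the six arrangements of [a], [b], [0], each occurring once; the last
    column is constant. *)
Definition coefX (i : 'I_3) (k : 'I_7) : R :=
  nth 0 (nth [::] [:: [:: a; b; 0; b; a; 0; r]; [:: 0; a; b; 0; b; a; r];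
    [:: b; 0; a; a; 0; b; r]] i) k.

Let r0 : 0 <= r. Proof. exact: powR_ge0. Qed.

Let r_alpha : r `^ alpha = 1 - 2 * a `^ alpha - 2 * b `^ alpha.
Proof. by rewrite /r -powRrM mulVf ?gt_eqF// powRr1. Qed.

Lemma coefX_ge0 i k : 0 <= coefX i k.
Proof.
have [a_ge0 b_ge0] := (ltW a0, ltW b0); rewrite /coefX.
case: i => [[|[|[|//]]] /= _]; by case: k => [[|[|[|[|[|[|[|//]]]]]]] /= _].
Qed.

(** A permutation of the rows permutes the six arrangements of [a], [b], [0] among themselves and
    fixes the constant column. *)
Lemma coefX_perm (s : 'S_3) :
  exists sg : 'S_7, forall i k, coefX (s i) (sg k) = coefX i k.
Proof.
pose i0 : 'I_3 := ord0; pose i1 : 'I_3 := Ordinal (isT : 1 < 3)%N.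
pose i2 : 'I_3 := Ordinal (isT : 2 < 3)%N.
have allP3 (Q : 'I_3 -> Prop) : Q i0 -> Q i1 -> Q i2 -> forall i, Q i.
  move=> q0 q1 q2 [[|[|[|//]]] H].
  - by rewrite (_ : Ordinal H = i0)//; exact: val_inj.
  - by rewrite (_ : Ordinal H = i1)//; exact: val_inj.
  - by rewrite (_ : Ordinal H = i2)//; exact: val_inj.
have witness (l : seq nat) : [&& size l == 7%N, uniq l & all (fun j => j < 7)%N l] ->
    (forall i (k : 'I_7), coefX (s i) (inord (nth 0%N l k)) = coefX i k) ->
    exists sg : 'S_7, forall i k, coefX (s i) (sg k) = coefX i k.
  move=> /and3P[/eqP sl ul al] H; have [sg sgE] := perm_of_list sl ul al.
  by exists sg => i k; rewrite -[RHS]H -sgE inord_val.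
have s01 : s i0 != s i1 by rewrite (inj_eq perm_inj).
have s02 : s i0 != s i2 by rewrite (inj_eq perm_inj).
have s12 : s i1 != s i2 by rewrite (inj_eq perm_inj).
have concl l (p0 p1 p2 : 'I_3) : s i0 = p0 -> s i1 = p1 -> s i2 = p2 ->
    [&& size l == 7%N, uniq l & all (fun j => j < 7)%N l] ->
    (forall k : 'I_7, [/\ coefX p0 (inord (nth 0%N l k)) = coefX i0 k,
       coefX p1 (inord (nth 0%N l k)) = coefX i1 k &
       coefX p2 (inord (nth 0%N l k)) = coefX i2 k]) ->
    exists sg : 'S_7, forall i k, coefX (s i) (sg k) = coefX i k.
  move=> <- <- <- ll H; apply: (witness l ll); apply: allP3 => k; by have [] := H k.
move: s01 s02 s12.
case E0: (s i0) => [[|[|[|//]]] /= lt0]; case E1: (s i1) => [[|[|[|//]]] /= lt1];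
  case E2: (s i2) => [[|[|[|//]]] /= lt2] // _ _ _.
(* The cases come in lexicographic order of [(s 0, s 1, s 2)]; each list sends a column to the one
   with the same entries at the permuted rows. *)
- apply: (concl [:: 0; 1; 2; 3; 4; 5; 6] _ _ _ E0 E1 E2) => // k.
  by split; rewrite /coefX inordK//; case: k => [[|[|[|[|[|[|[|//]]]]]]]].
- apply: (concl [:: 4; 3; 5; 1; 0; 2; 6] _ _ _ E0 E1 E2) => // k.
  by split; rewrite /coefX inordK//; case: k => [[|[|[|[|[|[|[|//]]]]]]]].
- apply: (concl [:: 5; 4; 3; 2; 1; 0; 6] _ _ _ E0 E1 E2) => // k.
  by split; rewrite /coefX inordK//; case: k => [[|[|[|[|[|[|[|//]]]]]]]].
- apply: (concl [:: 1; 2; 0; 4; 5; 3; 6] _ _ _ E0 E1 E2) => // k.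
  by split; rewrite /coefX inordK//; case: k => [[|[|[|[|[|[|[|//]]]]]]]].
- apply: (concl [:: 2; 0; 1; 5; 3; 4; 6] _ _ _ E0 E1 E2) => // k.
  by split; rewrite /coefX inordK//; case: k => [[|[|[|[|[|[|[|//]]]]]]]].
- apply: (concl [:: 3; 5; 4; 0; 2; 1; 6] _ _ _ E0 E1 E2) => // k.
  by split; rewrite /coefX inordK//; case: k => [[|[|[|[|[|[|[|//]]]]]]]].
Qed.

Let sum_ord7 (F : nat -> R) :
  \sum_(k < 7) F k = F 0%N + F 1%N + F 2%N + F 3%N + F 4%N + F 5%N + F 6%N.
Proof. by rewrite !big_ord_recr big_ord0 /= add0r. Qed.

Section Realization.
Context {d : measure_display} {T : measurableType d} (P : probability T R).
Variable S : 'I_7 -> {RV P >-> R}.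

Lemma XvecE : Xvec a b alpha (fun i => S i) = linear_image coefX S.
Proof.
apply/funext => w; apply: eq_from_tnth => i; rewrite tnth_mktuple.
pose F j := nth 0 (nth [::] [:: [:: a; b; 0; b; a; 0; r]; [:: 0; a; b; 0; b; a; r];
    [:: b; 0; a; a; 0; b; r]] i) j * S (inord j) w.
rewrite (eq_bigr (fun k : 'I_7 => F k)); last first.
  by move=> k _; rewrite /F inord_val.
rewrite sum_ord7 /F (tnth_nth 0).
case: i F => [[|[|[|//]]] /= _] _; rewrite -/r; ring.
Qed.

Hypothesis iidS : iid_standard_stable alpha S.

Lemma Xvec_symmetric_stable : symmetric_stable P alpha (Xvec a b alpha (fun i => S i)).
Proof. by case: iidS => indS idS stS; rewrite XvecE; exact: symmetric_stable_linear_image. Qed.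

Lemma Xvec_exchangeable : exchangeable P (Xvec a b alpha (fun i => S i)).
Proof.
case: iidS => indS idS stS; rewrite XvecE.
exact: exchangeable_linear_image indS idS coefX_perm.
Qed.

Let nu h (k : nat) : R :=
  fine (P [set w | forall i : 'I_3, (i < k)%N ->
    threshold (Xvec a b alpha (fun i => S i)) h i w]).

Lemma Xvec_threshold_asymptotics : alpha < 2 -> exists K : R, [/\ 0 < K,
  h `^ alpha * nu h 1 @[h --> +oo] --> K,
  h `^ alpha * nu h 2 @[h --> +oo] -->
    K * (2 * Num.min a b `^ alpha + (1 - 2 * a `^ alpha - 2 * b `^ alpha)) &
  h `^ alpha * nu h 3 @[h --> +oo] -->
    K * (1 - 2 * a `^ alpha - 2 * b `^ alpha)].
Proof.
move=> alpha2; case: iidS => indS idS stS.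
have alpha02 : 0 < alpha < 2 by rewrite alpha0.
have cs := iid_stable_cos_sin idS stS ord0.
have [K [K0 cK cK']] := stable_tail alpha02 (measurable_funPT (S ord0))
  (fun th => (cs th).1) (fun th => (cs th).2).
have jump k (mm : 'I_7 -> R) :
    (forall (i : 'I_3) j, (i < k)%N -> mm j <= coefX i j) ->
    (forall j, exists2 i : 'I_3, (i < k)%N & coefX i j = mm j) ->
    h `^ alpha * nu h k @[h --> +oo] --> K * \sum_(j < 7) mm j `^ alpha.
  move=> mm_le mm_ex.
  have := @big_jump _ _ _ _ _ _ _ alpha0 _ _ coefX_ge0 indS idS _ _ (ltW K0) cK cK'
    [set i : 'I_3 | (i < k)%N]%SET mm.
  rewrite (_ : (fun h => _) = (fun h => h `^ alpha * nu h k)); last first.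
    apply/funext => h; congr (_ * fine (P _)); rewrite /threshold XvecE.
    apply/seteqP; split => w /= H i ik.
      by rewrite tnth_mktuple; apply: H; rewrite finset.inE.
    by move: ik; rewrite finset.inE => /H; rewrite tnth_mktuple.
  apply.
    by move=> i j; rewrite finset.inE; exact: mm_le.
  by move=> j; have [i iA ij] := mm_ex j; exists i => //; rewrite finset.inE.
have z : 0 `^ alpha = 0 :> R by rewrite powR0// gt_eqF.
exists K; split => //.
- have := jump 1%N (coefX ord0).
  rewrite /coefX (sum_ord7 (fun j => nth 0 _ j `^ alpha))/= r_alpha z.
  rewrite [X in K * X](_ : _ = 1); last by ring.
  rewrite mulr1; apply.
    by move=> i j; rewrite ltnS leqn0 => /eqP i0; rewrite i0.
  by move=> j; exists ord0.
(* In the first two rows only the columns 1, 4 and 6 are free of zeros; columns 1 and 4 hold both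
   [a] and [b]. *)
- have := jump 2%N (fun j => nth 0 [:: 0; Num.min a b; 0; 0; Num.min a b; 0; r] j).
  rewrite (sum_ord7 (fun j => nth 0 _ j `^ alpha))/= r_alpha z.
  rewrite [X in K * X](_ : _ = 2 * Num.min a b `^ alpha + (1 - 2 * a `^ alpha - 2 * b `^ alpha)); last by ring.
  apply.
    move=> i j; rewrite /coefX; case: i => [[|[|//]] /= _] _;
    case: j => [[|[|[|[|[|[|[|//]]]]]]] /= _]; rewrite ?ge_min ?lexx ?orbT ?(ltW a0) ?(ltW b0)//.
  (* The lists name, column by column, a row attaining the minimum; they differ at columns 1 and 4,
     where the order of [a] and [b] decides. *)
  have [ab|/ltW ba] := leP a b.
    move=> j; exists (inord (nth 0%N [:: 1; 1; 0; 1; 0; 0; 0]%N j)); rewrite /coefX ?inordK//;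
    by case: j => [[|[|[|[|[|[|[|//]]]]]]] /= _].
  move=> j; exists (inord (nth 0%N [:: 1; 0; 0; 1; 1; 0; 0]%N j)); rewrite /coefX ?inordK//;
    by case: j => [[|[|[|[|[|[|[|//]]]]]]] /= _].
have := jump 3%N (fun j => nth 0 [:: 0; 0; 0; 0; 0; 0; r] j).
rewrite (sum_ord7 (fun j => nth 0 _ j `^ alpha))/= r_alpha z.
rewrite !add0r; apply.
  move=> i j _; have := coefX_ge0 i j; rewrite /coefX.
  case: j => [[|[|[|[|[|[|[|//]]]]]]] /= _] //.
  by case: i => [[|[|[|//]]]].
move=> j; exists (inord (nth 0%N [:: 1; 2; 0; 1; 2; 0; 0]%N j)); rewrite /coefX ?inordK//;
  by case: j => [[|[|[|[|[|[|[|//]]]]]]] /= _].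
Qed.

Let mX : measurable_fun setT (Xvec a b alpha (fun i => S i)).
Proof. by rewrite XvecE; exact: measurable_linear_image. Qed.

Let nuE h (A : {set 'I_3}) :
  fine (P [set w | forall i, i \in A -> threshold (Xvec a b alpha (fun i => S i)) h i w]) =
  nu h #|A|.
Proof.
by congr fine; exact: (exchangeable_threshold h A Xvec_exchangeable).
Qed.

Let powR_max_min : a `^ alpha + b `^ alpha = Num.max a b `^ alpha + Num.min a b `^ alpha.
Proof. by case: (leP a b) => // _; rewrite addrC. Qed.

Lemma Xvec_eventually_not_color : alpha < 2 ->
  Num.max a b `^ alpha < 2 * Num.min a b `^ alpha ->
  eventually_not_color P (Xvec a b alpha (fun i => S i)).
Proof.
move=> alpha2 lt; have [K [K0 c1 c2 c3]] := Xvec_threshold_asymptotics alpha2.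
have neg : 2 * (1 - 2 * a `^ alpha - 2 * b `^ alpha) - 3 * (2 * Num.min a b `^ alpha +
    (1 - 2 * a `^ alpha - 2 * b `^ alpha)) + 1 < 0.
  move: lt powR_max_min.
  move: (a `^ _) (b `^ _) (Num.max a b `^ _) (Num.min a b `^ _) => x y M m; lra.
have [h0 [_ H]] := asymptotic_color_violation alpha0 K0 c1 c2 c3 neg.
exists h0 => h /H[nu1 viol] col.
have := color3_necessary (measurable_threshold mX h) (nuE h) nu1 col.
by rewrite leNgt viol.
Qed.

Lemma Xvec_eventually_color : alpha < 2 ->
  0 < 1 - 2 * a `^ alpha - 2 * b `^ alpha ->
  2 * Num.min a b `^ alpha < Num.max a b `^ alpha ->
  eventually_color P (Xvec a b alpha (fun i => S i)).
Proof.
move=> alpha2 rpos lt; have [K [K0 c1 c2 c3]] := Xvec_threshold_asymptotics alpha2.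
have m0 : 0 < Num.min a b `^ alpha by rewrite powR_gt0// lt_min a0.
have rt : 1 - 2 * a `^ alpha - 2 * b `^ alpha <
    2 * Num.min a b `^ alpha + (1 - 2 * a `^ alpha - 2 * b `^ alpha).
  by rewrite ltrDr mulr_gt0.
have pos : 0 < 2 * (1 - 2 * a `^ alpha - 2 * b `^ alpha) - 3 * (2 * Num.min a b `^ alpha +
    (1 - 2 * a `^ alpha - 2 * b `^ alpha)) + 1.
  move: lt powR_max_min.
  move: (a `^ _) (b `^ _) (Num.max a b `^ _) (Num.min a b `^ _) => x y M m; lra.
have [h0 [_ H]] := asymptotic_color_weights alpha0 K0 c1 c2 c3 rpos rt pos.
exists h0 => h /H[wA [wB [wC [[p01 wA0 wB0 wC0] [w1 n2 n3]]]]].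
exact: (color3_sufficient (measurable_threshold mX h) (nuE h) p01 wA0 wB0 wC0 w1 erefl n2 n3).
Qed.

End Realization.

End Model.

Theorem theorem1p10 (R : realType) :
  (forall a b : R, 0 < a < 1 -> 0 < b < 1 -> 2 * a ^+ 2 + 2 * b ^+ 2 < 1 ->
    (exists! c1 : R, is_c1 a b c1) /\
    forall c1 : R, is_c1 a b c1 ->
    [/\ forall alpha : R, c1 < alpha < 2 ->
          X_defined a b alpha /\ X_stable_exchangeable a b alpha,
        (c2 a b <= c1%:E)%E ->
          forall alpha : R, c1 < alpha < 2 -> X_color_large_h a b alpha,
        (2%:E <= c2 a b)%E ->
          forall alpha : R, c1 < alpha < 2 -> X_not_color_large_h a b alpha
      & (c1%:E < c2 a b < 2%:E)%E ->
          (forall alpha : R, c1 < alpha -> (alpha%:E < c2 a b)%E ->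
             X_not_color_large_h a b alpha) /\
          (forall alpha : R, (c2 a b < alpha%:E)%E -> alpha < 2 ->
             X_color_large_h a b alpha)]) /\
  (forall alphac epsilon : R, 0 < alphac < 2 -> 0 < epsilon < alphac ->
    exists a b : R,
      [/\ 0 < a < 1, 0 < b < 1, 2 * a ^+ 2 + 2 * b ^+ 2 < 1,
          is_c1 a b epsilon & c2 a b = alphac%:E] /\
      [/\ forall alpha : R, epsilon < alpha < 2 -> X_defined a b alpha,
          forall alpha : R, epsilon < alpha < alphac ->
            X_not_color_large_h a b alpha
        & forall alpha : R, alphac < alpha < 2 -> X_color_large_h a b alpha]).
Proof.
have defd (a b c alpha : R) : 0 < a < 1 -> 0 < b < 1 -> is_c1 a b c -> c < alpha ->
    0 < 1 - 2 * a `^ alpha - 2 * b `^ alpha.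
  by move=> a01 b01 ic ca; rewrite -addrA -opprD subr_gt0 (gt_c1_lt1 a01 b01 ic ca).
have defd' (a b c alpha : R) : 0 < a < 1 -> 0 < b < 1 -> is_c1 a b c -> c < alpha ->
    X_defined a b alpha.
  by move=> a01 b01 ic ca; apply: ltW; exact: (defd _ _ _ _ a01 b01 ic ca).
(* Every case of the theorem reduces to [notcol] and [col]: for [alpha] between [c1] and 2 the
   outcome depends only on the side of [c2] on which [alpha] lies. *)
have notcol (a b c alpha : R) : 0 < a < 1 -> 0 < b < 1 -> is_c1 a b c -> c < alpha < 2 ->
    (alpha%:E < c2 a b)%E -> X_not_color_large_h a b alpha.
  move=> a01 b01 ic /andP[ca a2] lt d T P S iid.
  have [/andP[a0 _] /andP[b0 _]] := (a01, b01).
  have al0 : 0 < alpha by apply: lt_trans ca; case: ic => /andP[].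
  apply: Xvec_eventually_not_color => //; first exact: (defd' _ _ _ _ a01 b01 ic ca).
  exact: lt_c2_powR.
have col (a b c alpha : R) : 0 < a < 1 -> 0 < b < 1 -> is_c1 a b c -> c < alpha < 2 ->
    (c2 a b < alpha%:E)%E -> X_color_large_h a b alpha.
  move=> a01 b01 ic /andP[ca a2] lt d T P S iid.
  have [/andP[a0 _] /andP[b0 _]] := (a01, b01).
  have al0 : 0 < alpha by apply: lt_trans ca; case: ic => /andP[].
  have dp := defd _ _ _ _ a01 b01 ic ca.
  apply: Xvec_eventually_color => //; first exact: (defd' _ _ _ _ a01 b01 ic ca).
  exact: gt_c2_powR.
split.
  move=> a b a01 b01 lt1; split; first exact: is_c1_exists.
  move=> c ic; split.
  - move=> alpha /andP[ca a2]; split; first exact: (defd' _ _ _ _ a01 b01 ic ca).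
    move=> d T P S iid.
    have al0 : 0 < alpha by apply: lt_trans ca; case: ic => /andP[].
    split; [exact: Xvec_symmetric_stable|exact: Xvec_exchangeable].
  - move=> c21 alpha /[dup] ca2 /andP[ca _]; apply: (col _ _ _ _ a01 b01 ic ca2).
    by apply: (le_lt_trans c21); rewrite lte_fin.
  - move=> c22 alpha /[dup] ca2 /andP[_ a2]; apply: (notcol _ _ _ _ a01 b01 ic ca2).
    by apply: lt_le_trans c22; rewrite lte_fin.
  - move=> /andP[cc2 c22]; split => alpha.
      move=> ca ac2; apply: (notcol _ _ _ _ a01 b01 ic) => //; rewrite ca/=.
      by have := lt_trans ac2 c22; rewrite lte_fin.
    move=> c2a a2; apply: (col _ _ _ _ a01 b01 ic) => //; rewrite a2 andbT.
    by have := lt_trans cc2 c2a; rewrite lte_fin.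
move=> gam eps gam02 eps0gam.
have [a [b [a01 b01 lt1 ic c2E]]] := exists_critical_pair gam02 eps0gam.
have [/andP[g0 g2] /andP[e0 eg]] := (gam02, eps0gam).
exists a, b; split => //; split.
- by move=> alpha /andP[ca _]; exact: (defd' _ _ _ _ a01 b01 ic ca).
- move=> alpha /andP[ea ag]; apply: (notcol _ _ _ _ a01 b01 ic).
    by rewrite ea/= (lt_trans ag).
  by rewrite c2E lte_fin.
- move=> alpha /andP[ga a2]; apply: (col _ _ _ _ a01 b01 ic).
    by rewrite a2 andbT (lt_trans eg).
  by rewrite c2E lte_fin.
Qed.
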